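(* Let $\omega\in\mathcal{W}$. Then there is a constant $C_3=C_3(C,C',C'',\sigma)>0$ such that $$\rho_\tau(z,w)\leq C_3\,\mathcal{S}(z,w)\qquad\text{for all } z,w\in\mathbb{D}.$$
   Context: $\mathbb{D}$ is the open unit disk, $dA$ the normalized area measure on $\mathbb{D}$, $H(\mathbb{D})$ the space of holomorphic functions on $\mathbb{D}$. Weights are positive integrable radial functions $\omega=e^{-\eta}$ on $\mathbb{D}$, where $\eta$ is a radial function, strictly increasing in $|z|$, with $\Delta\eta>0$ on $\mathbb{D}$. Such a weight belongs to the class $\mathcal{W}$ if there is a differentiable radial function $\tau>0$, $\tau(z)=\tau(|z|)$, such that $(\Delta\eta(z))^{-1/2}$ and $\tau(z)$ are comparable (each bounded by a positive constant times the other on $\mathbb{D}$), $\lim_{r\to1^-}\tau(r)=0$ and $\lim_{r\to1^-}\tau'(r)=0$; for $\omega\in\mathcal{W}$ such a $\tau$ is fixed. $A^2(\omega)$ is the Hilbert space of $f\in H(\mathbb{D})$ with $\|f\|^2=\int_{\mathbb{D}}|f\omega|^2\,dA<\infty$, with inner product $\langle f,g\rangle_\omega=\int_{\mathbb{D}}f\overline g\,\omega^2\,dA$; its reproducing kernel is $K(z,w)=\overline{K_z(w)}$, where $f(z)=\langle f,K_z\rangle_\omega$. Define $d_\tau(z,w)=\inf_\gamma\int_0^1\frac{|\gamma'(t)|}{\tau(\gamma(t))}\,dt$, the infimum over piecewise smooth curves $\gamma:[0,1]\to\mathbb{D}$ connecting $z$ and $w$, and $\rho_\tau(z,w)=1-e^{-d_\tau(z,w)}$.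 The Skwarczyński pseudodistance is $$\mathcal{S}(z,w)=\left(1-\frac{|K(z,w)|}{\|K_z\|\|K_w\|}\right)^{1/2}.$$ The constants are those in the following known estimates for $\omega\in\mathcal{W}$: $e^{-d_\tau(z,w)}\le C\left(\frac{\min(\tau(z),\tau(w))}{|z-w|}\right)^M$ for $z\ne w$ (for each $M>0$ there is such $C=C(M)>1$); $|K(z,w)|\omega(z)\omega(w)\le\frac{C'}{\tau(z)\tau(w)}e^{-\sigma d_\tau(z,w)}$ for all $z,w\in\mathbb{D}$, with $\sigma>0$; and $|K(z,w)|\omega(z)\omega(w)\ge\frac{C''}{\tau(z)\tau(w)}$ for $d_\tau(z,w)<R$ with a suitable $R>0$. *)

(* Defs.v *)
From mathcomp Require Import all_boot all_order all_algebra.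
From mathcomp Require Import all_classical all_reals all_analysis.
From mathcomp Require Import complex.

Set Implicit Arguments.
Unset Strict Implicit.
Unset Printing Implicit Defensive.

Import Order.TTheory GRing.Theory Num.Theory.
Import numFieldNormedType.Exports.
Import ComplexField.Normc.

Local Open Scope classical_set_scope.
Local Open Scope ring_scope.
Local Open Scope complex_scope.

Section Disk.
Variable R : realType.

Definition disk : set R[i] := [set z | normc z < 1].

(* The plane R * R carries the real differential calculus and the area measure;
   R[i] carries the complex calculus. *)
Definition cplx (p : R * R) : R[i] := p.1 +i* p.2.
Definition disk2 : set (R * R) := cplx @^-1` disk.

Lemma pi_inv_ge0 : (0 : R) <= pi^-1.
Proof. by rewrite invr_ge0 pi_ge0. Qed.

Definition dA : {measure set (measurableTypeR R * measurableTypeR R) -> \bar R} :=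
  mscale (NngNum pi_inv_ge0) (@lebesgue_measure R \x @lebesgue_measure R)%E.

(* 'derivable' over the scalar field R[i] is complex differentiability. *)
Definition holomorphic_disk (f : R[i] -> R[i]) : Prop :=
  forall z, disk z -> derivable (f : R[i]^o -> R[i]^o) z 1.

Definition radial (u : R[i] -> R) : Prop :=
  forall z w, disk z -> disk w -> normc z = normc w -> u z = u w.

Definition dir_x : R * R := (1, 0).
Definition dir_y : R * R := (0, 1).

Definition has_pure_second_partials (u : R[i] -> R) : Prop :=
  forall p e, disk2 p -> e = dir_x \/ e = dir_y ->
    derivable (u \o cplx) p e /\ derivable ('D_e (u \o cplx)) p e.

Definition laplacian (u : R[i] -> R) (z : R[i]) : R :=
  let p := (complex.Re z, complex.Im z) in
  'D_dir_x ('D_dir_x (u \o cplx)) p + 'D_dir_y ('D_dir_y (u \o cplx)) p.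

(* Positivity of omega is implied by omega = exp (- eta). *)
Record weight (omega eta : R[i] -> R) : Prop := Weight {
  weight_exp : forall z, disk z -> omega z = expR (- eta z) ;
  weight_integrable : dA.-integrable disk2 (EFin \o omega \o cplx) ;
  weight_radial : radial eta ;
  weight_incr : forall z w, disk z -> disk w -> normc z < normc w -> eta z < eta w ;
  weight_second_partials : has_pure_second_partials eta ;
  weight_laplacian : forall z, disk z -> 0 < laplacian eta z }.

Record classW (omega eta tau : R[i] -> R) : Prop := ClassW {
  classW_weight : weight omega eta ;
  classW_pos : forall z, disk z -> 0 < tau z ;
  classW_radial : radial tau ;
  classW_differentiable : forall p, disk2 p -> differentiable (tau \o cplx) p ;
  classW_comparable : exists a b : R, [/\ 0 < a, 0 < b &
    forall z, disk z -> a * tau z <= (Num.sqrt (laplacian eta z))^-1 <= b * tau z] ;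
  classW_lim : tau r%:C @[r --> (1 : R)^'-] --> (0 : R) ;
  classW_lim_deriv :
    derive1 (fun s : R => tau s%:C) r @[r --> (1 : R)^'-] --> (0 : R) }.

Definition A2 (omega : R[i] -> R) (f : R[i] -> R[i]) : Prop :=
  holomorphic_disk f /\
  (\int[dA]_(p in disk2) ((normc (f (cplx p)) * omega (cplx p)) ^+ 2)%:E < +oo)%E.

Definition A2norm (omega : R[i] -> R) (f : R[i] -> R[i]) : R :=
  Num.sqrt (fine
    (\int[dA]_(p in disk2) ((normc (f (cplx p)) * omega (cplx p)) ^+ 2)%:E)).

Definition A2inner (omega : R[i] -> R) (f g : R[i] -> R[i]) : R[i] :=
  let F p := f (cplx p) * conjc (g (cplx p)) * (omega (cplx p) ^+ 2)%:C in
  Rintegral dA disk2 (fun p => complex.Re (F p)) +i*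
  Rintegral dA disk2 (fun p => complex.Im (F p)).

(* The representing function K_z is w |-> conj (K z w). *)
Definition kernel_fun (K : R[i] -> R[i] -> R[i]) (z : R[i]) : R[i] -> R[i] :=
  fun w => conjc (K z w).

Definition reproducing_kernel (omega : R[i] -> R) (K : R[i] -> R[i] -> R[i]) : Prop :=
  forall z, disk z ->
    A2 omega (kernel_fun K z) /\
    forall f, A2 omega f -> f z = A2inner omega f (kernel_fun K z).

Definition C1 (x : R -> R) : Prop :=
  (forall t, derivable x t 1) /\ continuous (derive1 x).

(* On each closed piece the curve is the restriction of a C^1 curve on R. *)
Definition piecewise_smooth (gamma : R -> R[i]) : Prop :=
  exists (n : nat) (t : nat -> R),
    [/\ t 0%N = 0, t n = 1, (forall k, (k < n)%N -> t k < t k.+1) &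
      forall k, (k < n)%N -> exists x y : R -> R, [/\ C1 x, C1 y &
        forall s, t k <= s <= t k.+1 -> gamma s = x s +i* y s]].

(* derive1 is unspecified at the finitely many break points, which do not
   affect the integral. *)
Definition speed (gamma : R -> R[i]) (t : R) : R :=
  normc (derive1 (fun s => complex.Re (gamma s)) t +i*
         derive1 (fun s => complex.Im (gamma s)) t).

Definition tau_length (tau : R[i] -> R) (gamma : R -> R[i]) : \bar R :=
  (\int[@lebesgue_measure R]_(t in `[0%R, 1%R]) (speed gamma t / tau (gamma t))%:E)%E.

Definition connects (gamma : R -> R[i]) (z w : R[i]) : Prop :=
  [/\ piecewise_smooth gamma, forall t, 0 <= t <= 1 -> disk (gamma t),
      gamma 0 = z & gamma 1 = w].

Definition d_tau (tau : R[i] -> R) (z w : R[i]) : R :=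
  fine (ereal_inf [set tau_length tau gamma | gamma in [set gamma | connects gamma z w]]).

Definition rho_tau (tau : R[i] -> R) (z w : R[i]) : R := 1 - expR (- d_tau tau z w).

Definition skwarczynski (omega : R[i] -> R) (K : R[i] -> R[i] -> R[i])
    (z w : R[i]) : R :=
  Num.sqrt (1 - normc (K z w) /
    (A2norm omega (kernel_fun K z) * A2norm omega (kernel_fun K w))).

Definition distance_estimate (tau : R[i] -> R) (C : R -> R) : Prop :=
  forall M z w, 0 < M -> disk z -> disk w -> z <> w ->
    expR (- d_tau tau z w) <=
      C M * (Num.min (tau z) (tau w) / normc (z - w)) `^ M.

Definition kernel_upper_estimate (omega tau : R[i] -> R)
    (K : R[i] -> R[i] -> R[i]) (C' sigma : R) : Prop :=
  forall z w, disk z -> disk w ->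
    normc (K z w) * omega z * omega w <=
      C' / (tau z * tau w) * expR (- (sigma * d_tau tau z w)).

Definition kernel_lower_estimate (omega tau : R[i] -> R)
    (K : R[i] -> R[i] -> R[i]) (C'' rad : R) : Prop :=
  forall z w, disk z -> disk w -> d_tau tau z w < rad ->
    C'' / (tau z * tau w) <= normc (K z w) * omega z * omega w.

End Disk.

(* Main.v *)
Require Import Defs.
From mathcomp Require Import all_boot all_order all_algebra.
From mathcomp Require Import all_classical all_reals all_analysis.
From mathcomp Require Import measurable_realfun complex ring lra.

(** Let b be the point of larger modulus, T = tau b and t = |a - b| / T.

    Lower bound for S.  A function in A2 vanishing at a is tested against the
    projection of K_b to the orthogonal complement of K_a, whose norm is
    comparable to S(a, b) |K_b|.  Testing with (z - a) K_b(z), whose norm is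
    controlled by the off-diagonal decay of K and the distance estimate, gives
    S(a, b) >= c min(1, t).

    Upper bound for d_tau.  It suffices to treat small t and to show d_tau(a, b) <= c t,
    which follows from a lower bound for tau on the path joining a and b in polar
    coordinates.  If T is at most a constant times |b|, a drop of tau on the moduli
    between |a| and |b| would bring a point at Euclidean distance comparable to T
    within bounded d_tau-distance of b, where tau is much smaller than T: this
    contradicts the distance estimate.  If T is much larger than |b|, the potential eta is
    convex in ln |z|, and reproducing the monomial z^n at b shows that its
    logarithmic slope at |b| is less than 1/2; the maximum principle for K_z then gives
    tau z >= c T (|z| / |b|)^(1/2) for |z| <= |b|, and moving the square root of the
    modulus at constant speed yields a short path. *)

Set Implicit Arguments.
Unset Strict Implicit.
Unset Printing Implicit Defensive.
Import Order.TTheory GRing.Theory Num.Theory.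
Import numFieldNormedType.Exports.
Import ComplexField.Normc.
Local Open Scope classical_set_scope.
Local Open Scope ring_scope.
Local Open Scope complex_scope.

(** * Cauchy-Goursat on a rectangle *)

Section Goursat.
Context {R : realType}.
Implicit Types (f : R -> R) (P Q : R -> R -> R) (a b c d e l m x y : R) (k : nat).
Local Notation mu := (@lebesgue_measure R).
Local Notation "\int_[ a , b ] f" := (Rintegral mu `[a, b]%classic f)
  (at level 36, a, b at level 50, f at level 36).

(** [C3] is fixed before the weight, so it may depend neither on the constants comparing [tau] with
    the Laplacian, nor on a Lipschitz bound for [tau], nor on [rad]. The variation of [tau] between
    the two points therefore has to be extracted from the kernel and distance estimates themselves;
    the lower kernel estimate enters on the diagonal, where [d_tau] vanishes, whatever [rad] is.

    The split according to T / |b| is forced by the contradiction argument: it needs a point of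
    modulus |b| at distance comparable to T from b, and there is none when T is much larger than
    |b|. In that regime the bound for [tau] degenerates like the square root of the modulus, which
    is affordable because x^(-1/2) is integrable at 0; this is where the threshold 1/2 for the slope
    comes from. A slope x >= 1/2 leaves room for an integer n with x - n between 1/2 and 3/2. Then
    |z|^n omega decays at least like |z|^(-1/2) outside the circle of b and grows at most like
    |z|^(-3/2) towards the origin, so that the reproducing integral is controlled at both ends. *)

Lemma continuous_itv_integrable f a b :
  (forall x, a <= x <= b -> {for x, continuous f}) ->
  mu.-integrable `[a, b] (EFin \o f).
Proof.
move=> cf; apply: continuous_compact_integrable; first exact: segment_compact.
apply: continuous_in_subspaceT => x; rewrite inE/= in_itv/=; exact: cf.
Qed.

Lemma Rintegral_itv_split f a m b : a <= m <= b ->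
  (forall x, a <= x <= b -> {for x, continuous f}) ->
  \int_[a, b] f = \int_[a, m] f + \int_[m, b] f.
Proof.
move=> /andP[am mb] cf.
have := @Rintegral_itvB R f (BLeft a) (BRight b) m (continuous_itv_integrable cf).
rewrite !bnd_simp => /(_ am mb) /eqP; rewrite subr_eq => /eqP ->; rewrite addrC; congr +%R.
rewrite Rintegral_itv_obnd_cbnd//.
apply: (@integrableS _ _ _ mu `[m, b]) => //.
- by apply: subset_itvr; rewrite bnd_simp.
- by apply: continuous_itv_integrable => x /andP[mx xb]; apply: cf; rewrite xb (le_trans am).
Qed.

Lemma Rintegral_itv_dist f a b l e : a <= b ->
  (forall x, a <= x <= b -> {for x, continuous f}) ->
  (forall x, a <= x <= b -> `|f x - l| <= e) ->
  `|\int_[a, b] f - l * (b - a)| <= e * (b - a).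
Proof.
move=> ab cf fl.
have fi := continuous_itv_integrable cf.
have ci (k : R) : mu.-integrable `[a, b] (EFin \o cst k).
  by apply: continuous_itv_integrable => x _; exact: cvg_cst.
have Ec (k : R) : \int_[a, b] (cst k) = k * (b - a).
  by rewrite Rintegral_cst//= lebesgue_measure_itv/= lte_fin; case: ltgtP ab => //= ->; rewrite subrr.
have lefi (k : R) : (forall x, a <= x <= b -> f x <= k) -> \int_[a, b] f <= k * (b - a).
  move=> fk; rewrite -Ec; apply: le_Rintegral => //; exact: (ci k).
have gefi (k : R) : (forall x, a <= x <= b -> k <= f x) -> k * (b - a) <= \int_[a, b] f.
  move=> fk; rewrite -Ec; apply: le_Rintegral => //; exact: (ci k).
have := @lefi (l + e); have := @gefi (l - e).
rewrite ler_norml; move=> H1 H2.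
have {}H1 : (l - e) * (b - a) <= \int_[a, b] f.
  by apply: H1 => x /fl; rewrite ler_norml; lra.
have {}H2 : \int_[a, b] f <= (l + e) * (b - a).
  by apply: H2 => x /fl; rewrite ler_norml; lra.
move: (Rintegral _ _ _) H1 H2 => I H1 H2; by apply/andP; split; lra.
Qed.

(* The 1-form [P dx + Q dy] is Frechet differentiable at [(x, y)] and
   dQ/dx = dP/dy there; the derivatives need not be continuous. *)
Definition closed_at P Q x y := exists al be ga : R, forall e, 0 < e ->
  exists2 d, 0 < d & forall x' y', `|x' - x| < d -> `|y' - y| < d ->
   `|Q x' y' - Q x y - (al * (x' - x) + be * (y' - y))| <= e * (`|x' - x| + `|y' - y|) /\
   `|P x' y' - P x y - (ga * (x' - x) + al * (y' - y))| <= e * (`|x' - x| + `|y' - y|).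

(** Counterclockwise circulation of [P dx + Q dy] around the rectangle with sides [[a, b]] and
    [[c, d]]. *)
Definition boundary P Q a b c d :=
  (\int_[c, d] (Q b) - \int_[c, d] (Q a)) -
  (\int_[a, b] (P^~ d) - \int_[a, b] (P^~ c)).

Lemma linear_approx_continuous f x l : (forall e, 0 < e ->
  exists2 d, 0 < d & forall x', `|x' - x| < d -> `|f x' - f x - l * (x' - x)| <= e * `|x' - x|) ->
  {for x, continuous f}.
Proof.
move=> H; apply/cvgrPdist_le => e e0.
have [d d0 Hd] := H 1 ltr01.
near=> t.
have td : `|t - x| < d by near: t; apply/nbhs_ballP; exists d => // y; rewrite /ball/= distrC.
have te : `|t - x| < e / (1 + `|l|).
  near: t; apply/nbhs_ballP; exists (e / (1 + `|l|)) => /=; first by rewrite divr_gt0// ltr_pwDl.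
  by move=> y; rewrite /ball/= distrC.
have := Hd t td; rewrite mul1r => H1.
rewrite distrC (_ : f t - f x = (f t - f x - l * (t - x)) + l * (t - x)); last by ring.
rewrite (le_trans (ler_normD _ _))// normrM.
move: te; rewrite ltr_pdivlMr ?ltr_pwDl//; lra.
Unshelve. all: by end_near. Qed.

Lemma closed_at_continuous P Q x y : closed_at P Q x y ->
  [/\ {for y, continuous (Q x)} & {for x, continuous (P^~ y)}].
Proof.
move=> [al [be [ga H]]]; split.
- apply: (@linear_approx_continuous _ _ be) => e /H[d d0 Hd]; exists d => // y' yd.
  have [] := Hd x y' _ yd; first by rewrite subrr normr0.
  by rewrite subrr normr0 mulr0 !add0r.
- apply: (@linear_approx_continuous _ _ ga) => e /H[d d0 Hd]; exists d => // x' xd.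
  have [|_] := Hd x' y xd; first by rewrite subrr normr0.
  by rewrite subrr normr0 mulr0 !addr0.
Qed.

Lemma boundary_split P Q a m b c (n : R) d : a <= m <= b -> c <= n <= d ->
  (forall x y, a <= x <= b -> c <= y <= d -> closed_at P Q x y) ->
  boundary P Q a b c d = boundary P Q a m c n + boundary P Q m b c n +
    boundary P Q a m n d + boundary P Q m b n d.
Proof.
move=> amb cnd cl; have /andP[am mb] := amb; have /andP[cn nd] := cnd.
have QE x : a <= x <= b -> \int_[c, d] (Q x) = \int_[c, n] (Q x) + \int_[n, d] (Q x).
  by move=> xab; apply: Rintegral_itv_split => // y ycd; have [] := closed_at_continuous (cl _ _ xab ycd).
have PE y : c <= y <= d -> \int_[a, b] (P^~ y) = \int_[a, m] (P^~ y) + \int_[m, b] (P^~ y).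
  move=> ycd; apply: (@Rintegral_itv_split (P^~ y)) => // x xab.
  by have [_] := closed_at_continuous (cl _ _ xab ycd).
rewrite /boundary !QE ?PE ?lexx ?(le_trans am) ?(le_trans cn)//.
by ring.
Qed.

(** The affine part of the form has zero circulation: the [be] and [ga] terms cancel between
    opposite sides, and the two contributions of the shared coefficient [al] are equal. Only the
    error terms survive. *)
Lemma boundary_small P Q a b c d x0 y0 al be ga e :
  a <= x0 <= b -> c <= y0 <= d -> 0 <= e ->
  (forall x y, a <= x <= b -> c <= y <= d -> closed_at P Q x y) ->
  (forall x y, a <= x <= b -> c <= y <= d ->
   `|Q x y - Q x0 y0 - (al * (x - x0) + be * (y - y0))| <= e * (`|x - x0| + `|y - y0|) /\
   `|P x y - P x0 y0 - (ga * (x - x0) + al * (y - y0))| <= e * (`|x - x0| + `|y - y0|)) ->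
  `|boundary P Q a b c d| <= 2 * e * (b - a + (d - c)) ^+ 2.
Proof.
move=> xab ycd e0 cl H.
have /andP[ax xb] := xab; have /andP[cy yd] := ycd.
have ab := le_trans ax xb; have cd := le_trans cy yd.
have cQ x : a <= x <= b -> forall y, c <= y <= d -> {for y, continuous (Q x)}.
  by move=> xab' y ycd'; have [] := closed_at_continuous (cl _ _ xab' ycd').
have cP y : c <= y <= d -> forall x, a <= x <= b -> {for x, continuous (P^~ y)}.
  by move=> ycd' x xab'; have [] := closed_at_continuous (cl _ _ xab' ycd').
have aab : a <= a <= b by rewrite lexx ab.
have bab : a <= b <= b by rewrite lexx ab.
have ccd : c <= c <= d by rewrite lexx cd.
have dcd : c <= d <= d by rewrite lexx cd.
have HQ : `|\int_[c, d] (Q b) - \int_[c, d] (Q a) - al * (b - a) * (d - c)| <=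
    2 * e * (b - a + (d - c)) * (d - c).
  rewrite -RintegralB//; [|exact: continuous_itv_integrable (cQ _ _)..].
  apply: Rintegral_itv_dist => // [y yy|y yy].
    by apply: (@cvgB _ R^o); exact: cQ.
  have [] := H b y bab yy; have [] := H a y aab yy.
  have : `|y - y0| <= d - c by rewrite ler_norml; move: yy => /andP[]; lra.
  have : `|b - x0| <= b - a by rewrite ler_norml; lra.
  have : `|a - x0| <= b - a by rewrite ler_norml; lra.
  move=> H1 H2 H3 H4 _ H5 _.
  have {}H4 := le_trans H4 (ler_wpM2l e0 (lerD H1 H3)).
  have {}H5 := le_trans H5 (ler_wpM2l e0 (lerD H2 H3)).
  by move: H4 H5; rewrite !ler_norml -(mulrA 2); move: (e * _) => E; lra.
have HP : `|\int_[a, b] (P^~ d) - \int_[a, b] (P^~ c) - al * (d - c) * (b - a)| <=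
    2 * e * (b - a + (d - c)) * (b - a).
  rewrite -RintegralB//; [|exact: continuous_itv_integrable (cP _ _)..].
  apply: Rintegral_itv_dist => // [x xx|x xx].
    by apply: (@cvgB _ R^o _ _ _ (P^~ d) (P^~ c)); exact: cP.
  have [_] := H x d xx dcd; have [_] := H x c xx ccd.
  have : `|x - x0| <= b - a by rewrite ler_norml; move: xx => /andP[]; lra.
  have : `|d - y0| <= d - c by rewrite ler_norml; lra.
  have : `|c - y0| <= d - c by rewrite ler_norml; lra.
  move=> H1 H2 H3 H4 H5.
  have {}H4 := le_trans H4 (ler_wpM2l e0 (lerD H3 H1)).
  have {}H5 := le_trans H5 (ler_wpM2l e0 (lerD H3 H2)).
  by move: H4 H5; rewrite !ler_norml -(mulrA 2); move: (e * _) => E; lra.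
rewrite /boundary; move: HQ HP.
move: (\int_[c, d] (Q b) - \int_[c, d] (Q a)) (\int_[a, b] (P^~ d) - \int_[a, b] (P^~ c)) => u v.
rewrite expr2 mulrA; move: (2 * e * _) => E; rewrite -!(mulrA al) (mulrC (d - c)) => h1 h2.
have -> : u - v = (u - al * ((b - a) * (d - c))) - (v - al * ((b - a) * (d - c))) by ring.
rewrite (le_trans (ler_normB _ _))//; lra.
Qed.

Lemma norm_add4_le (u v s t : R) : let m := `|u + v + s + t| in
  m <= 4 * `|u| \/ m <= 4 * `|v| \/ m <= 4 * `|s| \/ m <= 4 * `|t|.
Proof.
move=> m; have [h1|h1] := lerP m (4 * `|u|); first by left.
have [h2|h2] := lerP m (4 * `|v|); first by right; left.
have [h3|h3] := lerP m (4 * `|s|); first by right; right; left.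
right; right; right.
have := ler_normD (u + v + s) t; have := ler_normD (u + v) s; have := ler_normD u v.
by rewrite -/m; lra.
Qed.

(** Goursat's bisection. Some quarter keeps at least a fourth of the circulation, while near the
    common point of the nested rectangles [boundary_small] bounds it by an arbitrarily small
    multiple of the squared side lengths, which also shrink by 4 at each step. *)
Lemma boundary_eq0 P Q a b c d : a <= b -> c <= d ->
  (forall x y, a <= x <= b -> c <= y <= d -> closed_at P Q x y) ->
  boundary P Q a b c d = 0.
Proof.
move=> ab cd cl.
pose w k := (b - a) / 2 ^+ k; pose h k := (d - c) / 2 ^+ k.
have w0 k : 0 <= w k by rewrite divr_ge0 ?exprn_ge0 ?subr_ge0.
have h0 k : 0 <= h k by rewrite divr_ge0 ?exprn_ge0 ?subr_ge0.
have wS k : w k = w k.+1 + w k.+1 by rewrite /w exprS invfM; field.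
have hS k : h k = h k.+1 + h k.+1 by rewrite /h exprS invfM; field.
have ws k x : [/\ x <= x + w k.+1, x + w k.+1 <= x + w k & x + w k.+1 + w k.+1 <= x + w k].
  by have := w0 k.+1; rewrite (wS k) => ?; split; lra.
have hs k y : [/\ y <= y + h k.+1, y + h k.+1 <= y + h k & y + h k.+1 + h k.+1 <= y + h k].
  by have := h0 k.+1; rewrite (hS k) => ?; split; lra.
pose J k (p : R * R) := boundary P Q p.1 (p.1 + w k) p.2 (p.2 + h k).
pose inr k (p : R * R) := [/\ a <= p.1, p.1 + w k <= b, c <= p.2 & p.2 + h k <= d].
pose next k (p p' : R * R) := [/\ p.1 <= p'.1, p'.1 + w k.+1 <= p.1 + w k, p.2 <= p'.2,
  p'.2 + h k.+1 <= p.2 + h k & `|J k p| <= 4 * `|J k.+1 p'|].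
(* Guarding by [inr] makes the relation total, with the dummy corner (0, 0) outside the rectangle,
   so that [choice] yields a function to iterate. *)
have step (kp : nat * (R * R)) : exists p', inr kp.1 kp.2 -> next kp.1 kp.2 p'.
  case: kp => k [x y] /=; have [[/= x1 x2 y1 y2]|?] := pselect (inr k (x, y)); last first.
    by exists (0, 0).
  have E : J k (x, y) = J k.+1 (x, y) + J k.+1 (x + w k.+1, y) + J k.+1 (x, y + h k.+1) +
      J k.+1 (x + w k.+1, y + h k.+1).
    rewrite /J /= (@boundary_split P Q x (x + w k.+1) _ y (y + h k.+1)).
    - by rewrite (wS k) (hS k) !addrA.
    - by have := wS k; have := w0 k.+1; lra.
    - by have := hS k; have := h0 k.+1; lra.
    - move=> x' y' ? ?; apply: cl; lra.
  have [[? ? ?] [? ? ?]] := (ws k x, hs k y).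
  have := norm_add4_le (J k.+1 (x, y)) (J k.+1 (x + w k.+1, y)) (J k.+1 (x, y + h k.+1))
    (J k.+1 (x + w k.+1, y + h k.+1)); rewrite -E => -[H|[H|[H|H]]].
  - by exists (x, y) => _; split => /=; rewrite ?lexx.
  - by exists (x + w k.+1, y) => _; split => /=; rewrite ?lexx.
  - by exists (x, y + h k.+1) => _; split => /=; rewrite ?lexx.
  - by exists (x + w k.+1, y + h k.+1) => _; split => /=.
have [F HF] := choice step.
pose s := fix s k := if k is k'.+1 then F (k', s k') else (a, c).
have sin k : inr k (s k).
  elim: k => [|k IH]; first by rewrite /inr /= /w /h expr0 !divr1; split; lra.
  have := HF (k, s k) IH; rewrite /next /inr/=; case: IH => + + + +.
  move: (F (k, s k)) (s k) => [x' y'] [x y] /= ? ? ? ? [? ? ? ? _].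
  by split; lra.
have snext k : next k (s k) (s k.+1) by exact: (HF (k, s k)).
have s1 i j : ((s i).1 <= (s (i + j)%N).1) && ((s (i + j)%N).1 + w (i + j)%N <= (s i).1 + w i).
  elim: j => [|j IH]; first by rewrite addn0 !lexx.
  by rewrite addnS; have [? ? _ _ _] := snext (i + j)%N; lra.
have s2 i j : ((s i).2 <= (s (i + j)%N).2) && ((s (i + j)%N).2 + h (i + j)%N <= (s i).2 + h i).
  elim: j => [|j IH]; first by rewrite addn0 !lexx.
  by rewrite addnS; have [_ _ ? ? _] := snext (i + j)%N; lra.
have lim (u v : nat -> R) : (forall k, 0 <= v k) ->
  (forall i j, (u i <= u (i + j)%N) && (u (i + j)%N + v (i + j)%N <= u i + v i)) ->
  exists l, forall k, u k <= l <= u k + v k.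
  move=> v0 uv; exists (sup (range u)) => k.
  have ub (k' : nat) : ubound (range u) (u k' + v k').
    move=> _ [j _ <-]; have [jk|kj] := leqP j k'.
      have := uv j (k' - j)%N; rewrite subnKC//; have := v0 k'; lra.
    by have := uv k' (j - k')%N; rewrite subnKC 1?ltnW//; have := v0 j; lra.
  apply/andP; split.
    by apply: ub_le_sup; [exists (u k + v k)|exists k].
  by apply: ge_sup => //; exists (u k), k.
have [x0 Hx] := lim _ _ w0 s1; have [y0 Hy] := lim _ _ h0 s2.
have inx k x : (s k).1 <= x <= (s k).1 + w k -> a <= x <= b by have [? ? _ _] := sin k; lra.
have iny k y : (s k).2 <= y <= (s k).2 + h k -> c <= y <= d by have [_ _ ? ?] := sin k; lra.
have [al [be [ga H]]] := cl x0 y0 (inx _ _ (Hx 0%N)) (iny _ _ (Hy 0%N)).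
have J4 k : `|J 0%N (a, c)| <= 4 ^+ k * `|J k (s k)|.
  elim: k => [|k IH]; first by rewrite mul1r.
  rewrite (le_trans IH)// exprSr -mulrA ler_wpM2l ?exprn_ge0//.
  by have [] := snext k.
have -> : boundary P Q a b c d = J 0%N (a, c) by rewrite /J /w /h /= !divr1 !subrKC.
apply/eqP; rewrite -normr_le0; apply/ler_addgt0Pl => e e0; rewrite addr0.
pose S := b - a + (d - c); have S0 : 0 <= S by rewrite /S; lra.
(* Chosen so that 2 e' S^2 <= e; the shift [S + 1] covers a degenerate rectangle. *)
pose e' := e / (2 * (S + 1) ^+ 2).
have e'0 : 0 < e' by rewrite divr_gt0// mulr_gt0// exprn_gt0//; lra.
have [dl dl0 Hd] := H e' e'0.
have [k Sk] : exists k, S < dl * 2 ^+ k.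
  pose k := Num.bound (S / dl); exists k.
  rewrite -ltr_pdivrMl// mulrC; apply: (@lt_le_trans _ _ k%:R).
    by apply: archi_boundP; rewrite divr_ge0// ltW.
  by rewrite -natrX ler_nat; exact/ltnW/ltn_expl.
have wd : w k < dl.
  by rewrite ltr_pdivrMr ?exprn_gt0//; apply: le_lt_trans Sk; rewrite /S; lra.
have hd : h k < dl.
  by rewrite ltr_pdivrMr ?exprn_gt0//; apply: le_lt_trans Sk; rewrite /S; lra.
have := @boundary_small P Q (s k).1 ((s k).1 + w k) (s k).2 ((s k).2 + h k) x0 y0 al be ga e'
  (Hx k) (Hy k) (ltW e'0).
have -> : (s k).1 + w k - (s k).1 + ((s k).2 + h k - (s k).2) = S / 2 ^+ k.
  by rewrite /w /h /S; field; rewrite expf_neq0.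
move=> Hs; apply: (le_trans (J4 k)).
have {}Hs : `|J k (s k)| <= 2 * e' * (S / 2 ^+ k) ^+ 2.
  apply: Hs => [x y /inx xab /iny ycd|x y xx yy]; first exact: cl.
  by apply: Hd; rewrite ltr_norml; move: (Hx k) (Hy k); lra.
have -> : 4 ^+ k = (2 ^+ k) ^+ 2 :> R by rewrite -exprM mulnC exprM; congr (_ ^+ _); ring.
rewrite (le_trans (ler_wpM2l _ Hs)) ?exprn_ge0//.
have -> : (2 ^+ k) ^+ 2 * (2 * e' * (S / 2 ^+ k) ^+ 2) = 2 * e' * S ^+ 2.
  by field; rewrite expf_neq0.
rewrite /e' (_ : 2 * _ * _ = e * (S ^+ 2 / (S + 1) ^+ 2)); last by field; rewrite lt0r_neq0//; lra.
rewrite ler_piMr ?(ltW e0)// ler_pdivrMr ?mul1r ?exprn_gt0//; [|lra].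
by rewrite lerXn2r ?nnegrE//; lra.
Qed.

(** In logarithmic polar coordinates the sides at angles 0 and 2 pi cancel, so this says that the
    means over two concentric circles agree. *)
Lemma boundary0_periodic P Q a b c d : P^~ d = P^~ c -> boundary P Q a b c d = 0 ->
  \int_[c, d] (Q b) = \int_[c, d] (Q a).
Proof. by rewrite /boundary => ->; rewrite subrr subr0 => /eqP; rewrite subr_eq0 => /eqP. Qed.

Lemma Rintegral_eq_le f g (p l M : R) e : 0 < p ->
  (forall x, 0 <= x <= p -> {for x, continuous f}) ->
  (forall x, 0 <= x <= p -> {for x, continuous g}) ->
  \int_[0, p] f = \int_[0, p] g ->
  (forall x, 0 <= x <= p -> `|f x| <= M) ->
  (forall x, 0 <= x <= p -> `|g x - l| <= e) -> l <= M + e.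
Proof.
move=> p0 cf cg fg fM gl.
have H1 : `|\int_[0, p] f - 0 * (p - 0)| <= M * (p - 0).
  by apply: Rintegral_itv_dist (ltW p0) cf _ => x /fM; rewrite subr0.
have H2 := Rintegral_itv_dist (ltW p0) cg gl.
move: H1 H2; rewrite fg !subr0; move: (Rintegral _ _ _) => J; rewrite !ler_norml => H1 H2.
by rewrite -(ler_pM2r p0); lra.
Qed.

End Goursat.

(** * The maximum modulus principle *)

Lemma derivable_linear_approx (K : numFieldType) (f : K^o -> K^o) (x : K) :
  derivable f x 1 -> forall e, 0 < e -> exists2 d : K, 0 < d & forall x' : K,
    `|x' - x| < d -> `|f x' - f x - 'D_1 f x * (x' - x)| <= e * `|x' - x|.
Proof.
move=> /derivable_nbhs /eqaddoP H e e0.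
have := H e e0 => /nbhs_ballP[d /= d0 Hd]; exists d => // x' xd.
have := Hd (x' - x); rewrite /ball/= sub0r normrN => /(_ xd).
by rewrite /= !fctE /= [X in f X](_ : _ = x') ?opprD ?addrA; [rewrite [_ *: 'D_1 f x]mulrC|rewrite /shift/= scaler1 subrK].
Qed.

Lemma is_derive_linear_approx (K : numFieldType) (f : K^o -> K^o) (x l : K) :
  is_derive (x : K^o) (1 : K^o) f l -> forall e, 0 < e -> exists2 d : K, 0 < d & forall x' : K,
    `|x' - x| < d -> `|f x' - f x - l * (x' - x)| <= e * `|x' - x|.
Proof. by move=> [/derivable_linear_approx + <-]. Qed.

(** * Circle means in logarithmic polar coordinates *)

Section Complex.
Context {R : realType}.
Implicit Types (z w : R[i]) (g : R[i] -> R[i]) (e d s t : R).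

Lemma normc_real (x : R) : normc x%:C = `|x|.
Proof. by rewrite /normc/= expr0n/= addr0 sqrtr_sqr. Qed.

Lemma norm_Re_le z : `|complex.Re z| <= normc z.
Proof. by case: z => x y /=; rewrite -sqrtr_sqr ler_wsqrtr// lerDl sqr_ge0. Qed.

Lemma norm_Im_le z : `|complex.Im z| <= normc z.
Proof. by case: z => x y /=; rewrite -sqrtr_sqr ler_wsqrtr// lerDr sqr_ge0. Qed.

Lemma normc_ge0 z : 0 <= normc z.
Proof. by case: z => x y /=; exact: sqrtr_ge0. Qed.

Lemma normc_conj z : normc (conjc z) = normc z.
Proof. by case: z => x y /=; rewrite sqrrN. Qed.

Lemma normc_le_ReIm z : normc z <= `|complex.Re z| + `|complex.Im z|.
Proof.
have {1}-> : z = (complex.Re z)%:C + 'i%C * (complex.Im z)%:C by rewrite -complexE.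
rewrite (le_trans (le_normcD _ _))// normcM !normc_real.
by rewrite /normc expr0n expr1n add0r sqrtr1 mul1r.
Qed.

Definition cderivable g z := derivable (g : R[i]^o -> R[i]^o) z 1.

Lemma cderivable_linear_approx g z : cderivable g z -> exists D, forall e, 0 < e ->
  exists2 d, 0 < d & forall z', normc (z' - z) < d ->
    normc (g z' - g z - D * (z' - z)) <= e * normc (z' - z).
Proof.
move=> /derivable_linear_approx H; exists ('D_1 (g : R[i]^o -> R[i]^o) z) => e e0.
have [|d d0 Hd] := H e%:C; first by rewrite ltcR.
have dE : d = (complex.Re d)%:C by apply/esym/RRe_real/gtr0_real.
exists (complex.Re d); first by rewrite -ltcR -dE.
move=> z' zd; have := Hd z'; rewrite dE -lecR -ltcR in zd *.
by move=> /(_ zd); rewrite rmorphM.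
Qed.

Lemma expR_taylor1 e : 0 < e -> exists2 d, 0 < d & forall h, `|h| < d ->
  `|expR h - 1 - h| <= e * `|h| /\ `|expR h - 1| <= e.
Proof.
move=> e0.
have [|d d0 Hd] := is_derive_linear_approx (is_derive_expR (0 : R)) (e := Num.min e 1); first by rewrite lt_min e0 ltr01.
exists (Num.min d (e / 2)); first by rewrite lt_min d0 divr_gt0.
move=> h; rewrite lt_min => /andP[hd he].
have := Hd h; rewrite subr0 => /(_ hd).
rewrite expR0 mul1r => H; split.
  by rewrite (le_trans H)// ler_wpM2r// ge_min lexx.
have {}H : `|expR h - 1 - h| <= `|h|.
  by rewrite (le_trans H)// ler_piMl// ge_min lexx orbT.
have := ler_normD (expR h - 1 - h) h; rewrite subrK; lra.
Qed.

Lemma cos_taylor1 e : 0 < e -> exists2 d, 0 < d & forall h, `|h| < d ->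
  `|cos h - 1| <= e * `|h|.
Proof.
move=> e0.
have [d d0 Hd] := is_derive_linear_approx (is_derive_cos (0 : R)) e0.
exists d => // h hd; have := Hd h; rewrite subr0 => /(_ hd).
by rewrite cos0 sin0 oppr0 mul0r subr0.
Qed.

Lemma sin_taylor1 e : 0 < e -> exists2 d, 0 < d & forall h, `|h| < d ->
  `|sin h - h| <= e * `|h|.
Proof.
move=> e0.
have [d d0 Hd] := is_derive_linear_approx (is_derive_sin (0 : R)) e0.
exists d => // h hd; have := Hd h; rewrite subr0 => /(_ hd).
by rewrite cos0 sin0 mul1r subr0.
Qed.

Definition expc s t : R[i] := (expR s * cos t) +i* (expR s * sin t).

Lemma expcD s t s' t' : expc (s + s') (t + t') = expc s t * expc s' t'.
Proof.
rewrite /expc expRD cosD sinD; apply/eqP; rewrite eq_complex /=.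
by apply/andP; split; apply/eqP; ring.
Qed.

Lemma normc_expc s t : normc (expc s t) = expR s.
Proof. by rewrite /normc/= !exprMn -mulrDr cos2Dsin2 mulr1 sqrtr_sqr ger0_norm// expR_ge0. Qed.

Lemma expc_taylor1 e : 0 < e -> exists2 d, 0 < d & forall h k, `|h| < d -> `|k| < d ->
  normc (expc h k - 1 - h +i* k) <= e * (`|h| + `|k|).
Proof.
move=> e0; pose e1 := Num.min (e / 6) 1.
have e10 : 0 < e1 by rewrite lt_min ltr01 divr_gt0.
have e11 : e1 <= 1 by rewrite ge_min lexx orbT.
have e1e : e1 <= e / 6 by rewrite ge_min lexx.
have [d1 d10 H1] := expR_taylor1 e10.
have [d2 d20 H2] := cos_taylor1 e10.
have [d3 d30 H3] := sin_taylor1 e10.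
exists (Num.min (Num.min d1 1) (Num.min d2 d3)); first by rewrite !lt_min d10 d20 d30 ltr01.
move=> h k; rewrite !lt_min => /andP[/andP[h1 h11] _] /andP[_ /andP[k2 k3]].
have [A B] := H1 h h1; have C := H2 k k2; have D := H3 k k3.
rewrite (le_trans (normc_le_ReIm _))//=.
have -> : expR h * cos k - 1 - h = (expR h - 1 - h) * cos k + (1 + h) * (cos k - 1) by ring.
have -> : expR h * sin k - 0 - k = (expR h - 1) * (sin k - k) + (expR h - 1) * k + (sin k - k) by ring.
have cosk : `|cos k| <= 1 by rewrite ler_norml cos_geN1 cos_le1.
have P1 : `|(expR h - 1 - h) * cos k| <= e1 * `|h| by rewrite normrM -[leRHS]mulr1 ler_pM.
have P2 : `|(1 + h) * (cos k - 1)| <= 2 * (e1 * `|k|).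
  by rewrite normrM ler_pM// (le_trans (ler_normD _ _))// normr1; lra.
have P3 : `|(expR h - 1) * (sin k - k)| <= e1 * `|k|.
  by rewrite normrM -[leRHS]mul1r ler_pM// (le_trans B).
have P4 : `|(expR h - 1) * k| <= e1 * `|k| by rewrite normrM ler_wpM2r.
have Eh : e1 * `|h| <= e / 6 * `|h| by rewrite ler_wpM2r.
have Ek : e1 * `|k| <= e / 6 * `|k| by rewrite ler_wpM2r.
have := ler_normD ((expR h - 1 - h) * cos k) ((1 + h) * (cos k - 1)).
have := ler_normD ((expR h - 1) * (sin k - k) + (expR h - 1) * k) (sin k - k).
have := ler_normD ((expR h - 1) * (sin k - k)) ((expR h - 1) * k).
have := mulr_ge0 (ltW e0) (normr_ge0 h); have := mulr_ge0 (ltW e0) (normr_ge0 k); lra.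
Qed.

Lemma expc_linear_approx s t e : 0 < e -> exists2 d, 0 < d & forall s' t',
  `|s' - s| < d -> `|t' - t| < d ->
  normc (expc s' t' - expc s t - expc s t * ((s' - s) +i* (t' - t))) <= e * (`|s' - s| + `|t' - t|).
Proof.
move=> e0; have [d d0 H] := expc_taylor1 (e := e / expR s) ltac:(by rewrite divr_gt0// expR_gt0).
exists d => // s' t' sd td.
have -> : expc s' t' = expc s t * expc (s' - s) (t' - t) by rewrite -expcD !subrKC.
have -> : expc s t * expc (s' - s) (t' - t) - expc s t - expc s t * ((s' - s) +i* (t' - t)) =
  expc s t * (expc (s' - s) (t' - t) - 1 - (s' - s) +i* (t' - t)) by ring.
rewrite normcM normc_expc -ler_pdivlMl ?expR_gt0// (le_trans (H _ _ sd td))//.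
by rewrite mulrA [_^-1 * e]mulrC.
Qed.

(** The Cauchy-Riemann equations for F = c g(exp(s + i t)): the form is Im (F (ds + i dt)), and [A]
    is the derivative of F with respect to s + i t. *)
Lemma polar_closed_at c g s t : cderivable g (expc s t) ->
  closed_at (fun s t => complex.Im (c * g (expc s t)))
            (fun s t => complex.Re (c * g (expc s t))) s t.
Proof.
move=> /cderivable_linear_approx[D HD].
pose A := c * D * expc s t; exists (complex.Re A), (- complex.Im A), (complex.Im A) => e e0.
suff [d d0 H] : exists2 d, 0 < d & forall s' t', `|s' - s| < d -> `|t' - t| < d ->
   normc (c * g (expc s' t') - c * g (expc s t) - A * ((s' - s) +i* (t' - t))) <=
   e * (`|s' - s| + `|t' - t|).
  exists d => // s' t' sd td; have := H s' t' sd td => {}H.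
  split; apply: le_trans H; [apply: le_trans (norm_Re_le _)|apply: le_trans (norm_Im_le _)].
    rewrite le_eqVlt; apply/orP; left; apply/eqP; congr `|_|.
    by rewrite [A]complexE; case: (c * _) => ? ?; case: (c * _) => ? ? /=; ring.
  rewrite le_eqVlt; apply/orP; left; apply/eqP; congr `|_|.
  by rewrite [A]complexE; case: (c * _) => ? ?; case: (c * _) => ? ? /=; ring.
pose N := normc (expc s t); pose Cc := normc c + 1; pose Dd := normc D + 1.
have N0 : 0 <= N by exact: normc_ge0.
have Cc0 : 0 < Cc by rewrite ltr_wpDl// normc_ge0.
have Dd0 : 0 < Dd by rewrite ltr_wpDl// normc_ge0.
have [d1 d10 H1] := HD (e / (2 * Cc * (N + 1))) ltac:(by rewrite divr_gt0// !mulr_gt0// ltr_wpDl).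
have [d2 d20 H2] := expc_linear_approx s t (e := Num.min 1 (e / (2 * Cc * Dd)))
  ltac:(by rewrite lt_min ltr01 divr_gt0// !mulr_gt0).
pose d3 := d1 / (2 * (N + 1)).
have d30 : 0 < d3 by rewrite divr_gt0// mulr_gt0// ltr_wpDl.
exists (Num.min d2 d3); first by rewrite lt_min d20 d30.
move=> s' t'; rewrite !lt_min => /andP[s2 s3] /andP[t2 t3].
pose S := `|s' - s| + `|t' - t|; have S0 : 0 <= S by rewrite addr_ge0.
pose h := (s' - s) +i* (t' - t).
have hS : normc h <= S by exact: le_trans (normc_le_ReIm _) _.
have {}H2 := H2 _ _ s2 t2.
have EN : normc (expc s' t' - expc s t) <= (N + 1) * S.
  rewrite (_ : expc s' t' - expc s t = (expc s' t' - expc s t - expc s t * h) + expc s t * h);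
    last by rewrite subrK.
  rewrite (le_trans (le_normcD _ _))// normcM mulrDl mul1r addrC lerD ?ler_wpM2l//.
  by rewrite (le_trans H2)// ler_piMl// ge_min lexx.
have Ed1 : normc (expc s' t' - expc s t) < d1.
  apply: le_lt_trans EN _; rewrite mulrC -ltr_pdivlMr ?ltr_wpDl//.
  rewrite (_ : d1 / (N + 1) = d3 + d3); first exact: ltrD.
  by rewrite /d3; field; rewrite gt_eqF// ltr_wpDl.
have {}H1 := H1 _ Ed1.
have -> : c * g (expc s' t') - c * g (expc s t) - A * h =
  c * (g (expc s' t') - g (expc s t) - D * (expc s' t' - expc s t)) +
  c * (D * (expc s' t' - expc s t - expc s t * h)) by rewrite /A; ring.
rewrite (le_trans (le_normcD _ _))// !normcM.
have Q1 : normc c * normc (g (expc s' t') - g (expc s t) - D * (expc s' t' - expc s t)) <=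
   e / 2 * S.
  apply: (@le_trans _ _ (Cc * (e / (2 * Cc * (N + 1)) * ((N + 1) * S)))).
    apply: ler_pM; rewrite ?normc_ge0//; first by rewrite lerDl.
    apply: (le_trans H1); rewrite ler_wpM2l// divr_ge0 ?(ltW e0)// ltW// !mulr_gt0//.
    by rewrite ltr_wpDl.
  rewrite le_eqVlt; apply/orP; left; apply/eqP; field.
  by rewrite !gt_eqF// ltr_wpDl.
have Q2 : normc c * (normc D * normc (expc s' t' - expc s t - expc s t * h)) <= e / 2 * S.
  apply: (@le_trans _ _ (Cc * (Dd * (e / (2 * Cc * Dd) * S)))).
    apply: ler_pM; rewrite ?mulr_ge0 ?normc_ge0//; first by rewrite lerDl.
    apply: ler_pM; rewrite ?normc_ge0//; first by rewrite lerDl.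
    by apply: (le_trans H2); rewrite ler_wpM2r// ge_min lexx orbT.
  by rewrite le_eqVlt; apply/orP; left; apply/eqP; field; rewrite !gt_eqF.
by move: Q1 Q2; rewrite -/S; lra.
Qed.

Lemma expc_periodic s : expc s (pi *+ 2) = expc s 0.
Proof. by rewrite /expc cos2pi sin2pi cos0 sin0. Qed.

(** After multiplication by a unimodular [c] with c g(0) = |g(0)|, the mean of Re (c g) over the
    circle of radius [r] is at most [M]. It equals the mean over a small circle, which is within [e]
    of |g(0)|. *)
Lemma max_modulus_center g r M : 0 < r ->
  (forall z, normc z <= r -> cderivable g z) ->
  (forall z, normc z = r -> normc (g z) <= M) ->
  normc (g 0) <= M.
Proof.
move=> r0 dg gM.
have [g0|g0] := eqVneq (normc (g 0)) 0.
  by rewrite g0 (le_trans _ (gM (expc (ln r) 0) _)) ?normc_ge0// normc_expc lnK.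
pose c := (normc (g 0))%:C / g 0.
have gn0 : g 0 != 0 by apply: contra_neq g0 => ->; rewrite normc0.
have c1 : normc c = 1.
  by rewrite normcM normcV normc_real ger0_norm ?normc_ge0// divff.
have cg : c * g 0 = (normc (g 0))%:C by rewrite divfK.
apply/ler_addgt0Pl => e e0.
have [D HD] := cderivable_linear_approx (dg 0 ltac:(by rewrite normc0 ltW)).
have [d d0 Hd] := HD 1 ltr01.
(* On the circle of radius [rho] the linear approximation holds with error at most [rho], so g
   differs from g(0) by at most rho (1 + |D|) <= e. *)
pose rho := Num.min (Num.min (d / 2) r) (e / (1 + normc D)).
have rho0 : 0 < rho by rewrite !lt_min r0 !divr_gt0// ltr_pwDl// normc_ge0.
have rhor : rho <= r by rewrite !ge_min lexx orbT.
have rhod : rho < d by rewrite !gt_min ltr_pdivrMr// ltr_pMr// ltr1n.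
have rhoe : rho * (1 + normc D) <= e.
  by rewrite -ler_pdivlMr ?ltr_pwDl ?normc_ge0// !ge_min lexx orbT.
pose P s t := complex.Im (c * g (expc s t)).
pose Q s t := complex.Re (c * g (expc s t)).
have cl s t : ln rho <= s <= ln r -> 0 <= t <= pi *+ 2 -> closed_at P Q s t.
  move=> /andP[_ sr] _; apply/polar_closed_at/dg.
  by rewrite normc_expc -(lnK r0) ler_expR.
have pi2 : 0 < pi *+ 2 :> R by rewrite mulrn_wgt0 ?pi_gt0.
have lr : ln rho <= ln r by rewrite ler_ln.
have Pper : P^~ (pi *+ 2) = P^~ 0 by apply/funext => s; rewrite /P expc_periodic.
have QE := boundary0_periodic Pper (boundary_eq0 lr (ltW pi2) cl).
have cQ s : ln rho <= s <= ln r -> forall t, 0 <= t <= pi *+ 2 -> {for t, continuous (Q s)}.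
  by move=> ss t tt; have [] := closed_at_continuous (cl s t ss tt).
have cQ1 : forall t, 0 <= t <= pi *+ 2 -> {for t, continuous (Q (ln r))}.
  by apply: cQ; rewrite lr lexx.
have cQ2 : forall t, 0 <= t <= pi *+ 2 -> {for t, continuous (Q (ln rho))}.
  by apply: cQ; rewrite lr lexx.
rewrite addrC; apply: (Rintegral_eq_le pi2 cQ1 cQ2 QE); clear cl QE cQ cQ1 cQ2 Pper => t _.
  rewrite (le_trans (norm_Re_le _))// normcM c1 mul1r gM//.
  by rewrite normc_expc lnK.
have -> : Q (ln rho) t - normc (g 0) = complex.Re (c * (g (expc (ln rho) t) - g 0)).
  by rewrite mulrBr cg /Q; case: (c * _).
apply: (le_trans (norm_Re_le _)); rewrite normcM c1 mul1r.
have := Hd (expc (ln rho) t); rewrite subr0 normc_expc lnK// => /(_ rhod) H.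
have := le_normcD (g (expc (ln rho) t) - g 0 - D * expc (ln rho) t) (D * expc (ln rho) t).
rewrite subrK normcM normc_expc lnK//.
move: (normc (g _ - _ - _)) (normc (g _ - _)) H => u v; lra.
Qed.

End Complex.

(** * From the centre to an arbitrary point of the disk *)

Section Moebius.
Context {R : realType}.
Implicit Types (z w : R[i]) (f g : R[i] -> R[i]).

Lemma cderivable_cst c z : cderivable (cst c) z.
Proof. exact: derivable_cst. Qed.

Lemma cderivable_id z : cderivable id z.
Proof. exact: derivable_id. Qed.

Lemma cderivableD f g z : cderivable f z -> cderivable g z ->
  cderivable (fun z => f z + g z) z.
Proof. exact: derivableD. Qed.

Lemma cderivableB f g z : cderivable f z -> cderivable g z ->
  cderivable (fun z => f z - g z) z.
Proof. exact: derivableB. Qed.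

Lemma cderivableM f g z : cderivable f z -> cderivable g z ->
  cderivable (fun z => f z * g z) z.
Proof. exact: derivableM. Qed.

Lemma cderivableV f z : f z != 0 -> cderivable f z -> cderivable (fun z => (f z)^-1) z.
Proof. exact: derivableV. Qed.

Lemma cderivableX f n z : cderivable f z -> cderivable (fun z => f z ^+ n) z.
Proof.
by move=> /(@derivableX _ R[i]^o f n); rewrite /cderivable exprfctE.
Qed.

Lemma cderivable_comp f g z : cderivable g z -> cderivable f (g z) ->
  cderivable (f \o g) z.
Proof.
by move=> /derivable1_diffP dg /derivable1_diffP df; apply/derivable1_diffP;
  exact: (@differentiable_comp R[i] R[i]^o R[i]^o R[i]^o g f z dg df).
Qed.

Lemma sqr_normc z : normc z ^+ 2 = complex.Re z ^+ 2 + complex.Im z ^+ 2.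
Proof. by case: z => x y /=; rewrite sqr_sqrtr// addr_ge0// sqr_ge0. Qed.

(* The Moebius automorphism of the disk of radius [r] taking [0] to [w]
   reduces the estimate at [w] to the estimate at the center. *)
Lemma max_modulus f r w M : normc w < r ->
  (forall z, normc z <= r -> cderivable f z) ->
  (forall z, normc z = r -> normc (f z) <= M) ->
  normc (f w) <= M.
Proof.
move=> wr df fM; have r0 : 0 < r by apply: le_lt_trans wr; exact: normc_ge0.
have r0' := ltW r0.
pose den z := (r ^+ 2)%:C + conjc w * z.
pose phi z := (r ^+ 2)%:C * (z + w) / den z.
(* This identity carries everything about [phi]: it maps the closed disk into itself, preserves the
   bounding circle, and its denominator does not vanish. *)
have sqrE z : normc (den z) ^+ 2 - (r * normc (z + w)) ^+ 2 =
   (r ^+ 2 - normc z ^+ 2) * (r ^+ 2 - normc w ^+ 2).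
  rewrite exprMn !sqr_normc /den; case: z w {wr den phi} => [x y] [u v] /=; ring.
have w2 : 0 < r ^+ 2 - normc w ^+ 2.
  by rewrite subr_gt0 ltr_pXn2r ?nnegrE ?normc_ge0.
have le_den z : normc z <= r -> r * normc (z + w) <= normc (den z).
  move=> zr; rewrite -(@ler_pXn2r _ 2) ?nnegrE ?mulr_ge0 ?normc_ge0//.
  rewrite -subr_ge0 sqrE mulr_ge0 ?(ltW w2)// subr_ge0.
  by rewrite ler_pXn2r ?nnegrE ?normc_ge0.
have den0 z : normc z <= r -> 0 < normc (den z).
  move=> zr; rewrite lt_neqAle normc_ge0 andbT eq_sym; apply/eqP => dz.
  have := le_den _ zr; rewrite dz pmulr_rle0// => zw.
  have {}zw : normc (z + w) = 0 by apply/eqP; rewrite eq_le zw normc_ge0.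
  have := sqrE z; rewrite dz zw mulr0 subrr => /esym/eqP; rewrite mulf_eq0 (gt_eqF w2) orbF.
  have -> : z = - w by apply/eqP; rewrite -addr_eq0; apply/eqP/eq0_normc.
  by rewrite normcN (gt_eqF w2).
have phiE z : normc (phi z) = r * (r * normc (z + w) / normc (den z)).
  rewrite /phi !normcM normcV normc_real ger0_norm ?sqr_ge0//.
  by rewrite expr2 -!mulrA.
have phi_le z : normc z <= r -> normc (phi z) <= r.
  move=> zr; rewrite phiE ler_piMr ?(ltW r0)// ler_pdivrMr ?den0// mul1r; exact: le_den.
have phi_eq z : normc z = r -> normc (phi z) = r.
  move=> zr; rewrite phiE (_ : r * normc (z + w) = normc (den z)).
    by rewrite divff ?mulr1// gt_eqF// den0// zr.
  have /eqP := sqrE z; rewrite zr subrr mul0r subr_eq0 eqrXn2 ?mulr_ge0 ?normc_ge0//.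
  by move/eqP.
have phi0 : phi 0 = w.
  rewrite /phi /den add0r mulr0 addr0 mulrC mulKf//.
  by rewrite (inj_eq (@complexI _)) expf_neq0// gt_eqF.
rewrite -phi0; apply: (@max_modulus_center _ (f \o phi) r M r0) => z zr; last first.
  by apply: fM; exact: phi_eq.
apply: cderivable_comp; last by apply/df/phi_le.
apply: cderivableM; first by apply: cderivableM; [exact: cderivable_cst|
  apply: cderivableD; [exact: cderivable_id|exact: cderivable_cst]].
apply: cderivableV; first by apply: contraTneq (den0 _ zr) => ->; rewrite normc0 ltxx.
apply: cderivableD; first exact: cderivable_cst.
by apply: cderivableM; [exact: cderivable_cst|exact: cderivable_id].
Qed.

End Moebius.

(** * Log-convexity of radial potentials *)

Section LogConvexity.
Context {R : realType}.
Implicit Types (u : R * R -> R) (p : R * R) (s t h : R).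

Lemma shift_dir_x s t h : h *: dir_x R + (s, t) = (h *: (1 : R^o) + s, t).
Proof. by congr (_, _); rewrite /= [_ *: _]mulr0 add0r. Qed.

Lemma shift_dir_y s t h : h *: dir_y R + (s, t) = (s, h *: (1 : R^o) + t).
Proof. by congr (_, _); rewrite /= [_ *: _]mulr0 add0r. Qed.

Lemma derive_dir_x u s t : 'D_(dir_x R) u (s, t) = 'D_1 (fun x : R^o => u (x, t)) s.
Proof.
rewrite /derive (_ : (fun h : R => _) =
  (fun h : R => h^-1 *: (((fun x : R^o => u (x, t)) \o shift s) (h *: (1 : R^o)) - u (s, t))))//.
by apply/funext => h /=; rewrite /shift/= shift_dir_x.
Qed.

Lemma derive_dir_y u s t : 'D_(dir_y R) u (s, t) = 'D_1 (fun y : R^o => u (s, y)) t.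
Proof.
rewrite /derive (_ : (fun h : R => _) =
  (fun h : R => h^-1 *: (((fun y : R^o => u (s, y)) \o shift t) (h *: (1 : R^o)) - u (s, t))))//.
by apply/funext => h /=; rewrite /shift/= shift_dir_y.
Qed.

Lemma derivable_dir_x u s t : derivable u (s, t) (dir_x R) ->
  derivable (fun x : R^o => u (x, t)) s 1.
Proof.
rewrite /derivable (_ : (fun h : R => _) =
  (fun h : R => h^-1 *: (((fun x : R^o => u (x, t)) \o shift s) (h *: (1 : R^o)) - u (s, t))))//.
by apply/funext => h /=; rewrite /shift/= shift_dir_x.
Qed.

Lemma disk_real s : `|s| < 1 -> disk s%:C.
Proof. by move=> s1; rewrite /disk /mkset normc_real. Qed.

Context (eta : R[i] -> R) (rad_eta : radial eta) (d2 : has_pure_second_partials eta).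
Let u := eta \o @cplx R.
Let phi (s : R^o) : R^o := eta s%:C.
Let dphi (s : R^o) : R^o := 'D_1 phi s.

Let disk2_axis s : `|s| < 1 -> disk2 (s, 0).
Proof. exact: disk_real. Qed.

Let phi_is_derive s : `|s| < 1 -> is_derive (s : R^o) (1 : R^o) phi (dphi s).
Proof.
move=> s1; have [/derivable_dir_x H _] := d2 (disk2_axis s1) (or_introl erefl).
by apply: DeriveDef.
Qed.

Let dphi_is_derive s : `|s| < 1 ->
  is_derive (s : R^o) (1 : R^o) dphi ('D_(dir_x R) ('D_(dir_x R) u) (s, 0)).
Proof.
move=> s1; have [_ /derivable_dir_x H] := d2 (disk2_axis s1) (or_introl erefl).
have E : (fun x : R^o => 'D_(dir_x R) u (x, 0)) = dphi.
  by apply/funext => x; rewrite derive_dir_x.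
have HE : 'D_(dir_x R) ('D_(dir_x R) u) (s, 0) = 'D_1 dphi s.
  by rewrite (derive_dir_x ('D_(dir_x R) u)) E.
apply: DeriveDef; last exact: esym HE.
by rewrite -E; exact: H.
Qed.

Let u_radial s t : normc (s +i* t) < 1 -> u (s, t) = phi (normc (s +i* t)).
Proof.
move=> st; apply: rad_eta => //.
  by apply: disk_real; rewrite ger0_norm// normc_ge0.
by rewrite [RHS]normc_real ger0_norm// normc_ge0.
Qed.

(** By radiality u(s, t) = phi(rho t) with rho t = sqrt(s^2 + t^2), so the t-derivative is phi'(rho
    t) t / rho t, which vanishes at t = 0. Its difference quotient there is phi'(rho h) / rho h, and
    continuity of phi' at s gives the limit. *)
Let derive_yy s : 0 < s -> s < 1 ->
  'D_(dir_y R) ('D_(dir_y R) u) (s, 0) = dphi s / s.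
Proof.
move=> s0 s1.
pose rho (t : R^o) : R^o := Num.sqrt (s ^+ 2 + t ^+ 2).
have rho0 t : 0 < rho t by rewrite sqrtr_gt0 ltr_pwDl ?exprn_gt0// sqr_ge0.
have drho (t : R) : is_derive (t : R^o) (1 : R^o) rho (t / rho t).
  have -> : rho = Num.sqrt \o (fun t => s ^+ 2 + t ^+ 2) by [].
  have H : is_derive (t : R^o) (1 : R^o) (fun t => s ^+ 2 + t ^+ 2 : R^o) (2 * t).
    have H1 := is_derive_cst (s ^+ 2 : R^o) (t : R^o) (1 : R^o).
    have H2 := is_deriveX 2 (is_derive_id (t : R^o) (1 : R^o)).
    have -> : (fun t : R => s ^+ 2 + t ^+ 2) = cst (s ^+ 2) + (id ^+ 2).
      by apply/funext => x; rewrite /= exprfctE.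
    have H3 := is_deriveD H1 H2.
    by rewrite add0r expr1 /GRing.scale/= mulr1 in H3.
  have st0 : 0 < s ^+ 2 + t ^+ 2 by rewrite ltr_pwDl ?exprn_gt0// sqr_ge0.
  have := @is_derive1_comp R Num.sqrt (fun t => s ^+ 2 + t ^+ 2) t _ _ (is_derive1_sqrt st0) H.
  have -> // : (2 * Num.sqrt (s ^+ 2 + t ^+ 2))^-1 * (2 * t) = t / rho t.
  by rewrite -/(rho t); field; rewrite gt_eqF.
have crho : {for 0, continuous rho}.
  by apply/differentiable_continuous/derivable1_diffP; have [] := drho 0.
have rhos : rho 0 = s by rewrite /rho expr0n addr0 sqrtr_sqr gtr0_norm.
have near1 : \forall t \near (0 : R^o), rho t < 1.
  by apply: (cvgr_lt (rho 0) crho); rewrite rhos.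
have E : \forall t \near (0 : R^o), 'D_(dir_y R) u (s, t) = dphi (rho t) * (t / rho t).
  have [e /= e0 He] := near1; near=> t.
  rewrite derive_dir_y; have rt1 : rho t < 1.
    by apply: He; near: t; apply/nbhs_ballP; exists e.
  have -> : 'D_1 (fun y : R^o => u (s, y)) t = 'D_1 (phi \o rho) t.
    apply: near_eq_derive.
    have : {for t, continuous rho} by apply/differentiable_continuous/derivable1_diffP; have [] := drho t.
    move=> /cvgr_lt/(_ _ rt1); apply: filterS => y y1.
    by rewrite u_radial.
  have rt : `|rho t| < 1 by rewrite gtr0_norm.
  by have [_ ->] := is_derive1_comp (phi_is_derive rt) (drho t).
have cd : {for s, continuous dphi}.
  apply/differentiable_continuous/derivable1_diffP.
  by have [] := @dphi_is_derive s ltac:(by rewrite gtr0_norm).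
rewrite derive_dir_y; apply: cvg_lim => //.
have C : (dphi (rho t) / rho t) @[t --> (0 : R^o)^'] --> dphi s / s.
  apply: cvg_within_filter.
  have -> : dphi s / s = dphi (rho 0) / rho 0 by rewrite rhos.
  apply: cvgM.
    apply: (@continuous_comp _ _ _ rho dphi) => //; rewrite rhos; exact: cd.
  by apply: cvgV; [rewrite gt_eqF|exact: crho].
apply: cvg_trans C; apply: near_eq_cvg; near=> h.
have h0 : h != 0 by near: h; exact: nbhs_dnbhs_neq.
have Eh : 'D_(dir_y R) u (s, h) = dphi (rho h) * (h / rho h).
  by near: h; apply: nbhs_dnbhs; exact: E.
have E0 : 'D_(dir_y R) u (s, 0) = 0.
  by rewrite (nbhs_singleton E) mul0r mulr0.
rewrite /= addr0 [h *: 1]mulr1 Eh E0 subr0 [_ *: _]mulrC.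
by field; rewrite h0 gt_eqF.
Unshelve. all: by end_near. Qed.

(* For radial [eta] the Laplacian is [(r eta')' / r], so its positivity means
   that [eta] is convex as a function of [ln r]. *)
Lemma radial_log_convex : (forall z, disk z -> 0 < laplacian eta z) ->
  forall r0 : R, 0 < r0 < 1 -> exists x : R, forall r : R, 0 < r < 1 ->
  eta r0%:C + x * ln (r / r0) <= eta r%:C.
Proof.
move=> lap r0 /andP[r00 r01].
pose psi (s : R^o) : R^o := s * dphi s.
pose dd s := 'D_(dir_x R) ('D_(dir_x R) u) (s, 0) : R.
have dpsi (s : R) : 0 < s < 1 -> is_derive (s : R^o) (1 : R^o) psi (dphi s + s * dd s).
  move=> /andP[s0 s1]; have H : is_derive (s : R^o) (1 : R^o) dphi (dd s).
    by apply: dphi_is_derive; rewrite gtr0_norm.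
  have -> : psi = id * dphi by [].
  by apply: is_derive_eq; rewrite addrC [_ *: 1]mulr1.
have dpsi_gt0 s : 0 < s < 1 -> 0 < dphi s + s * dd s.
  move=> /andP[s0 s1]; have := lap s%:C (disk_real _); rewrite gtr0_norm// => /(_ s1).
  rewrite /laplacian /= -/u (derive_yy s0 s1) -/(dd s) => H.
  have -> : dphi s + s * dd s = s * (dd s + dphi s / s) by field; rewrite gt_eqF.
  exact: mulr_gt0.
have psi_mono s t : 0 < s -> s <= t -> t < 1 -> psi s <= psi t.
  move=> s0; rewrite le_eqVlt => /predU1P[->//|st] t1.
  have H x : s <= x <= t -> is_derive (x : R^o) (1 : R^o) psi (dphi x + x * dd x).
    by move=> /andP[? ?]; apply: dpsi; rewrite (lt_le_trans s0)//= (le_lt_trans _ t1).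
  have [|c|c cst E] := @MVT R psi (fun x => dphi x + x * dd x) s t st.
  - by move=> x; rewrite in_itv/= => /andP[? ?]; apply: H; rewrite !ltW.
  - apply: derivable_within_continuous => x; rewrite in_itv/= => /H[].
    by [].
  - rewrite -subr_ge0 E mulr_ge0 ?subr_ge0 ?(ltW st)// ltW// dpsi_gt0//.
    move: cst; rewrite in_itv/= => /andP[sc ct].
    by rewrite (lt_trans s0)//= (lt_trans ct).
(* [psi r0] is the derivative of eta with respect to ln r at r0. The function [G] below is eta minus
   its tangent in ln r, up to a constant; its derivative has the sign of psi s - psi r0, so it is
   smallest at r0. *)
exists (psi r0) => r /andP[rr0 rr1].
pose G (s : R^o) : R^o := phi s - psi r0 * ln s.
have dG (s : R) : 0 < s < 1 -> is_derive (s : R^o) (1 : R^o) G ((psi s - psi r0) / s).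
  move=> /andP[s0 s1]; have H1 : is_derive (s : R^o) (1 : R^o) phi (dphi s).
    by apply: phi_is_derive; rewrite gtr0_norm.
  have H2 := is_derive1_ln s0.
  have H3 := is_deriveB H1 (is_deriveZ (psi r0) H2).
  apply: DeriveDef; first by case: H3.
  have [_ ->] := H3; rewrite /psi /GRing.scale /=; field; exact: lt0r_neq0.
suff : G r0 <= G r.
  rewrite /G /phi lnM ?posrE ?invr_gt0// lnV ?posrE//; lra.
have cG a b : 0 < a -> b < 1 -> {within `[a, b], continuous G}.
  move=> a0 b1; apply: derivable_within_continuous => x; rewrite in_itv/= => /andP[ax xb].
  have x01 : 0 < x < 1 by rewrite (lt_le_trans a0)//= (le_lt_trans xb).
  by have [] := dG x x01.
have dG' a b (x : R) : 0 < a -> b < 1 -> x \in `]a, b[%R -> is_derive (x : R^o) (1 : R^o) G ((psi x - psi r0) / x).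
  move=> a0 b1; rewrite in_itv/= => /andP[ax xb].
  by apply: dG; rewrite (lt_trans a0)//= (lt_trans xb).
case: (ltgtP r0 r) => [lt|lt|->//].
- have [c|c] := @MVT R G (fun s => (psi s - psi r0) / s) r0 r lt _ (cG _ _ r00 rr1).
    exact: dG'.
  rewrite in_itv/= => /andP[c1 c2] E; rewrite -subr_ge0 E mulr_ge0 ?subr_ge0 ?(ltW lt)//.
  rewrite divr_ge0 ?(ltW (lt_trans r00 c1))// subr_ge0.
  by apply: psi_mono => //; [exact: ltW|exact: lt_trans rr1].
- have [c|c] := @MVT R G (fun s => (psi s - psi r0) / s) r r0 lt _ (cG _ _ rr0 r01).
    exact: dG'.
  rewrite in_itv/= => /andP[c1 c2] E; rewrite -subr_le0 E mulr_le0_ge0 ?subr_ge0 ?(ltW lt)//.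
  have c0 := lt_trans rr0 c1.
  rewrite mulr_le0_ge0 ?invr_ge0 ?(ltW c0)// subr_le0.
  by apply: psi_mono => //; exact: ltW.
Qed.

End LogConvexity.

(** * Curves and d_tau *)

Section Curves.
Import HBNNSimple.
Context {R : realType}.
Implicit Types (r th dr dth : R -> R) (s t p L : R) (tau : R[i] -> R).
Local Notation mu := (@lebesgue_measure R).

(* No measurability is needed: the integral of a nonnegative function is the
   supremum of the integrals of the simple functions below it. *)
Lemma integral01_le_off_point (f : R -> \bar R) p L : 0 <= L ->
  (forall t, 0 <= t <= 1 -> (0 <= f t)%E) ->
  (forall t, 0 <= t <= 1 -> t != p -> (f t <= L%:E)%E) ->
  (\int[mu]_(t in `[0%R, 1%R]) f t <= L%:E)%E.
Proof.
move=> L0 f0 fL; rewrite ge0_integralE; last by move=> t /=; rewrite in_itv/=; exact: f0.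
apply: ge_ereal_sup => _ [h /= hf <-].
rewrite -integralT_nnsfun.
have -> : L%:E = (\int[mu]_(t in `[0%R, 1%R]) (cst L%:E) t)%E.
  by rewrite integral_cst//= lebesgue_measure_itv/= lte_fin ltr01 sube0 mule1.
rewrite [leRHS]integral_mkcond; apply: ae_ge0_le_integral => //.
- by move=> t _; rewrite lee_fin.
- by apply/measurable_EFinP.
- by move=> t _; rewrite patchE; case: ifP => // _; rewrite lee_fin.
- by apply/(measurable_restrictT _ _).1.
exists [set p]; split => //; first exact: lebesgue_measure_set1.
move=> t /=; apply: contra_notP => tp _.
have := hf t; rewrite !patchE; case: ifPn => // tD /le_trans; apply.
move: tD; rewrite inE/= in_itv/= => tD; apply: fL => //; exact/eqP.
Qed.

Lemma speed_ge0 (gamma : R -> R[i]) t : 0 <= speed gamma t.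
Proof. exact: normc_ge0. Qed.

Lemma d_tau_ge0 tau z w : (forall z, disk z -> 0 < tau z) -> 0 <= d_tau tau z w.
Proof.
move=> tau0; apply: fine_ge0; apply: le_ereal_inf_tmp => _ [gamma [_ gd _ _] <-].
apply: integral_ge0 => t /=; rewrite in_itv/= => /gd /tau0 ?.
by rewrite lee_fin divr_ge0 ?speed_ge0// ltW.
Qed.

(** The exceptional time [p] is meant for the junction of a two-piece path, where [speed] may take
    an arbitrary value. *)
Lemma d_tau_le tau z w (gamma : R -> R[i]) p L : (forall z, disk z -> 0 < tau z) ->
  connects gamma z w -> 0 <= L ->
  (forall t, 0 <= t <= 1 -> t != p -> speed gamma t / tau (gamma t) <= L) ->
  d_tau tau z w <= L.
Proof.
move=> tau0 co L0 sp.
have len : (tau_length tau gamma <= L%:E)%E.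
  apply: (@integral01_le_off_point _ p) => // t t01.
  have [_ gd _ _] := co.
  by rewrite lee_fin divr_ge0 ?speed_ge0// ltW// tau0//; apply: gd.
pose A := [set tau_length tau gamma | gamma in [set gamma | connects gamma z w]].
have A0 : (0 <= ereal_inf A)%E.
  apply: le_ereal_inf_tmp => _ [ga [_ gd _ _] <-].
  apply: integral_ge0 => t /=; rewrite in_itv/= => /gd /tau0 ?.
  by rewrite lee_fin divr_ge0 ?speed_ge0// ltW.
have AL : (ereal_inf A <= L%:E)%E.
  by apply: le_trans len; apply: ereal_inf_lbound; exists gamma.
have Afin : ereal_inf A \is a fin_num.
  by rewrite ge0_fin_numE// (le_lt_trans AL)// ltry.
by rewrite /d_tau -/A -lee_fin fineK.
Qed.

Definition polar (x t : R) : R[i] := (x * cos t) +i* (x * sin t).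

Lemma normc_polar x t : 0 <= x -> normc (polar x t) = x.
Proof.
by move=> x0; rewrite /normc/= !exprMn -mulrDr cos2Dsin2 mulr1 sqrtr_sqr ger0_norm.
Qed.

Lemma polar_exists z : exists t, [/\ - pi <= t, t <= pi & z = polar (normc z) t].
Proof.
have [->|z0] := eqVneq z 0.
  exists 0; split; rewrite ?oppr_le0 ?pi_ge0//.
  by rewrite normc0 /polar !mul0r.
case: z z0 => x y z0; set N := normc _.
have N0 : 0 < N.
  rewrite lt_neqAle normc_ge0 andbT eq_sym; apply: contra z0 => /eqP /eq0_normc ->.
  by rewrite eqxx.
have N2 : N ^+ 2 = x ^+ 2 + y ^+ 2 by rewrite /N /= sqr_sqrtr// addr_ge0 ?sqr_ge0.
have xN : -1 <= x / N <= 1.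
  by rewrite -ler_norml normrM normfV (gtr0_norm N0) ler_pdivrMr ?mul1r// (norm_Re_le (x +i* y)).
clearbody N; have Nn0 : N != 0 by rewrite gt_eqF.
have cx : cos (acos (x / N)) = x / N by rewrite acosK// in_itv.
have sx : sin (acos (x / N)) = `|y| / N.
  rewrite sin_acos//; have -> : 1 - (x / N) ^+ 2 = (y / N) ^+ 2.
    by rewrite !expr_div_n N2; field; rewrite -N2 expf_neq0// gt_eqF.
  by rewrite sqrtr_sqr normrM normfV (gtr0_norm N0).
have a0 := acos_ge0 xN; have api := acos_lepi xN.
have [y0|y0] := lerP 0 y.
  exists (acos (x / N)); split => //; first by rewrite (le_trans _ a0)// oppr_le0 pi_ge0.
  by rewrite /polar cx sx (ger0_norm y0) (mulrCA N x) (mulrCA N y) divff// !mulr1.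
exists (- acos (x / N)); split; first by rewrite lerN2.
  by rewrite (le_trans _ (pi_ge0 R))// oppr_le0.
by rewrite /polar cosN sinN cx sx (ltr0_norm y0) mulNr opprK (mulrCA N x) (mulrCA N y) divff// !mulr1.
Qed.

Definition is_C1 (f df : R -> R) :=
  (forall s : R, is_derive (s : R^o) (1 : R^o) (f : R^o -> R^o) (df s)) /\ continuous df.

Lemma is_C1_C1 f df : is_C1 f df -> C1 f.
Proof.
move=> [fd cd]; split; first by move=> s; have [] := fd s.
have -> // : derive1 f = df by apply/funext => s; rewrite derive1E; have [_] := fd s.
Qed.

Lemma is_C1_cos th dth : is_C1 th dth -> is_C1 (cos \o th) (fun s => - sin (th s) * dth s).
Proof.
move=> [td cd]; split.
  by move=> s; apply: (is_derive1_comp (is_derive_cos _) (td s)).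
have ct : continuous th by move=> s; apply/differentiable_continuous/derivable1_diffP; have [] := td s.
move=> s; apply: cvgM; last exact: cd.
by apply: cvgN; apply: continuous_comp; [exact: ct|exact: continuous_sin].
Qed.

Lemma is_C1_sin th dth : is_C1 th dth -> is_C1 (sin \o th) (fun s => cos (th s) * dth s).
Proof.
move=> [td cd]; split.
  by move=> s; apply: (is_derive1_comp (is_derive_sin _) (td s)).
have ct : continuous th by move=> s; apply/differentiable_continuous/derivable1_diffP; have [] := td s.
move=> s; apply: cvgM; last exact: cd.
by apply: continuous_comp; [exact: ct|exact: continuous_cos].
Qed.

Lemma is_C1M f g df dg : is_C1 f df -> is_C1 g dg ->
  is_C1 (fun s => f s * g s) (fun s => f s * dg s + g s * df s).
Proof.
move=> [fd cdf] [gd cdg]; split.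
  by move=> s; apply: (is_deriveM (fd s) (gd s)).
have cf : continuous f by move=> s; apply/differentiable_continuous/derivable1_diffP; have [] := fd s.
have cg : continuous g by move=> s; apply/differentiable_continuous/derivable1_diffP; have [] := gd s.
by move=> s; apply: cvgD; apply: cvgM; [exact: cf|exact: cdg|exact: cg|exact: cdf].
Qed.

Lemma is_C1_affine a b : is_C1 (fun s => a + b * s) (cst b).
Proof.
split; last by move=> s; exact: cvg_cst.
move=> s; have -> : (fun s : R => a + b * s) = cst a + (b \*: (id : R^o -> R^o)) by [].
by apply: is_derive_eq; rewrite add0r [_ *: _]mulr1.
Qed.

Lemma is_C1_polar r dr th dth : is_C1 r dr -> is_C1 th dth ->
  is_C1 (fun s => r s * cos (th s)) (fun s => r s * (- sin (th s) * dth s) + cos (th s) * dr s) /\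
  is_C1 (fun s => r s * sin (th s)) (fun s => r s * (cos (th s) * dth s) + sin (th s) * dr s).
Proof.
by move=> Cr Ct; split; [apply: (is_C1M Cr (is_C1_cos Ct))|apply: (is_C1M Cr (is_C1_sin Ct))].
Qed.

Lemma polar_speed_le r dr th dth (gamma : R -> R[i]) s : is_C1 r dr -> is_C1 th dth ->
  0 <= r s -> (\near s, gamma s = polar (r s) (th s)) ->
  speed gamma s <= `|dr s| + r s * `|dth s|.
Proof.
move=> Cr Ct r0 E; have [[dx _] [dy _]] := is_C1_polar Cr Ct; rewrite /speed.
have -> : derive1 (fun s => complex.Re (gamma s)) s =
    r s * (- sin (th s) * dth s) + cos (th s) * dr s.
  rewrite derive1E -(@near_eq_derive _ _ _ (fun s => r s * cos (th s) : R^o)).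
    by have [_] := dx s.
  by apply: filterS E => x ->.
have -> : derive1 (fun s => complex.Im (gamma s)) s =
    r s * (cos (th s) * dth s) + sin (th s) * dr s.
  rewrite derive1E -(@near_eq_derive _ _ _ (fun s => r s * sin (th s) : R^o)).
    by have [_] := dy s.
  by apply: filterS E => x ->.
rewrite /normc -[leRHS]ger0_norm ?addr_ge0 ?mulr_ge0// -sqrtr_sqr ler_wsqrtr//.
have -> : (r s * (- sin (th s) * dth s) + cos (th s) * dr s) ^+ 2 +
  (r s * (cos (th s) * dth s) + sin (th s) * dr s) ^+ 2 =
  (dr s ^+ 2 + (r s * dth s) ^+ 2) * (cos (th s) ^+ 2 + sin (th s) ^+ 2) by ring.
rewrite cos2Dsin2 mulr1 sqrrD !exprMn !real_normK ?num_real//.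
by rewrite lerD2r lerDl mulrn_wge0// !mulr_ge0.
Qed.

(** Two pieces accommodate an arc followed by a radial segment; a single smooth path is the case of
    equal pieces. *)
Lemma d_tau_le_polar2 tau r1 dr1 th1 dth1 r2 dr2 th2 dth2 L :
  (forall z, disk z -> 0 < tau z) ->
  is_C1 r1 dr1 -> is_C1 th1 dth1 -> is_C1 r2 dr2 -> is_C1 th2 dth2 -> 0 <= L ->
  r1 2^-1 = r2 2^-1 -> th1 2^-1 = th2 2^-1 ->
  (forall s, 0 <= s <= 2^-1 -> 0 <= r1 s < 1 /\
    `|dr1 s| + r1 s * `|dth1 s| <= L * tau (polar (r1 s) (th1 s))) ->
  (forall s, 2^-1 <= s <= 1 -> 0 <= r2 s < 1 /\
    `|dr2 s| + r2 s * `|dth2 s| <= L * tau (polar (r2 s) (th2 s))) ->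
  d_tau tau (polar (r1 0) (th1 0)) (polar (r2 1) (th2 1)) <= L.
Proof.
move=> tau0 Cr1 Ct1 Cr2 Ct2 L0 Er Et H1 H2.
pose gamma s := if s <= 2^-1 then polar (r1 s) (th1 s) else polar (r2 s) (th2 s).
have half0 : 0 <= 2^-1 :> R by rewrite invr_ge0.
have half1 : 2^-1 < 1 :> R by rewrite invf_lt1// ltr1n.
have g2 s : 2^-1 <= s -> gamma s = polar (r2 s) (th2 s).
  by rewrite le_eqVlt /gamma => /predU1P[<-|]; [rewrite lexx Er Et|case: ltgtP].
have pd x t : 0 <= x < 1 -> disk (polar x t).
  by move=> /andP[x0 x1]; rewrite /disk/mkset normc_polar.
have gd s : 0 <= s <= 1 -> disk (gamma s).
  move=> /andP[s0 s1]; have [sh|sh] := lerP s 2^-1.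
    by rewrite /gamma sh; apply: pd; have [] := H1 s; rewrite ?s0.
  by rewrite g2 ?(ltW sh)//; apply: pd; have [] := H2 s; rewrite ?s1 ?(ltW sh).
apply: (@d_tau_le _ _ _ gamma 2^-1) => //.
  split => //.
  - exists 2%N, (fun k => k%:R / 2); split => //.
    + by rewrite mul0r.
    + by rewrite divff.
    + by move=> k _; rewrite ltr_pM2r ?invr_gt0// ltr_nat.
    + have [X1 Y1] := is_C1_polar Cr1 Ct1; have [X2 Y2] := is_C1_polar Cr2 Ct2.
      case=> [|[|//]] _; rewrite ?mul0r ?mul1r ?divff//.
        exists (fun s => r1 s * cos (th1 s)), (fun s => r1 s * sin (th1 s)); split.
        * exact: is_C1_C1 X1.
        * exact: is_C1_C1 Y1.
        * by move=> s /andP[_ sh]; rewrite /gamma sh.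
      exists (fun s => r2 s * cos (th2 s)), (fun s => r2 s * sin (th2 s)); split.
      * exact: is_C1_C1 X2.
      * exact: is_C1_C1 Y2.
      * by move=> s /andP[sh _]; rewrite g2.
  - by rewrite /gamma half0.
  - by rewrite g2// ltW.
move=> s s01 sn; have /andP[s0 s1] := s01.
rewrite ler_pdivrMr; last by apply/tau0/gd.
case: (ltgtP s 2^-1) sn => // sh _.
- have [] := H1 s; first by rewrite s0 ltW.
  move=> /andP[r0 _] HL; have -> : gamma s = polar (r1 s) (th1 s) by rewrite /gamma ltW.
  apply: le_trans HL; apply: (polar_speed_le Cr1 Ct1) => //.
  by apply: filterS (lt_nbhsl sh) => x xh; rewrite /gamma ltW.
- have [] := H2 s; first by rewrite s1 andbT ltW.
  move=> /andP[r0 _] HL; rewrite g2 ?(ltW sh)//.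
  apply: le_trans HL; apply: (polar_speed_le Cr2 Ct2) => //.
  by apply: filterS (lt_nbhsr sh) => x xh; rewrite g2// ltW.
Qed.

Lemma d_tau_le_polar tau r dr th dth L :
  (forall z, disk z -> 0 < tau z) -> is_C1 r dr -> is_C1 th dth -> 0 <= L ->
  (forall s, 0 <= s <= 1 -> 0 <= r s < 1 /\
    `|dr s| + r s * `|dth s| <= L * tau (polar (r s) (th s))) ->
  d_tau tau (polar (r 0) (th 0)) (polar (r 1) (th 1)) <= L.
Proof.
move=> tau0 Cr Ct L0 H.
have h1 : 2^-1 <= 1 :> R by rewrite invf_le1// ler1n.
have h0 : 0 <= 2^-1 :> R by rewrite invr_ge0.
apply: (d_tau_le_polar2 tau0 Cr Ct Cr Ct) => // s /andP[s0 s1]; apply: H.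
  by rewrite s0 (le_trans s1).
by rewrite s1 (le_trans h0).
Qed.

Lemma d_tau_refl tau z : (forall z, disk z -> 0 < tau z) -> disk z -> d_tau tau z z = 0.
Proof.
move=> tau0 zd; apply/eqP; rewrite eq_le d_tau_ge0// andbT.
have [t [_ _ zE]] := polar_exists z.
have C (a : R) : is_C1 (cst a) (cst 0).
  by split; [move=> s; apply: is_derive_cst|move=> s; exact: cvg_cst].
rewrite zE; apply: (d_tau_le_polar tau0 (C (normc z)) (C t) (lexx 0)) => s _ /=.
by rewrite normr0 mulr0 addr0 mul0r lexx normc_ge0.
Qed.

End Curves.

(** * Area integrals *)

Section Plane.
Context {R : realType}.
Implicit Types (U : set (R * R)) (p q : R * R) (z b : R[i]) (T r v : R) (k : nat).
Local Notation plane := (measurableTypeR R * measurableTypeR R)%type.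
Local Notation mu := (@lebesgue_measure R).

Definition square p r : set plane := `]p.1 - r, p.1 + r[%classic `*` `]p.2 - r, p.2 + r[%classic.

Lemma measurable_square p r : measurable (square p r).
Proof. by apply: measurableX; exact: measurable_itv. Qed.

Lemma open_measurable_plane U : open U -> measurable (U : set plane).
Proof.
move=> oU.
pose F (x y : rat) (n : nat) : set plane :=
  if pselect (square (ratr x, ratr y) n.+1%:R^-1 `<=` U) then square (ratr x, ratr y) n.+1%:R^-1 else set0.
suff -> : U = \bigcup_x \bigcup_y \bigcup_n F x y n.
  apply: bigcupT_measurable_rat => x; apply: bigcupT_measurable_rat => y.
  apply: bigcupT_measurable => n; rewrite /F; case: pselect => ? /=; [exact: measurable_square|exact: measurable0].
rewrite predeqE => -[a c]; split; last first.
  by move=> [x _ [y _ [n _]]]; rewrite /F; case: pselect => //= sub; exact: sub.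
move=> Uac; have Un : nbhs (a, c) U by exact: open_nbhs_nbhs.
have [e /= e0 He] := (@nbhs_ballP R (R * R)%type (a, c) U).1 Un.
(* The rational centre lies within [h] of the point and the square has half-side [h], hence the
   requirement 2 h < e. *)
pose n := Num.bound (2 / e); pose h : R := n.+1%:R^-1.
have h0 : 0 < h by rewrite invr_gt0.
have he : 2 * h < e.
  rewrite /h ltr_pdivrMr// -ltr_pdivrMl// mulrC.
  rewrite (@lt_le_trans _ _ n%:R)// ?ler_nat//.
  by apply: archi_boundP; rewrite divr_ge0// ltW.
have [x] := @rat_in_itvoo R (a - h) (a + h) ltac:(lra).
have [y] := @rat_in_itvoo R (c - h) (c + h) ltac:(lra).
rewrite !in_itv/= => /andP[y1 y2] /andP[x1 x2].
exists x => //; exists y => //; exists n => //; rewrite /F; case: pselect => [?|H].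
  by split; rewrite /= in_itv/= -/h; lra.
exfalso; apply: H => -[u w] [/=]; rewrite !in_itv/= -/h => /andP[u1 u2] /andP[w1 w2].
by apply: He; split; rewrite /ball/= ltr_norml; lra.
Qed.

Lemma normc_cplx_sub p b : normc (cplx p - b) =
  Num.sqrt ((p.1 - complex.Re b) ^+ 2 + (p.2 - complex.Im b) ^+ 2).
Proof. by case: b => x y. Qed.

Lemma continuous_normc_sub b : continuous (fun p => normc (cplx p - b)).
Proof.
move=> p; rewrite (_ : (fun p => _) = Num.sqrt \o
   (fun p => (p.1 - complex.Re b) * (p.1 - complex.Re b) +
     (p.2 - complex.Im b) * (p.2 - complex.Im b))); last first.
  by apply/funext => q /=; rewrite normc_cplx_sub !expr2.
have c1 : (fun q : R * R => q.1 - complex.Re b) @ p --> p.1 - complex.Re b.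
  by apply: cvgB; [exact: cvg_fst|exact: cvg_cst].
have c2 : (fun q : R * R => q.2 - complex.Im b) @ p --> p.2 - complex.Im b.
  by apply: cvgB; [exact: cvg_snd|exact: cvg_cst].
apply: continuous_comp; last exact: sqrt_continuous.
by apply: cvgD; apply: cvgM.
Qed.

Lemma open_disk2 : open (@disk2 R).
Proof.
have -> : @disk2 R = (fun p => normc (cplx p - 0)) @^-1` [set x | x < 1].
  by apply/funext => p; rewrite /disk2 /disk /preimage /mkset subr0.
apply: open_comp; last exact: open_lt.
by move=> p _; exact: continuous_normc_sub.
Qed.

Lemma measurable_disk2 : measurable (@disk2 R : set plane).
Proof. by apply: open_measurable_plane; exact: open_disk2. Qed.

Lemma open_continuous_measurable_plane U (g : R * R -> R) : open U ->
  (forall p, U p -> {for p, continuous g}) -> measurable_fun (U : set plane) (g : plane -> R).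
Proof.
move=> oU cg; apply: (measurability _ (RGenOInfty.measurableE R)).
move=> _ [_ [a ->] <-]; apply: open_measurable_plane.
rewrite openE /interior => p /= [Up]; rewrite /= in_itv/= andbT => ap.
apply: filterI; first by apply: open_nbhs_nbhs.
have H : \near p, a < g p by apply: (cvgr_gt (g p) (cg p Up)).
by apply: (filterS _ H) => q /=; rewrite in_itv/= andbT.
Qed.

Lemma cderivable_continuous_plane (f : R[i] -> R[i]) p : cderivable f (cplx p) ->
  {for p, continuous (fun p => complex.Re (f (cplx p)))} /\
  {for p, continuous (fun p => complex.Im (f (cplx p)))}.
Proof.
move=> /cderivable_linear_approx[D HD]; have [d d0 Hd] := HD 1 ltr01.
suff H e : 0 < e -> \forall q \near p, normc (f (cplx p) - f (cplx q)) <= e.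
  split; apply/cvgrPdist_le => e /H; apply: filterS => q; apply: le_trans.
    by apply: le_trans (norm_Re_le _); case: (f _) => ? ?; case: (f _).
  by apply: le_trans (norm_Im_le _); case: (f _) => ? ?; case: (f _).
move=> e0; pose c := 1 + normc D; have c0 : 0 < c by rewrite ltr_pwDl// normc_ge0.
pose m := Num.min d (e / c); have m0 : 0 < m by rewrite lt_min d0 divr_gt0.
have near_m : \forall q \near p, normc (cplx q - cplx p) < m.
  apply: (cvgr_lt _ (continuous_normc_sub (b := cplx p) (x := p))).
  by rewrite subrr normc0.
apply: filterS near_m => q; rewrite lt_min => /andP[qd qe].
have := Hd _ qd; rewrite mul1r => H.
rewrite -opprB normcN; have -> : f (cplx q) - f (cplx p) =
  (f (cplx q) - f (cplx p) - D * (cplx q - cplx p)) + D * (cplx q - cplx p) by rewrite subrK.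
rewrite (le_trans (le_normcD _ _))// normcM.
move: qe; rewrite ltr_pdivlMr// /c; lra.
Qed.

(** A null set through [b], to be discarded: off it the distance to [b] is positive and the
    quotients by that distance are genuine. *)
Definition cross b : set plane := [set p | p.1 = complex.Re b \/ p.2 = complex.Im b].

Lemma crossE b : cross b = ([set complex.Re b] `*` setT) `|` (setT `*` [set complex.Im b]).
Proof. by rewrite predeqE => -[x y]; rewrite /cross /=; split => [[]|[[]|[]]]; tauto. Qed.

Lemma measurable_cross b : measurable (cross b).
Proof. by rewrite crossE; apply: measurableU; apply: measurableX. Qed.

Lemma dA_setX (A B : set R) : measurable A -> measurable B ->
  @dA R (A `*` B) = (pi^-1%:E * (mu A * mu B))%E.
Proof. by move=> mA mB; rewrite /dA /mscale; congr (_ * _)%E; exact: product_measure1E. Qed.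

Lemma dA_cross b : @dA R (cross b) = 0%E.
Proof.
apply/eqP; rewrite eq_le measure_ge0 andbT crossE.
apply: (le_trans (measureU2 _ _ _)); [exact: measurableX..|].
have mu1 (x : R) : mu [set x] = 0%E by exact: lebesgue_measure_set1.
have E1 : @dA R ([set complex.Re b] `*` setT) = 0%E by rewrite dA_setX// mu1 mul0e mule0.
have E2 : @dA R (setT `*` [set complex.Im b]) = 0%E by rewrite dA_setX// mu1 mule0 mule0.
by rewrite -[X in (_ <= X)%E]adde0 -{1}E1 -E2.
Qed.

Lemma not_cross_neq b p : ~ cross b p -> cplx p != b.
Proof. by move=> H; apply: contra_notN H => /eqP <-; left. Qed.

Lemma dA_square_le p r : 0 <= r -> (@dA R (square p r) <= (4 * r ^+ 2)%:E)%E.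
Proof.
move=> r0; rewrite dA_setX//.
have E (x : R) : mu `]x - r, x + r[%classic = (2 * r)%:E.
  rewrite lebesgue_measure_itv/= lte_fin; case: ltP => [_|]; last first.
    move=> H; suff -> : r = 0%R by rewrite mulr0.
    by apply/eqP; rewrite eq_le r0 andbT; lra.
  by rewrite -EFinD; congr EFin; ring.
rewrite !E -!EFinM lee_fin -[leRHS]mul1r (_ : 2 * r * (2 * r) = 4 * r ^+ 2); last by ring.
rewrite ler_wpM2r ?mulr_ge0 ?sqr_ge0// invf_le1 ?pi_gt0//.
by rewrite (le_trans _ (pi_ge2 R))// ler1n.
Qed.

(** It is v^(-3/2) up to scale [T] and T v^(-5/2) beyond. As a function of the distance to a point
    it is integrable over the plane at both ends, with integral of order T^(1/2). *)
Definition tail_ker T v : R := Num.min 1 (T / v) / (v * Num.sqrt v).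

Lemma tail_ker_ge0 T v : 0 <= T -> 0 <= v -> 0 <= tail_ker T v.
Proof. by move=> T0 v0; rewrite divr_ge0 ?mulr_ge0 ?sqrtr_ge0// le_min ler01 divr_ge0. Qed.

Lemma measurable_tail_ker T b :
  measurable_fun (setT : set plane) (fun p : plane => tail_ker T (normc (cplx p - b))).
Proof.
have mn : measurable_fun (setT : set plane) (fun p : plane => normc (cplx p - b)).
  apply: open_continuous_measurable_plane; first exact: openT.
  by move=> p _; exact: continuous_normc_sub.
apply: (eq_measurable_fun (fun p : plane => Num.min 1 (T * normc (cplx p - b) `^ (-1)) *
    (normc (cplx p - b) * Num.sqrt (normc (cplx p - b))) `^ (-1))).
  by move=> p _; rewrite /tail_ker !powR_inv1 ?mulr_ge0 ?sqrtr_ge0 ?normc_ge0.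
apply: measurable_funM.
  apply: measurable_minr; first exact: measurable_cst.
  apply: measurable_funM; first exact: measurable_cst.
  exact: (measurableT_comp (measurable_powR _) mn).
apply: (measurableT_comp (measurable_powR _)); apply: measurable_funM => //.
by apply: measurableT_comp mn; apply: continuous_measurable_fun; exact: sqrt_continuous.
Qed.

Lemma sqrt_4X k : Num.sqrt (4 ^+ k) = 2 ^+ k :> R.
Proof.
have -> : 4 ^+ k = (2 ^+ k) ^+ 2 :> R by rewrite -exprM mulnC exprM; congr (_ ^+ _); ring.
by rewrite sqrtr_sqr ger0_norm// exprn_ge0.
Qed.

Lemma mul_sqrt_4X k : 4 ^+ k * Num.sqrt (4 ^+ k) = 8 ^+ k :> R.
Proof. by rewrite sqrt_4X -exprMn; congr (_ ^+ _); ring. Qed.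

Lemma ler_mul_sqrt (x y : R) : 0 <= x -> x <= y -> x * Num.sqrt x <= y * Num.sqrt y.
Proof. by move=> x0 xy; apply: ler_pM => //; rewrite ?sqrtr_ge0// ler_wsqrtr. Qed.

Lemma tail_ker_near T v k : 0 < T -> T / 4 ^+ k.+1 <= v ->
  tail_ker T v <= 8 ^+ k.+1 / (T * Num.sqrt T).
Proof.
move=> T0 Hv.
have p0 : 0 < 4 ^+ k.+1 :> R by rewrite exprn_gt0.
have v0 : 0 < v by apply: lt_le_trans Hv; rewrite divr_gt0.
have D0 (x : R) : 0 < x -> 0 < x * Num.sqrt x by move=> x0; rewrite mulr_gt0 ?sqrtr_gt0.
apply: (@le_trans _ _ (v * Num.sqrt v)^-1).
  by apply: ler_piMl; [rewrite invr_ge0 ltW ?D0|rewrite ge_min lexx].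
rewrite -(@invrK _ (8 ^+ _ / _)) lef_pV2 ?posrE ?D0// ?invr_gt0 ?divr_gt0 ?exprn_gt0 ?D0//.
have H : 0 <= T / 4 ^+ k.+1 by rewrite divr_ge0// ltW.
apply: le_trans (ler_mul_sqrt H Hv).
rewrite invf_div -mul_sqrt_4X sqrtrM ?(ltW T0)// sqrtrV ?(ltW p0)//.
rewrite le_eqVlt; apply/orP; left; apply/eqP; field.
by rewrite !gt_eqF ?sqrtr_gt0.
Qed.

Lemma tail_ker_far T v k : 0 < T -> T * 4 ^+ k <= v ->
  tail_ker T v <= (32 ^+ k * (T * Num.sqrt T))^-1.
Proof.
move=> T0 Hv.
have p0 : 0 < 4 ^+ k :> R by rewrite exprn_gt0.
have v0 : 0 < v by apply: lt_le_trans Hv; rewrite mulr_gt0.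
have D0 (x : R) : 0 < x -> 0 < x * Num.sqrt x by move=> x0; rewrite mulr_gt0 ?sqrtr_gt0.
apply: (@le_trans _ _ ((T / v) / (v * Num.sqrt v))).
  by apply: ler_wpM2r; [rewrite invr_ge0 ltW ?D0|rewrite ge_min lexx orbT].
have H : 0 <= T * 4 ^+ k by rewrite mulr_ge0// ltW.
have H1 : T / v <= (4 ^+ k)^-1 by rewrite ler_pdivrMr// mulrC ler_pdivlMr.
have H2 : (v * Num.sqrt v)^-1 <= (8 ^+ k * (T * Num.sqrt T))^-1.
  rewrite lef_pV2 ?posrE ?D0 ?mulr_gt0 ?exprn_gt0 ?sqrtr_gt0//.
  apply: le_trans (ler_mul_sqrt H Hv).
  rewrite -mul_sqrt_4X sqrtrM ?(ltW T0)//.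
  by rewrite le_eqVlt; apply/orP; left; apply/eqP; ring.
apply: (@le_trans _ _ ((4 ^+ k)^-1 * (8 ^+ k * (T * Num.sqrt T))^-1)).
  by apply: ler_pM => //; [rewrite divr_ge0// ltW|rewrite invr_ge0 ltW ?D0].
have -> : 32 ^+ k = 4 ^+ k * 8 ^+ k :> R by rewrite -exprMn; congr (_ ^+ _); ring.
by rewrite -[X in _ <= X^-1]mulrA [leRHS]invfM.
Qed.

Lemma dyadic_cover T v : 0 < T -> 0 < v ->
  (exists k, T / 4 ^+ k.+1 <= v < T / 4 ^+ k) \/ (exists k, T * 4 ^+ k <= v < T * 4 ^+ k.+1).
Proof.
move=> T0 v0.
have archi (x : R) : 0 <= x -> exists k, x < 4 ^+ k.
  move=> x0; exists (Num.bound x); apply: (@lt_le_trans _ _ (Num.bound x)%:R).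
    exact: archi_boundP.
  by rewrite -natrX ler_nat; exact/ltnW/ltn_expl.
have [vT|Tv] := ltrP v T; [left|right].
- have [k0 Hk0] := archi (T / v) ltac:(by rewrite divr_ge0// ltW).
  have ex : exists k, T / 4 ^+ k <= v.
    by exists k0; rewrite ler_pdivrMr ?exprn_gt0// mulrC -ler_pdivrMr// ltW.
  case: (ex_minnP ex) => -[|k] Hk Hmin; first by move: Hk; rewrite expr0 divr1 leNgt vT.
  exists k; rewrite Hk /= ltNge; apply/negP => /Hmin; by rewrite ltnn.
- have [k0 Hk0] := archi (v / T) ltac:(by rewrite divr_ge0// ltW).
  have ex : exists k, v < T * 4 ^+ k by exists k0; rewrite mulrC -ltr_pdivrMr.
  case: (ex_minnP ex) => -[|k] Hk Hmin; first by move: Hk; rewrite expr0 mulr1 ltNge Tv.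
  exists k; rewrite Hk andbT leNgt; apply/negP => /Hmin; by rewrite ltnn.
Qed.

Lemma indic_square_integral_le b c r : 0 <= c -> 0 <= r ->
  (\int[@dA R]_(p in @disk2 R) (c * \1_(square (complex.Re b, complex.Im b) r) p)%:E
     <= (c * (4 * r ^+ 2))%:E)%E.
Proof.
move=> c0 r0; set S := square _ r.
have mS : measurable S by exact: measurable_square.
have mI : measurable_fun (@disk2 R : set plane) (fun p : plane => (\1_S p)%:E : \bar R).
  by apply/measurable_EFinP; apply: measurable_funTS; exact: measurable_indic.
under eq_integral do rewrite EFinM.
rewrite ge0_integralZl_EFin//; last exact: measurable_disk2.
rewrite integral_indic//; last exact: measurable_disk2.
rewrite [leRHS]EFinM lee_wpmul2l ?lee_fin//.
apply: le_trans (dA_square_le (complex.Re b, complex.Im b) r0).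
apply: le_measure; [|by rewrite inE|by move=> p []].
by rewrite inE; apply: measurableI => //; exact: measurable_disk2.
Qed.

Lemma mem_square b p r : normc (cplx p - b) < r ->
  p \in (square (complex.Re b, complex.Im b) r : set (R * R)).
Proof.
move=> H; have := le_lt_trans (norm_Re_le _) H; have := le_lt_trans (norm_Im_le _) H.
case: b {H} => x y /=; rewrite !ltr_norml inE /square/= => ? ?.
by split; rewrite /= in_itv/=; lra.
Qed.

(** Squares at the scales T / 4^k and T 4^(k+1) dominate the kernel shell by shell. Sup times area
    is 32 sqrt(T) / 2^k on the near shells and 64 sqrt(T) / 2^k on the far ones, which sum to 64 and
    128 times sqrt(T). Base 4 keeps the square roots of the scales powers of 2. *)
Lemma integral_tail_ker_le T b : 0 < T ->
  (\int[@dA R]_(p in @disk2 R) (tail_ker T (normc (cplx p - b)))%:E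
    <= (192 * Num.sqrt T)%:E)%E.
Proof.
move=> T0; pose s := T * Num.sqrt T.
have sT0 : 0 < Num.sqrt T by rewrite sqrtr_gt0.
have s0 : 0 < s by rewrite mulr_gt0.
pose sq r := square (complex.Re b, complex.Im b) r.
pose F k (p : plane) : \bar R := ((8 ^+ k.+1 / s) * \1_(sq (T / 4 ^+ k)) p)%:E.
pose G k (p : plane) : \bar R := ((32 ^+ k * s)^-1 * \1_(sq (T * 4 ^+ k.+1)) p)%:E.
have cF k : 0 <= 8 ^+ k.+1 / s by rewrite divr_ge0 ?exprn_ge0// ltW.
have cG k : 0 <= (32 ^+ k * s)^-1 by rewrite invr_ge0 mulr_ge0 ?exprn_ge0// ltW.
have F0 k p : (0 <= F k p)%E by rewrite lee_fin mulr_ge0.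
have G0 k p : (0 <= G k p)%E by rewrite lee_fin mulr_ge0.
have mI c r : measurable_fun (@disk2 R : set plane) (fun p : plane => (c * \1_(sq r) p)%:E : \bar R).
  apply/measurable_EFinP; apply: measurable_funTS.
  by apply: measurable_funM => //; apply: measurable_indic; exact: measurable_square.
have mF k : measurable_fun (@disk2 R : set plane) (F k) by exact: mI.
have mG k : measurable_fun (@disk2 R : set plane) (G k) by exact: mI.
have pt p : ~ cross b p -> ((tail_ker T (normc (cplx p - b)))%:E <=
    \sum_(k <oo) F k p + \sum_(k <oo) G k p)%E.
  move=> /not_cross_neq pb; set v := normc _.
  have v0 : 0 < v.
    rewrite lt_neqAle normc_ge0 andbT eq_sym; apply: contra pb => /eqP /eq0_normc /eqP.
    by rewrite subr_eq0.
  have term (H : nat -> plane -> \bar R) k : (forall k p, 0 <= H k p)%E ->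
      (H k p <= \sum_(k <oo) H k p)%E.
    move=> H0; apply: le_trans (@nneseries_lim_ge R (H^~ p) xpredT 0%N k.+1 _) => //.
    by rewrite big_nat_recr//= leeDr// sume_ge0.
  have sF0 : (0 <= \sum_(k <oo) F k p)%E by apply: nneseries_ge0 => n _ _.
  have sG0 : (0 <= \sum_(k <oo) G k p)%E by apply: nneseries_ge0 => n _ _.
  have [[k /andP[k1 k2]]|[k /andP[k1 k2]]] := dyadic_cover T0 v0.
    apply: (@le_trans _ _ (F k p)); last first.
      by apply: le_trans (term F k F0) _; rewrite leeDl.
    by rewrite /F indicE mem_square// mulr1 lee_fin; exact: tail_ker_near.
  apply: (@le_trans _ _ (G k p)); last first.
    by apply: le_trans (term G k G0) _; rewrite leeDr.
  by rewrite /G indicE mem_square// mulr1 lee_fin; exact: tail_ker_far.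
have mD := measurable_disk2.
apply: (@le_trans _ _ (\int[@dA R]_(p in @disk2 R) (\sum_(k <oo) F k p + \sum_(k <oo) G k p))%E).
  apply: ae_ge0_le_integral => //.
  - by move=> p _; rewrite lee_fin tail_ker_ge0 ?normc_ge0// ltW.
  - apply/measurable_EFinP; apply: measurable_funTS; exact: measurable_tail_ker.
  - by move=> p _; rewrite adde_ge0// nneseries_ge0.
  - by apply: emeasurable_funD; apply: ge0_emeasurable_sum => //.
  - exists (cross b); split; [exact: measurable_cross|exact: dA_cross|].
    by move=> p /=; apply: contra_notP => H _; exact: pt.
rewrite ge0_integralD//; first last.
- by apply: ge0_emeasurable_sum.
- by move=> p _; rewrite nneseries_ge0.
- by apply: ge0_emeasurable_sum.
- by move=> p _; rewrite nneseries_ge0.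
rewrite !integral_nneseries//.
have -> : 192 * Num.sqrt T = 64 * Num.sqrt T + 128 * Num.sqrt T by ring.
rewrite EFinD; apply: leeD.
- apply: le_trans (@epsilon_trick0 R (64 * Num.sqrt T) xpredT _); last by rewrite mulr_ge0// ltW.
  apply: lee_nneseries => [k *|k *]; first by apply: integral_ge0 => p _; exact: F0.
  apply: (le_trans (indic_square_integral_le b (cF k) _)); first by rewrite divr_ge0 ?exprn_ge0// ltW.
  rewrite lee_fin /s (_ : 8 ^+ k.+1 = 8 * 8 ^+ k :> R) ?exprS//.
  have -> : 8 ^+ k = 4 ^+ k * 2 ^+ k :> R by rewrite -exprMn; congr (_ ^+ _); ring.
  rewrite natrX exprS (_ : 4 ^+ k = 2 ^+ k * 2 ^+ k :> R); last by rewrite -exprMn; congr (_ ^+ _); ring.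
  rewrite le_eqVlt; apply/orP; left; apply/eqP.
  have sqT : T = Num.sqrt T ^+ 2 by rewrite sqr_sqrtr// ltW.
  move: (Num.sqrt T) sT0 sqT => q q0 sqT; rewrite sqT; field.
  by rewrite expf_neq0//= gt_eqF.
- apply: le_trans (@epsilon_trick0 R (128 * Num.sqrt T) xpredT _); last by rewrite mulr_ge0// ltW.
  apply: lee_nneseries => [k *|k *]; first by apply: integral_ge0 => p _; exact: G0.
  apply: (le_trans (indic_square_integral_le b (cG k) _)); first by rewrite mulr_ge0 ?exprn_ge0// ltW.
  rewrite lee_fin /s.
  have -> : 32 ^+ k = 4 ^+ k * (4 ^+ k * 2 ^+ k) :> R by rewrite -!exprMn; congr (_ ^+ _); ring.
  rewrite natrX !exprS.
  rewrite le_eqVlt; apply/orP; left; apply/eqP.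
  have sqT : T = Num.sqrt T ^+ 2 by rewrite sqr_sqrtr// ltW.
  move: (Num.sqrt T) sT0 sqT => q q0 sqT; rewrite sqT; field.
  by rewrite !expf_neq0//= gt_eqF.
Qed.

End Plane.

(** * The space A2 *)

Section A2.
Context {R : realType}.
Implicit Types (f g h : R[i] -> R[i]) (z w c : R[i]) (p : R * R).
Local Notation plane := (measurableTypeR R * measurableTypeR R)%type.
Local Notation D := (@disk2 R : set plane).
Local Notation dA := (@dA R).

Context (omega : R[i] -> R).
Context (momega : measurable_fun D (omega \o @cplx R : plane -> R)).
Let W p := omega (cplx p).

Let mD : measurable D := @measurable_disk2 R.

Lemma holomorphic_measurable f : holomorphic_disk f ->
  measurable_fun D (fun p : plane => complex.Re (f (cplx p))) /\
  measurable_fun D (fun p : plane => complex.Im (f (cplx p))).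
Proof.
by move=> hf; split; (apply: open_continuous_measurable_plane => [|p Dp]; [exact: open_disk2|
  have [] := cderivable_continuous_plane (hf _ Dp)]).
Qed.

Lemma holomorphic_measurable_normc f : holomorphic_disk f ->
  measurable_fun D (fun p : plane => normc (f (cplx p))).
Proof.
move=> /holomorphic_measurable[mu mv].
apply: (eq_measurable_fun (fun p : plane =>
  Num.sqrt (complex.Re (f (cplx p)) ^+ 2 + complex.Im (f (cplx p)) ^+ 2))).
  by move=> p _; case: (f _).
apply: (@measurableT_comp _ _ _ _ _ _ (@Num.sqrt R)).
  by apply: continuous_measurable_fun; exact: sqrt_continuous.
by apply: measurable_funD; exact: measurable_funX.
Qed.

Let sqnorm f := (\int[dA]_(p in D) ((normc (f (cplx p)) * W p) ^+ 2)%:E)%E.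

Lemma measurable_sqnorm f : holomorphic_disk f ->
  measurable_fun D (fun p : plane => ((normc (f (cplx p)) * W p) ^+ 2)%:E : \bar R).
Proof.
move=> hf; apply/measurable_EFinP; apply: measurable_funX; apply: measurable_funM => //.
exact: holomorphic_measurable_normc.
Qed.

Lemma measurable_normcM f g : holomorphic_disk f -> holomorphic_disk g ->
  measurable_fun D (fun p : plane =>
    (normc (f (cplx p)) * normc (g (cplx p)) * W p ^+ 2)%:E : \bar R).
Proof.
move=> hf hg; apply/measurable_EFinP; apply: measurable_funM; last exact: measurable_funX.
by apply: measurable_funM; exact: holomorphic_measurable_normc.
Qed.

Lemma A2_sqnormE f : A2 omega f -> sqnorm f = (A2norm omega f ^+ 2)%:E.
Proof.
move=> [_ fi]; have i0 : (0 <= sqnorm f)%E.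
  by apply: integral_ge0 => p _; rewrite lee_fin sqr_ge0.
rewrite /A2norm sqr_sqrtr ?fine_ge0// fineK//.
by rewrite ge0_fin_numE.
Qed.

Lemma A2_of_le f u : holomorphic_disk f ->
  (\int[dA]_(p in D) ((normc (f (cplx p)) * W p) ^+ 2)%:E <= u%:E)%E -> A2 omega f.
Proof. by move=> hf H; split => //; apply: le_lt_trans H _; rewrite ltry. Qed.

Lemma A2norm_le f u : A2 omega f ->
  (\int[dA]_(p in D) ((normc (f (cplx p)) * W p) ^+ 2)%:E <= u%:E)%E ->
  A2norm omega f ^+ 2 <= u.
Proof. by move=> fA H; rewrite -lee_fin -A2_sqnormE. Qed.

Let F f g p := f (cplx p) * conjc (g (cplx p)) * (omega (cplx p) ^+ 2)%:C.

Let normF f g p : normc (F f g p) = normc (f (cplx p)) * normc (g (cplx p)) * W p ^+ 2.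
Proof. by rewrite !normcM normc_conj normc_real ger0_norm ?sqr_ge0. Qed.

Let nnF f g p : 0 <= normc (f (cplx p)) * normc (g (cplx p)) * W p ^+ 2.
Proof. by rewrite -normF normc_ge0. Qed.

Let mF f g : holomorphic_disk f -> holomorphic_disk g ->
  measurable_fun D (fun p : plane => complex.Re (F f g p)) /\
  measurable_fun D (fun p : plane => complex.Im (F f g p)).
Proof.
move=> /holomorphic_measurable[f1 f2] /holomorphic_measurable[g1 g2].
have m2 : measurable_fun D (fun p : plane => W p ^+ 2) by exact: measurable_funX.
split.
  apply: (eq_measurable_fun (fun p : plane =>
    (complex.Re (f (cplx p)) * complex.Re (g (cplx p)) +
     complex.Im (f (cplx p)) * complex.Im (g (cplx p))) * W p ^+ 2)).
    by move=> p _; rewrite /F /W; case: (f _) (g _) => [? ?] [? ?] /=; ring.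
  by apply: measurable_funM => //; apply: measurable_funD; apply: measurable_funM.
apply: (eq_measurable_fun (fun p : plane =>
    (complex.Im (f (cplx p)) * complex.Re (g (cplx p)) -
     complex.Re (f (cplx p)) * complex.Im (g (cplx p))) * W p ^+ 2)).
  by move=> p _; rewrite /F /W; case: (f _) (g _) => [? ?] [? ?] /=; ring.
by apply: measurable_funM => //; apply: measurable_funB; apply: measurable_funM.
Qed.

Let absF f g : A2 omega f -> A2 omega g ->
  (\int[dA]_(p in D) (normc (f (cplx p)) * normc (g (cplx p)) * W p ^+ 2)%:E < +oo)%E.
Proof.
move=> [hf fi] [hg gi].
have mf := measurable_sqnorm hf; have mg := measurable_sqnorm hg.
apply: (@le_lt_trans _ _ (sqnorm f + sqnorm g)%E); last exact: lte_add_pinfty.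
rewrite /sqnorm -ge0_integralD//; try by move=> p _; rewrite lee_fin sqr_ge0.
apply: ge0_le_integral => //.
- by move=> p _; rewrite lee_fin nnF.
- exact: measurable_normcM.
- exact: emeasurable_funD.
move=> p _; rewrite -EFinD lee_fin !exprMn -mulrDl ler_wpM2r ?sqr_ge0//.
have := sqr_ge0 (normc (f (cplx p)) - normc (g (cplx p))).
have := normc_ge0 (f (cplx p)); have := normc_ge0 (g (cplx p)); nra.
Qed.

Let intF f g : A2 omega f -> A2 omega g ->
  dA.-integrable D (EFin \o (fun p => complex.Re (F f g p))) /\
  dA.-integrable D (EFin \o (fun p => complex.Im (F f g p))).
Proof.
move=> fA gA; have lt := absF fA gA; move: fA gA => [hf _] [hg _].
have mn := measurable_normcM hf hg.
have [m1 m2] := mF hf hg.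
have aux (u : plane -> R) : measurable_fun D u -> (forall p, `|u p| <= normc (F f g p)) ->
    dA.-integrable D (EFin \o u).
  move=> mu ub; have mu' : measurable_fun D (EFin \o u) by exact/measurable_EFinP.
  apply/integrableP; split => //; apply: le_lt_trans lt; apply: ge0_le_integral => //.
    exact: measurableT_comp.
  by move=> p Dp; rewrite lee_fin -normF.
by split; apply: aux => // p; [exact: norm_Re_le|exact: norm_Im_le].
Qed.

(** The factor 2 comes from bounding real and imaginary parts separately. It is the source of the
    factor 4 in the squared estimates and affects only constants. *)
Lemma A2inner_le f g : A2 omega f -> A2 omega g ->
  ((normc (A2inner omega f g))%:E <=
   2%:E * \int[dA]_(p in D) (normc (f (cplx p)) * normc (g (cplx p)) * W p ^+ 2)%:E)%E.
Proof.
move=> fA gA; have lt := absF fA gA; have [i1 i2] := intF fA gA.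
set J := (\int[dA]_(p in D) _)%E in lt *.
have J0 : (0 <= J)%E.
  by apply: integral_ge0 => p _; rewrite lee_fin nnF.
have JE : J = (fine J)%:E by rewrite fineK// ge0_fin_numE.
move: fA gA => [hf _] [hg _].
have mn := measurable_normcM hf hg.
have bound (u : plane -> R) : dA.-integrable D (EFin \o u) ->
    (forall p, `|u p| <= normc (F f g p)) -> `|Rintegral dA D u| <= fine J.
  move=> iu ub; have mu := measurable_int _ iu.
  rewrite -lee_fin -JE EFin_normr_Rintegral//.
  apply: (le_trans (le_abse_integral _ _ _)) => //.
  apply: ge0_le_integral => //; first exact: measurableT_comp.
  by move=> p Dp; rewrite lee_fin -normF.
rewrite JE -EFinM lee_fin (le_trans (normc_le_ReIm _))//= mulr_natl mulr2n.
by apply: lerD; apply: bound => // p; [exact: norm_Re_le|exact: norm_Im_le].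
Qed.

(** Cauchy-Schwarz up to a constant, from 2 |f g| <= t |f|^2 + |g|^2 / t integrated, then optimized
    in t. The choice t = n / (2 X) turns n <= t X + Y / t into n^2 <= 4 X Y. *)
Lemma A2inner_sqr_le f g : A2 omega f -> A2 omega g ->
  normc (A2inner omega f g) ^+ 2 <= 4 * A2norm omega f ^+ 2 * A2norm omega g ^+ 2.
Proof.
move=> fA gA; set n := normc _; set X := A2norm omega f ^+ 2; set Y := A2norm omega g ^+ 2.
have [X0 Y0] : 0 <= X /\ 0 <= Y by rewrite !sqr_ge0.
have n0 : 0 <= n by exact: normc_ge0.
have [[hf _] [hg _]] := (fA, gA).
have m1 := measurable_sqnorm hf; have m2 := measurable_sqnorm hg.
have m3 := measurable_normcM hf hg.
have H (t : R) : 0 < t -> n <= t * X + t^-1 * Y.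
  move=> t0; rewrite -lee_fin; apply: le_trans (A2inner_le fA gA) _.
  rewrite (EFinD (t * X)) (EFinM t) (EFinM t^-1) -!A2_sqnormE//.
  have t0' : 0 <= t^-1 by rewrite invr_ge0 ltW.
  have t00 := ltW t0.
  have mm1 := measurable_funeM t%:E m1; have mm2 := measurable_funeM (t^-1)%:E m2.
  rewrite -!ge0_integralZl_EFin//; try by move=> p _; rewrite lee_fin ?sqr_ge0// nnF.
  rewrite -ge0_integralD//; try by move=> p _; rewrite -EFinM lee_fin mulr_ge0 ?sqr_ge0.
  apply: ge0_le_integral => //.
  - by move=> p _; rewrite -EFinM lee_fin mulr_ge0// nnF.
  - exact: measurable_funeM.
  - exact: emeasurable_funD.
  move=> p _; rewrite -!EFinM -EFinD lee_fin !exprMn.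
  move: (W p ^+ 2) (sqr_ge0 (W p)) (normc (f _)) (normc (g _)) => q q0 a b.
  rewrite -subr_ge0 (_ : _ - _ = t^-1 * (t * a - b) ^+ 2 * q).
    by apply: mulr_ge0 => //; apply: mulr_ge0 => //; exact: sqr_ge0.
  by field; exact: lt0r_neq0.
clearbody n X Y; have [n00|npos] := eqVneq n 0; first by rewrite n00 expr0n /= !mulr_ge0.
have np : 0 < n by rewrite lt_neqAle eq_sym npos.
have [X00|Xn] := eqVneq X 0.
  have Y1 : 0 < Y + 1 by rewrite ltr_wpDl.
  (* With X = 0 this large t would give n <= n Y / (2 (Y + 1)) < n. *)
  have := H (2 * (Y + 1) / n) ltac:(by rewrite divr_gt0// mulr_gt0).
  rewrite X00 mulr0 add0r invf_div mulrAC ler_pdivlMr ?mulr_gt0//.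
  by rewrite ler_pM2l//; lra.
have Xp : 0 < X by rewrite lt_neqAle eq_sym Xn.
have := H (n / (2 * X)) ltac:(by rewrite divr_gt0// mulr_gt0).
rewrite invf_div (_ : n / (2 * X) * X = n / 2); last by field.
move=> H1; have {}H1 : n * n <= n * (n / 2 + 2 * X / n * Y) by rewrite ler_wpM2l.
have E : n * (n / 2 + 2 * X / n * Y) = n * n / 2 + 2 * X * Y by field.
by rewrite E in H1; rewrite expr2; lra.
Qed.

Lemma A2inner_self f : A2 omega f -> A2inner omega f f = (A2norm omega f ^+ 2)%:C.
Proof.
move=> fA; have E := A2_sqnormE fA; rewrite /A2inner.
have -> : (fun p => complex.Im (f (cplx p) * conjc (f (cplx p)) * (omega (cplx p) ^+ 2)%:C)) = cst 0.
  by apply/funext => p /=; case: (f _) => ? ? /=; ring.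
have -> : (fun p => complex.Re (f (cplx p) * conjc (f (cplx p)) * (omega (cplx p) ^+ 2)%:C)) =
    (fun p => (normc (f (cplx p)) * W p) ^+ 2).
  by apply/funext => p /=; rewrite exprMn sqr_normc /W; case: (f _) => ? ? /=; ring.
by congr (_ +i* _); [rewrite /Rintegral -/(sqnorm f) E|rewrite /Rintegral integral0].
Qed.

Lemma A2inner_conj f g : A2 omega f -> A2 omega g ->
  A2inner omega g f = conjc (A2inner omega f g).
Proof.
move=> fA gA; have [_ i2] := intF fA gA; rewrite /A2inner /=; congr (_ +i* _).
  by apply: eq_Rintegral => p _; case: (f _) (g _) => [? ?] [? ?] /=; ring.
rewrite -mulN1r -RintegralZl//; apply: eq_Rintegral => p _.
by case: (f _) (g _) => [? ?] [? ?] /=; ring.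
Qed.

Lemma A2innerBr f g h c : A2 omega f -> A2 omega g -> A2 omega h ->
  A2inner omega f (fun z => g z - c * h z) =
  A2inner omega f g - conjc c * A2inner omega f h.
Proof.
move=> fA gA hA; have [i1 i2] := intF fA gA; have [j1 j2] := intF fA hA.
case: c => c1 c2; rewrite /A2inner.
have Z (k : R) (u : plane -> R) : dA.-integrable D (EFin \o u) -> dA.-integrable D (EFin \o (fun p => k * u p)).
  by move=> iu; apply: (integrableZl mD k iu).
have B (u v : plane -> R) : dA.-integrable D (EFin \o u) -> dA.-integrable D (EFin \o v) ->
    dA.-integrable D (EFin \o (fun p => u p - v p)).
  by move=> iu iv; apply: (integrableB mD iu iv).
have Ad (u v : plane -> R) : dA.-integrable D (EFin \o u) -> dA.-integrable D (EFin \o v) ->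
    dA.-integrable D (EFin \o (fun p => u p + v p)).
  by move=> iu iv; apply: (integrableD mD iu iv).
have [k1 k2] := (Z c1 _ j1, Z c2 _ j2); have [l1 l2] := (Z c1 _ j2, Z c2 _ j1).
apply/eqP; rewrite eq_complex; apply/andP; split; apply/eqP.
- transitivity (Rintegral dA D (fun p => complex.Re (F f g p) -
     (c1 * complex.Re (F f h p) + c2 * complex.Im (F f h p)))).
    by apply: eq_Rintegral => p _; rewrite /F; case: (f _) (g _) (h _) => [? ?] [? ?] [? ?] /=; ring.
  rewrite RintegralB//; last exact: Ad.
  by rewrite RintegralD// !RintegralZl//= mulNr opprK.
- transitivity (Rintegral dA D (fun p => complex.Im (F f g p) -
     (c1 * complex.Im (F f h p) - c2 * complex.Re (F f h p)))).
    by apply: eq_Rintegral => p _; rewrite /F; case: (f _) (g _) (h _) => [? ?] [? ?] [? ?] /=; ring.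
  rewrite RintegralB//; last exact: B.
  by rewrite RintegralB// !RintegralZl//= mulNr.
Qed.

Lemma A2B g h c : A2 omega g -> A2 omega h -> A2 omega (fun z => g z - c * h z).
Proof.
move=> gA hA; have [[hg _] [hh _]] := (gA, hA).
pose B := 2 * A2norm omega g ^+ 2 + 2 * normc c ^+ 2 * A2norm omega h ^+ 2.
have hol : holomorphic_disk (fun z => g z - c * h z).
  move=> z dz; apply: cderivableB; first exact: hg.
  by apply: cderivableM; [exact: cderivable_cst|exact: hh].
apply: (@A2_of_le _ B) => //.
have m1 := measurable_sqnorm hg; have m2 := measurable_sqnorm hh.
have c0 : 0 <= 2 * normc c ^+ 2 by rewrite mulr_ge0 ?sqr_ge0.
have mm1 := measurable_funeM 2%:E m1; have mm2 := measurable_funeM (2 * normc c ^+ 2)%:E m2.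
rewrite /B (EFinD (2 * _)) (EFinM 2 (_ ^+ 2)) (EFinM (2 * _)) -!A2_sqnormE// /sqnorm.
rewrite -!ge0_integralZl_EFin//; try by move=> p _; rewrite lee_fin sqr_ge0.
rewrite -ge0_integralD//; try by move=> p _; rewrite -EFinM lee_fin mulr_ge0 ?sqr_ge0.
apply: ge0_le_integral => //.
- by move=> p _; rewrite lee_fin sqr_ge0.
- exact: (measurable_sqnorm hol).
- exact: emeasurable_funD.
move=> p _; rewrite -!EFinM -EFinD lee_fin !exprMn.
have := le_normcD (g (cplx p)) (- (c * h (cplx p))); rewrite normcN normcM.
have := normc_ge0 (g (cplx p) - c * h (cplx p)).
move: (W p ^+ 2) (sqr_ge0 (W p)) => q q0.
move: (normc (g _)) (normc (h _)) (normc c) (normc (_ - _)) => a b k d d0 dab.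
have H : d ^+ 2 <= (a + k * b) ^+ 2 by rewrite ler_pXn2r ?nnegrE// (le_trans d0).
rewrite -subr_ge0 (_ : _ - _ = (((a + k * b) ^+ 2 - d ^+ 2) + (a - k * b) ^+ 2) * q); last by ring.
by rewrite mulr_ge0// addr_ge0 ?sqr_ge0 ?subr_ge0.
Qed.

Context (K : R[i] -> R[i] -> R[i]) (repK : reproducing_kernel omega K).
Local Notation k_ := (kernel_fun K).

Lemma kernel_A2 z : disk z -> A2 omega (k_ z).
Proof. by move=> /repK[]. Qed.

Lemma kernel_reproduces f z : disk z -> A2 omega f -> f z = A2inner omega f (k_ z).
Proof. by move=> /repK[_]; exact. Qed.

Lemma kernel_diag z : disk z -> K z z = (A2norm omega (k_ z) ^+ 2)%:C.
Proof.
move=> dz; have := kernel_reproduces dz (kernel_A2 dz).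
rewrite A2inner_self; last exact: kernel_A2.
by move=> /(congr1 conjc); rewrite /kernel_fun conjcK conjc_real.
Qed.

Lemma kernel_norm z : disk z -> A2norm omega (k_ z) ^+ 2 = normc (K z z).
Proof. by move=> dz; rewrite kernel_diag// normc_real ger0_norm ?sqr_ge0. Qed.

Lemma kernel_sym z w : disk z -> disk w -> K z w = conjc (K w z).
Proof.
move=> dz dw.
have := kernel_reproduces dw (kernel_A2 dz); have := kernel_reproduces dz (kernel_A2 dw).
rewrite (A2inner_conj (kernel_A2 dz) (kernel_A2 dw)) /kernel_fun => -> /(congr1 conjc).
by rewrite conjcK => ->.
Qed.

Lemma kernel_sqr_le z w : disk z -> disk w ->
  normc (K z w) ^+ 2 <= 4 * normc (K z z) * normc (K w w).
Proof.
move=> dz dw; have := A2inner_sqr_le (kernel_A2 dz) (kernel_A2 dw).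
by rewrite -kernel_reproduces ?kernel_norm//; [rewrite normc_conj|exact: kernel_A2].
Qed.

(* The projection of [k_ b] to the orthogonal complement of [k_ a] has squared
   norm [K b b - |K a b|^2 / K a a] and represents [f |-> f b] on that complement. *)
Lemma vanishing_eval_le f a b : disk a -> disk b -> A2 omega f -> f a = 0 ->
  0 < normc (K a a) ->
  normc (f b) ^+ 2 <= 4 * A2norm omega f ^+ 2 *
    (normc (K b b) - normc (K a b) ^+ 2 / normc (K a a)).
Proof.
move=> da db fA fa0 Ka; pose c := k_ b a / k_ a a.
pose h z := k_ b z - c * k_ a z.
have hA : A2 omega h by apply: A2B; exact: kernel_A2.
have kaa : k_ a a != 0.
  by apply: contraTneq Ka; rewrite /kernel_fun -(normc_conj (K a a)) => ->; rewrite normc0 ltxx.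
have ha : h a = 0 by rewrite /h /c divfK ?subrr.
have inn g : A2 omega g -> g a = 0 -> A2inner omega g h = g b.
  move=> gA ga; rewrite A2innerBr//; try exact: kernel_A2.
  by rewrite -!kernel_reproduces// ga mulr0 subr0.
rewrite -(inn _ fA fa0).
apply: le_trans (A2inner_sqr_le fA hA) _.
apply: ler_wpM2l; first by apply: mulr_ge0 => //; exact: sqr_ge0.
have -> : A2norm omega h ^+ 2 = complex.Re (h b) by rewrite -(inn h hA ha) A2inner_self.
rewrite /h /c /kernel_fun (kernel_sym da db).
have Kb := kernel_diag db; have Kaa := kernel_diag da.
rewrite Kb Kaa !conjcK !conjc_real normc_conj !normc_real !ger0_norm ?sqr_ge0// sqr_normc.
rewrite -fmorphV; case: (K b a) => x y /=.
by rewrite le_eqVlt; apply/orP; left; apply/eqP; ring.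
Qed.

End A2.

(** * Short paths in polar coordinates *)

Section PolarGeometry.
Context {R : realType}.
Implicit Types (a b z w : R[i]) (r th dr dth : R -> R) (s t x y L : R) (tau : R[i] -> R).

Lemma polarM x y s t : polar x s * polar y t = polar (x * y) (s + t).
Proof.
rewrite /polar cosD sinD; apply/eqP; rewrite eq_complex /=.
by apply/andP; split; apply/eqP; ring.
Qed.

Lemma sin_atan x : sin (atan x) = x * cos (atan x).
Proof.
have c0 : cos (atan x) != 0.
  by apply/lt0r_neq0/cos_gt0_pihalf; rewrite atan_gtNpi2 atan_ltpi2.
by rewrite -{2}[x]atanK /tan divfK.
Qed.

Lemma atan_le x : 0 <= x -> atan x <= x.
Proof.
rewrite le_eqVlt => /predU1P[<-|x0]; first by rewrite atan0.
have cat y : {for y, continuous (@atan R)} by exact: continuous_atan.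
have [c|c] := @MVT R atan (fun y => (1 + y ^+ 2)^-1) 0 x x0 (fun y _ => is_derive1_atan y).
  by apply: continuous_subspaceT => y; exact: cat.
rewrite in_itv/= => /andP[c0 _]; rewrite atan0 !subr0 => ->.
rewrite ler_piMl ?(ltW x0)// invf_le1 ?ltr_pwDl ?sqr_ge0//.
by rewrite lerDl sqr_ge0.
Qed.

Lemma norm_atan_le x : `|atan x| <= `|x|.
Proof.
have [x0|x0] := lerP 0 x.
  have a0 : 0 <= atan x by have := le_atan x0; rewrite atan0.
  by rewrite !ger0_norm// atan_le.
have nx : 0 <= - x by rewrite oppr_ge0 ltW.
have a0 : 0 <= atan (- x) by have := le_atan nx; rewrite atan0.
by rewrite -(normrN (atan x)) -atanN -(normrN x) (ger0_norm a0) (ger0_norm nx) atan_le.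
Qed.

Lemma polar_near1 w : normc (w - 1) < 2^-1 ->
  exists2 t, w = polar (normc w) t & `|t| <= 2 * normc (w - 1).
Proof.
move=> w1; have := le_lt_trans (norm_Re_le _) w1; have := norm_Im_le (w - 1).
case: w w1 => x y w1; set m := normc (_ - 1) in w1 *; set N := normc _ => /=.
rewrite oppr0 addr0 ltr_norml => ym /andP[x1 x2].
have x0 : 2^-1 <= x by lra.
have xp : 0 < x by apply: lt_le_trans x0.
have N2 : N ^+ 2 = x ^+ 2 + y ^+ 2 by rewrite /N /= sqr_sqrtr// addr_ge0 ?sqr_ge0.
have Np : 0 < N by rewrite /N /= sqrtr_gt0 ltr_pwDl ?exprn_gt0 ?sqr_ge0.
clearbody N; exists (atan (y / x)).
  have c : cos (atan (y / x)) = x / N.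
    rewrite cos_atan (_ : 1 + (y / x) ^+ 2 = (N / x) ^+ 2).
      by rewrite sqrtr_sqr ger0_norm ?invf_div// divr_ge0 ?ltW.
    by rewrite !expr_div_n N2; field; exact: lt0r_neq0.
  rewrite /polar sin_atan c; congr (_ +i* _); field; rewrite ?lt0r_neq0//.
rewrite (le_trans (norm_atan_le _))// normrM normfV (gtr0_norm xp) ler_pdivrMr//.
have m0 : 0 <= m by exact: normc_ge0.
by apply: (le_trans ym); nra.
Qed.

(** Here [ph] is an argument of w = a / b. Near 1 it is controlled by [polar_near1]; when |w - 1| >=
    1/2, the crude bound |ph| <= pi <= 4 <= 8 |w - 1| suffices. *)
Lemma polar_pair a b : b != 0 -> exists th ph : R,
  [/\ b = polar (normc b) th, a = polar (normc a) (th + ph) &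
      normc b * `|ph| <= 8 * normc (a - b)].
Proof.
move=> b0; pose w := a / b.
have aE : a = b * w by rewrite mulrC divfK.
have nb0 : 0 <= normc b by exact: normc_ge0.
have dist : normc (a - b) = normc b * normc (w - 1).
  by rewrite -normcM mulrBr mulr1 -aE.
have [th [_ _ bE]] := polar_exists b; exists th.
suff [ph wE phle] : exists2 ph, w = polar (normc w) ph & `|ph| <= 8 * normc (w - 1).
  exists ph; split => //.
    by rewrite {1}aE {1}bE {1}wE polarM -normcM -aE.
  by rewrite dist mulrCA ler_wpM2l.
have [w1|w1] := ltrP (normc (w - 1)) 2^-1.
  have [ph wE H] := polar_near1 w1; exists ph => //.
  by apply: (le_trans H); have := normc_ge0 (w - 1); lra.
have [ph [ph1 ph2 wE]] := polar_exists w; exists ph => //.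
have p4 : pi <= 4 :> R by have := @pihalf_lt2 R; lra.
have : `|ph| <= pi by rewrite ler_norml ph1.
by move/le_trans; apply; lra.
Qed.

Lemma is_C1_reverse r dr : is_C1 r dr ->
  is_C1 (fun s => r (1 - s)) (fun s => - dr (1 - s)).
Proof.
move=> [rd cd]; have d1 s : is_derive (s : R^o) (1 : R^o) (fun s => 1 - s : R^o) (-1).
  have := is_deriveB (is_derive_cst (1 : R^o) (s : R^o) (1 : R^o)) (is_derive_id (s : R^o) (1 : R^o)).
  by rewrite sub0r.
have c1 : continuous (fun s : R^o => 1 - s : R^o).
  by move=> s; apply/differentiable_continuous/derivable1_diffP; have [] := d1 s.
split.
  move=> s; have := @is_derive1_comp R r (fun s => 1 - s) s _ _ (rd (1 - s)) (d1 s).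
  by rewrite mulrN1.
by move=> s; apply: cvgN; apply: (@continuous_comp _ _ _ (fun s : R^o => 1 - s : R^o) dr); [exact: c1|exact: cd].
Qed.

(** The final argument orders the two points by modulus, so the bound is wanted in both directions;
    the explicit path is simply run backwards. *)
Lemma d_tau_le_polar_both tau r dr th dth L :
  (forall z, disk z -> 0 < tau z) -> is_C1 r dr -> is_C1 th dth -> 0 <= L ->
  (forall s, 0 <= s <= 1 -> 0 <= r s < 1 /\
    `|dr s| + r s * `|dth s| <= L * tau (polar (r s) (th s))) ->
  d_tau tau (polar (r 0) (th 0)) (polar (r 1) (th 1)) <= L /\
  d_tau tau (polar (r 1) (th 1)) (polar (r 0) (th 0)) <= L.
Proof.
move=> tau0 Cr Ct L0 H; split; first exact: (d_tau_le_polar tau0 Cr Ct).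
have := d_tau_le_polar tau0 (is_C1_reverse Cr) (is_C1_reverse Ct) L0.
rewrite subr0 subrr; apply => s s01; rewrite !normrN; apply: H; lra.
Qed.

Lemma is_C1_sqr r dr : is_C1 r dr -> is_C1 (fun s => r s ^+ 2) (fun s => 2 * r s * dr s).
Proof.
move=> C; have [h1 h2] := is_C1M C C.
have -> : (fun s => r s ^+ 2) = (fun s => r s * r s) by apply/funext => s; rewrite expr2.
have -> // : (fun s => 2 * r s * dr s) = (fun s => r s * dr s + r s * dr s).
by apply/funext => s; ring.
Qed.

End PolarGeometry.

(** * Lengths of explicit paths, and drops of tau excluded by the distance estimate *)

Section PolarPaths.
Context {R : realType} (tau : R[i] -> R) (tau0 : forall z, disk z -> 0 < tau z).
Implicit Types (a b z w : R[i]) (L q c rho : R).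
Local Notation d := (d_tau tau).

Lemma normc_dist_le a b : normc b - normc a <= normc (a - b).
Proof.
have := le_normcD (b - a) a; rewrite subrK => H.
by rewrite lerBlDr -(opprB b a) normcN.
Qed.

(* Moving the square root of the modulus at constant speed makes the path
   short when tau is only bounded below by the square root of the modulus. *)
Lemma d_tau_le_sqrt_profile a b B : disk b -> b != 0 -> normc a <= normc b -> 0 <= B ->
  (forall z, normc z <= normc b ->
     tau b * Num.sqrt (normc z / normc b) <= B * tau z) ->
  let L := 10 * B * (normc (a - b) / tau b) in d a b <= L /\ d b a <= L.
Proof.
move=> db b0 ab B0 H L; have [th [ph [bE aE phle]]] := polar_pair a b0.
have tb := tau0 db; have ra := normc_ge0 a.
have rb : 0 < normc b by rewrite lt_neqAle normc_ge0 andbT eq_sym; apply: contra b0 => /eqP/eq0_normc->.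
have dist := normc_dist_le a b; have m0 := normc_ge0 (a - b).
have L0 : 0 <= L by rewrite /L !mulr_ge0// ?invr_ge0 ltW.
set u := Num.sqrt (normc a); set v := Num.sqrt (normc b).
have u0 : 0 <= u by exact: sqrtr_ge0.
have v0 : 0 < v by rewrite sqrtr_gt0.
have uv : u <= v by exact: ler_wsqrtr.
have u2 : u ^+ 2 = normc a by rewrite sqr_sqrtr.
have v2 : v ^+ 2 = normc b by rewrite sqr_sqrtr ?ltW.
(* With modulus x^2 and x affine in time, the radial speed 2 x (v - u) and the angular speed x^2
   |ph| both carry the factor x that the lower bound tau b (x / v) / B for tau also contains. *)
have := d_tau_le_polar_both tau0 (is_C1_sqr (is_C1_affine u (v - u)))
  (is_C1_affine (th + ph) (- ph)) L0.
rewrite !mulr0 !mulr1 !addr0 addrK [u + _]addrC subrK u2 v2 -bE -aE; apply.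
move=> s /andP[s0 s1] /=.
set x := u + (v - u) * s.
have x0 : 0 <= x by rewrite /x; nra.
have xv : x <= v by rewrite /x; nra.
split.
  rewrite sqr_ge0 /=; apply: le_lt_trans db; rewrite -v2.
  by rewrite ler_pXn2r ?nnegrE// ltW.
set z := polar _ _; have zx : normc z = x ^+ 2 by rewrite normc_polar ?sqr_ge0.
have := H z; rewrite zx -v2 -expr_div_n sqrtr_sqr ger0_norm ?divr_ge0 ?(ltW v0)//.
rewrite ler_pXn2r ?nnegrE ?(ltW v0)// xv => /(_ isT) Hz.
rewrite normrN !normrM (ger0_norm x0) (@ger0_norm _ (v - u)) ?subr_ge0// (@ger0_norm _ 2)//.
have k0 : 0 <= 10 * (normc (a - b) / tau b) by apply: mulr_ge0 => //; apply: divr_ge0 => //; exact: ltW.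
have := ler_wpM2l k0 Hz.
rewrite (_ : _ * (B * tau z) = L * tau z); last by rewrite /L; ring.
apply: le_trans.
rewrite (_ : 10 * _ * _ = 10 * normc (a - b) / v * x); last by field; rewrite !lt0r_neq0.
have ph0 := normr_ge0 ph.
(* The constant is 10 = 2 + 8: twice v (v - u) <= v^2 - u^2 <= |a - b| for the radial part, and the
   8 of [polar_pair] for the angular part. *)
have E1 : v * (v - u) <= normc (a - b).
  by apply: le_trans dist; rewrite -u2 -v2; nra.
have E2 : v * (x * `|ph|) <= 8 * normc (a - b).
  by apply: le_trans phle; rewrite -v2 expr2 -mulrA ler_wpM2l ?(ltW v0)// ler_wpM2r.
rewrite (_ : _ + _ = (2 * (v - u) + x * `|ph|) * x); last by ring.
rewrite ler_wpM2r// ler_pdivlMr// mulrC mulrDr; lra.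
Qed.

(** Modulus and angle both move affinely; 9 = 1 + 8 adds the radial displacement and the angular one
    from [polar_pair]. *)
Lemma d_tau_le_lower_bound a b q : disk b -> b != 0 -> normc a <= normc b -> 0 < q ->
  (forall z, normc a <= normc z <= normc b -> q <= tau z) ->
  let L := 9 * normc (a - b) / q in d a b <= L /\ d b a <= L.
Proof.
move=> db b0 ab q0 H L; have [th [ph [bE aE phle]]] := polar_pair a b0.
have ra := normc_ge0 a.
have dist := normc_dist_le a b; have m0 := normc_ge0 (a - b).
have L0 : 0 <= L by rewrite /L !mulr_ge0// ?invr_ge0 ltW.
have := d_tau_le_polar_both tau0 (is_C1_affine (normc a) (normc b - normc a))
  (is_C1_affine (th + ph) (- ph)) L0.
rewrite !mulr0 !mulr1 !addr0 addrK [normc a + _]addrC subrK -bE -aE; apply.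
move=> s /andP[s0 s1] /=.
set x := normc a + (normc b - normc a) * s.
have x1 : normc a <= x by rewrite /x; nra.
have x2 : x <= normc b by rewrite /x; nra.
have x0 := le_trans ra x1.
split; first by rewrite x0 (le_lt_trans x2 db).
set z := polar _ _; have zx : normc z = x by rewrite normc_polar.
have := H z; rewrite zx x1 x2 => /(_ isT) Hz.
have := ler_wpM2l L0 Hz; apply: le_trans.
rewrite /L divfK ?lt0r_neq0// normrN ger0_norm ?subr_ge0//.
have : x * `|ph| <= normc b * `|ph| by rewrite ler_wpM2r.
lra.
Qed.

Context (tau_rad : radial tau)
  (tau_diff : forall p, disk2 p -> differentiable (tau \o @cplx R) p).

Lemma continuous_radial_profile rho : 0 <= rho < 1 ->
  {for rho, continuous (fun s : R => tau s%:C)}.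
Proof.
move=> /andP[r0 r1].
have D : disk2 (rho, 0 : R).
  by rewrite /disk2 /= /disk /= /cplx /= expr0n addr0 sqrtr_sqr ger0_norm.
have c := differentiable_continuous (tau_diff D).
have cp : {for rho, continuous (fun s : R => (s, 0 : R))}.
  exact: (@cvg_pair _ _ _ (nbhs rho) (nbhs rho) (nbhs (0 : R)) _ _ _ id (cst 0)
    (@cvg_id _ _) (cvg_cst _)).
exact: (@continuous_comp _ _ _ (fun s : R => (s, 0 : R)) (tau \o @cplx R) rho cp c).
Qed.

Context (C1 : R) (C1_gt0 : 0 < C1) (hdist : forall z w, disk z -> disk w -> z <> w ->
  expR (- d z w) <= C1 * (Num.min (tau z) (tau w) / normc (z - w))).

(** The value q violates the distance estimate by a factor 2. With T = tau b, two points within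
    d_tau-distance 2 and at Euclidean distance at least c T / 2, one of them with tau <= q T, would
    give exp(-2) <= C1 q T / (c T / 2) = exp(-2) / 2. *)
Definition away_const c := c * expR (-2) / (4 * C1).

(* If tau dropped below the threshold at distance comparable to tau b from b,
   the rotated point at Euclidean distance comparable to tau b would still be
   within bounded d_tau-distance, against the distance estimate. *)
Lemma tau_lower_away b c z : disk b -> 0 < c <= 1 -> c * tau b <= normc b ->
  away_const c <= 1 ->
  normc z <= normc b -> normc b - normc z <= away_const c * tau b ->
  away_const c * tau b <= tau z.
Proof.
move=> db /andP[c0 c1] cb q1 zb bz; have tb := tau0 db.
have q0 : 0 < away_const c by rewrite /away_const !divr_gt0 ?mulr_gt0 ?expR_gt0.
move: q0 q1 bz; set q := away_const c => q0 q1 bz.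
rewrite leNgt; apply/negP => tz.
have rz := normc_ge0 z; have rb : 0 < normc b by apply: lt_le_trans cb; rewrite mulr_gt0.
pose g (s : R) := tau s%:C.
have normE (s : R) : 0 <= s -> normc s%:C = s by move=> s0; rewrite normc_real ger0_norm.
have gE w : disk w -> tau w = g (normc w).
  move=> dw; rewrite /g; apply: tau_rad => //; last by rewrite normE ?normc_ge0.
  by rewrite /disk /mkset normE ?normc_ge0.
have dz : disk z by exact: le_lt_trans zb db.
rewrite gE// in tz.
(* The supremum [rho] of [S] is the last modulus at which tau is still at or below the threshold. By
   continuity tau equals the threshold there, so it is at least the threshold on all of
   [rho, |b|]. *)
pose S := [set s : R | normc z <= s <= normc b /\ g s <= q * tau b].
have Sz : S (normc z) by split; [rewrite lexx zb|exact: ltW].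
have Sb : has_ubound S by exists (normc b) => s [/andP[]].
have Ss : has_sup S by split => //; exists (normc z).
pose rho := sup S.
have rz' : normc z <= rho by exact: ub_le_sup.
have rb' : rho <= normc b by apply: ge_sup; [exists (normc z)|move=> s [/andP[]]].
have above s : rho < s -> s <= normc b -> q * tau b < g s.
  move=> rs sb; rewrite ltNge; apply/negP => gs.
  have : s <= rho by apply: ub_le_sup => //; split => //; rewrite (le_trans rz' (ltW rs)).
  by rewrite leNgt rs.
have crho : {for rho, continuous g}.
  by apply: continuous_radial_profile; rewrite (le_trans rz rz') (le_lt_trans rb' db).
have grho1 : g rho <= q * tau b.
  rewrite leNgt; apply/negP => h.
  have [e /= e0 He] := (nbhs_ballP _ _).1 (cvgr_gt (g rho) crho _ h).
  have [s [sz gs] se] := sup_adherent e0 Ss.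
  have sr : s <= rho by exact: ub_le_sup.
  have : q * tau b < g s.
    by apply: He; rewrite /ball /= ger0_norm ?subr_ge0// ltrBlDr addrC -ltrBlDr.
  by rewrite ltNge gs.
have grho2 : q * tau b <= g rho.
  rewrite leNgt; apply/negP => h.
  have rltb : rho < normc b.
    rewrite lt_neqAle rb' andbT; apply/eqP => E.
    by move: h; rewrite E -gE// ltNge ler_piMl// ltW.
  have [e /= e0 He] := (nbhs_ballP _ _).1 (cvgr_lt (g rho) crho _ h).
  have [se1 se2] : Num.min (rho + e / 2) (normc b) <= rho + e / 2 /\
    rho < Num.min (rho + e / 2) (normc b).
    by rewrite ge_min lexx lt_min rltb ltrDl divr_gt0.
  move: se1 se2; set s := Num.min _ _ => se1 se2.
  have : g s < q * tau b.
    by apply: He; rewrite /ball /= ltr0_norm ?subr_lt0// opprB; lra.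
  by apply/negP; rewrite -leNgt ltW// above// /s ge_min lexx orbT.
have rho0 := le_trans rz rz'.
(* The angle [al] = atan x is small enough for the arc of radius |b| to have length at most c tau b,
   and large enough for its endpoint to have height at least c tau b / 2 above the real axis, on
   which the point of modulus [rho] lies. *)
pose x := c * tau b / normc b.
have x0 : 0 < x by rewrite /x !divr_gt0 ?mulr_gt0.
have x1 : x <= 1 by rewrite /x ler_pdivrMr// mul1r.
pose al := atan x.
have al0 : 0 <= al by have := le_atan (ltW x0); rewrite atan0.
have alx : al <= x by exact/atan_le/ltW.
(* Arc, then radial segment. On the arc tau is tau b; on the segment tau is at least q tau b and the
   length is at most q tau b. Each piece costs at most 1, hence normalized speed at most 2 on each
   half of the time interval. *)
have dist2 : d (polar (normc b) al) (polar rho 0) <= 2.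
  have := @d_tau_le_polar2 R tau _ _ _ _ _ _ _ _ 2 tau0 (is_C1_affine (normc b) 0)
    (is_C1_affine al (- 2 * al)) (is_C1_affine (2 * normc b - rho) (2 * (rho - normc b)))
    (is_C1_affine 0 0).
  rewrite !mulr0 !mulr1 !addr0 (_ : 2 * normc b - rho + 2 * (rho - normc b) = rho); last by ring.
  apply; first by [].
  - by field.
  - by field.
  - move=> s _ /=; rewrite mul0r addr0.
    have dP : disk (polar (normc b) (al + - 2 * al * s)) by rewrite /disk/mkset normc_polar ?ltW.
    rewrite (ltW rb); split; first exact: db.
    rewrite gE// normc_polar ?(ltW rb)// -gE// normr0 add0r mulNr normrN ger0_norm ?mulr_ge0//.
    have : normc b * al <= normc b * x by rewrite ler_wpM2l// ltW.
    rewrite /x [_ * (_ / _)]mulrC divfK ?lt0r_neq0// => H.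
    have : c * tau b <= tau b by rewrite ler_piMl// ltW.
    lra.
  - move=> s /andP[s1 s2] /=; rewrite mul0r addr0.
    set v := _ + _ * s.
    have v1 : rho <= v by rewrite /v; nra.
    have v2 : v <= normc b by rewrite /v; nra.
    have v0 := le_trans rho0 v1.
    have dP : disk (polar v 0) by rewrite /disk/mkset normc_polar// (le_lt_trans v2 db).
    rewrite v0 (le_lt_trans v2 db) normr0 mulr0 addr0; split=> //.
    have : q * tau b <= g v.
      by move: v1; rewrite le_eqVlt => /predU1P[<-//|v1]; exact/ltW/above.
    rewrite (gE (polar v 0))// normc_polar// normrM normr_nat distrC ger0_norm ?subr_ge0//; lra.
have dw : disk (polar (normc b) al) by rewrite /disk/mkset normc_polar// ltW.
have dr : disk (polar rho 0) by rewrite /disk/mkset normc_polar// (le_lt_trans rb' db).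
have tr : tau (polar rho 0) <= q * tau b by rewrite gE// normc_polar.
have cos0 : 2^-1 <= cos al.
  rewrite cos_atan lef_pV2 ?posrE ?sqrtr_gt0 ?ltr_pwDl ?sqr_ge0//.
  rewrite -[leRHS]ger0_norm// -sqrtr_sqr ler_wsqrtr//.
  have : x ^+ 2 <= 1 by apply: exprn_ile1 => //; exact: ltW.
  lra.
have im : c * tau b / 2 <= normc (polar (normc b) al - polar rho 0).
  apply: le_trans (norm_Im_le _); rewrite /polar /= sin0 mulr0 subr0.
  rewrite sin_atan mulrA /x [normc b * _]mulrC divfK ?lt0r_neq0// -/x -/al.
  by apply: le_trans (ler_norm _); rewrite ler_wpM2l// ltW// mulr_gt0.
have neq : polar (normc b) al <> polar rho 0.
  move=> E; move: im; rewrite E subrr normc0 leNgt divr_gt0 ?mulr_gt0//.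
have := hdist dw dr neq.
have : expR (-2) <= expR (- d (polar (normc b) al) (polar rho 0)) by rewrite ler_expR lerN2.
move=> /le_trans h /h; clear h.
have E0 := expR_gt0 (-2 : R); apply/negP; rewrite -ltNge.
have i0 : 0 < c * tau b / 2 by rewrite divr_gt0 ?mulr_gt0.
apply: (@le_lt_trans _ _ (C1 * (q * tau b / (c * tau b / 2)))).
  rewrite ler_wpM2l ?(ltW C1_gt0)//; apply: ler_pM.
  - by rewrite le_min !ltW ?tau0.
  - by rewrite invr_ge0 normc_ge0.
  - by rewrite ge_min tr orbT.
  - by rewrite lef_pV2// posrE (lt_le_trans i0 im).
rewrite (_ : C1 * _ = expR (-2) / 2); first lra.
by rewrite /q /away_const; field; rewrite !lt0r_neq0.
Qed.

End PolarPaths.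

(** * Kernel estimates and the constants *)

Section RealBounds.
Context {R : realType}.
Implicit Types (T r v rho : R).

(** In use [r], [v], [rho] are |z|, |z - b|, |b|. If r < rho / 2 then v >= rho / 2, and only the
    singularity r^(-3/2) at the origin remains. If rho / 2 <= r < rho, the first factor is at most 3
    and v <= 2 rho. If r >= rho, then v <= 2 r converts decay in r into decay in v. The last two
    cases are charged to the kernel centred at b. *)
Lemma slope_tail_le rho T r v : 0 < rho -> rho <= T -> 0 < r -> 0 < v ->
  rho <= v + r -> v <= rho + r ->
  (if r < rho then rho / r * Num.sqrt (rho / r) else Num.sqrt (rho / r)) *
    (Num.min 1 (T / v) / v) <=
  2 * Num.sqrt rho * tail_ker rho r + 6 * Num.sqrt rho * tail_ker T v.
Proof.
move=> rho0 rhoT r0 v0 h1 h2.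
have T0 : 0 < T by exact: lt_le_trans rhoT.
have sr : 0 < Num.sqrt r by rewrite sqrtr_gt0.
have sv : 0 < Num.sqrt v by rewrite sqrtr_gt0.
have srho : 0 < Num.sqrt rho by rewrite sqrtr_gt0.
have m0 : 0 <= Num.min 1 (T / v) by rewrite le_min ler01 divr_ge0// ltW.
have m1 : Num.min 1 (T / v) <= 1 by rewrite ge_min lexx.
have t1 : 0 <= 2 * Num.sqrt rho * tail_ker rho r.
  by rewrite mulr_ge0 ?tail_ker_ge0 ?mulr_ge0// ltW.
have t2 : 0 <= 6 * Num.sqrt rho * tail_ker T v.
  by rewrite mulr_ge0 ?tail_ker_ge0 ?mulr_ge0// ltW.
have sq : Num.sqrt (rho / r) = Num.sqrt rho / Num.sqrt r.
  by rewrite sqrtrM ?(ltW rho0)// sqrtrV// ltW.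
have sq0 : 0 <= Num.sqrt (rho / r) by exact: sqrtr_ge0.
have far k : 0 <= k -> Num.sqrt v <= k * Num.sqrt rho ->
    Num.min 1 (T / v) / v <= k * Num.sqrt rho * tail_ker T v.
  move=> k0 H; rewrite /tail_ker.
  rewrite [leRHS](_ : _ = Num.min 1 (T / v) / v * (k * Num.sqrt rho / Num.sqrt v)).
    by rewrite ler_peMr ?divr_ge0 ?(ltW v0)// ler_pdivlMr// mul1r.
  by field; rewrite !lt0r_neq0.
case: ltrP => rrho.
- have [rh|rh] := ltrP r (rho / 2).
  + rewrite -[leLHS]addr0; apply: lerD => //.
    have -> : tail_ker rho r = (r * Num.sqrt r)^-1.
      rewrite /tail_ker (_ : Num.min 1 _ = 1) ?mul1r//; apply/min_idPl.
      by rewrite ler_pdivlMr// mul1r ltW.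
    have v2 : rho / 2 <= v by lra.
    apply: (@le_trans _ _ (rho / r * Num.sqrt (rho / r) * (2 / rho))).
      apply: ler_wpM2l; first by rewrite mulr_ge0// divr_ge0// ltW.
      apply: (@le_trans _ _ (1 / v)); first by rewrite ler_wpM2r ?invr_ge0// ltW.
      by rewrite mul1r -[2 / rho]invf_div lef_pV2 ?posrE// divr_gt0.
    rewrite sq le_eqVlt; apply/orP; left; apply/eqP; field.
    by rewrite !lt0r_neq0.
  + rewrite -[leLHS]add0r; apply: lerD => //.
    have q2 : rho / r <= 2 by rewrite ler_pdivrMr// -ler_pdivrMl// mulrC.
    have q1 : Num.sqrt (rho / r) <= 3 / 2.
      rewrite -[3 / 2]ger0_norm// -sqrtr_sqr ler_wsqrtr//.
      by apply: (le_trans q2); rewrite expr2; lra.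
    have qq : rho / r * Num.sqrt (rho / r) <= 3.
      have := @ler_pM _ (rho / r) 2 (Num.sqrt (rho / r)) (3 / 2).
      rewrite divr_ge0 ?(ltW rho0) ?(ltW r0)// sq0 => /(_ isT isT q2 q1); lra.
    have vv : Num.sqrt v <= 2 * Num.sqrt rho.
      rewrite -[X in X * _]ger0_norm// -sqrtr_sqr -sqrtrM ?sqr_ge0// ler_wsqrtr//.
      by rewrite expr2; lra.
    have H := far 2 ltac:(by []) vv.
    apply: (@le_trans _ _ (3 * (Num.min 1 (T / v) / v))).
      by rewrite ler_wpM2r// divr_ge0// ltW.
    apply: (le_trans (ler_wpM2l _ H)) => //.
    by rewrite !mulrA; rewrite (_ : 3 * 2 = 6 :> R)//; ring.
- rewrite -[leLHS]add0r; apply: lerD => //.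
  have vr : v <= 2 * r by lra.
  have vv : Num.sqrt v <= 2 * Num.sqrt r.
    rewrite -[X in X * _]ger0_norm// -sqrtr_sqr -sqrtrM ?sqr_ge0// ler_wsqrtr//.
    by rewrite expr2; lra.
  rewrite sq /tail_ker.
  rewrite (_ : _ / _ * (_ / v) = Num.sqrt rho * (Num.min 1 (T / v) / (v * Num.sqrt v)) * (Num.sqrt v / Num.sqrt r)); last first.
    by field; rewrite !lt0r_neq0.
  have q6 : Num.sqrt v / Num.sqrt r <= 6 by rewrite ler_pdivrMr//; lra.
  rewrite (_ : 6 * _ * _ = Num.sqrt rho * (Num.min 1 (T / v) / (v * Num.sqrt v)) * 6); last by ring.
  by rewrite ler_wpM2l// mulr_ge0 ?(ltW srho)// divr_ge0// mulr_ge0// ltW.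
Qed.

End RealBounds.

Section Estimates.
Context {R : realType} (C : R -> R) (C' C'' sigma : R).
Context (hC : forall M, 0 < M -> 1 < C M) (hC' : 0 < C') (hC'' : 0 < C'') (hsigma : 0 < sigma).
Context (omega eta tau : R[i] -> R) (K : R[i] -> R[i] -> R[i]) (rad : R).
Context (cW : classW omega eta tau) (repK : reproducing_kernel omega K) (rad0 : 0 < rad).
Context (hdist : distance_estimate tau C)
  (hup : kernel_upper_estimate omega tau K C' sigma)
  (hlow : kernel_lower_estimate omega tau K C'' rad).
Implicit Types (a b z w : R[i]) (p : R * R) (t T r v x rho : R).
Local Notation plane := (measurableTypeR R * measurableTypeR R)%type.
Local Notation D := (@disk2 R : set plane).
Local Notation dA := (@dA R).
Local Notation d := (d_tau tau).
Local Notation k_ := (kernel_fun K).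
Local Notation N z := (normc (K z z)).

(** The distance estimate with M = 4 / sigma, raised to the power sigma / 4: a quarter of the
    exponential decay of the kernel buys one factor min(tau z, tau w) / |z - w|, so the upper
    estimate affords four such factors. *)
Definition decay_const : R := C (4 / sigma) `^ (sigma / 4).
Local Notation A := decay_const.

Lemma decay_const_ge1 : 1 <= A.
Proof.
have H : 1 <= C (4 / sigma) by apply/ltW/hC; rewrite divr_gt0.
have -> : 1 = 1 `^ (sigma / 4) :> R by rewrite powR1.
apply: ge0_ler_powR => //; rewrite ?nnegrE//; last exact: le_trans H.
by rewrite divr_ge0// ltW.
Qed.

Let A0 : 0 < A. Proof. exact: lt_le_trans ltr01 decay_const_ge1. Qed.

Lemma tau_gt0 z : disk z -> 0 < tau z. Proof. exact: classW_pos cW _. Qed.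

Let we := classW_weight cW.

Lemma omega_gt0 z : disk z -> 0 < omega z.
Proof. by move=> dz; rewrite (weight_exp we dz) expR_gt0. Qed.

Lemma omega_radial z w : disk z -> disk w -> normc z = normc w -> omega z = omega w.
Proof. by move=> dz dw zw; rewrite !(weight_exp we)// (weight_radial we dz dw zw). Qed.

Lemma disk0 : disk (0 : R[i]). Proof. by rewrite /disk/mkset normc0. Qed.

Lemma omega_le0 z : disk z -> omega z <= omega 0.
Proof.
move=> dz; have [z0|z0] := eqVneq (normc z) 0.
  by rewrite (omega_radial dz disk0)// z0 normc0.
rewrite !(weight_exp we)//; last exact: disk0.
rewrite ler_expR lerN2 ltW// (weight_incr we disk0 dz)// normc0 lt_neqAle eq_sym z0.
exact: normc_ge0.
Qed.

Lemma omega_integrable : dA.-integrable D (EFin \o (omega \o @cplx R)).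
Proof. exact: weight_integrable we. Qed.

Lemma momega : measurable_fun D (omega \o @cplx R : plane -> R).
Proof. by have /measurable_EFinP := measurable_int _ omega_integrable. Qed.

Lemma holomorphicX n : holomorphic_disk (fun z : R[i] => z ^+ n).
Proof. by move=> z _; apply: cderivableX; exact: cderivable_id. Qed.

Lemma normcX z n : normc (z ^+ n) = normc z ^+ n.
Proof. by elim: n => [|n IH]; rewrite ?expr0 ?normc1// !exprS normcM IH. Qed.

(** The norm involves omega^2 whereas integrability is assumed for omega; since omega is largest at
    the centre, omega^2 <= omega(0) omega. *)
Lemma A2_X n : A2 omega (fun z => z ^+ n).
Proof.
split; first exact: holomorphicX.
have /integrableP[mo] := integrableZl (measurable_disk2) (omega 0) omega_integrable.
apply: le_lt_trans; apply: ge0_le_integral => //.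
- exact: measurable_disk2.
- by move=> p _; rewrite lee_fin sqr_ge0.
- exact: (measurable_sqnorm momega (@holomorphicX n)).
- exact: measurableT_comp.
move=> p Dp /=; rewrite lee_fin normrM.
have o0 := omega_gt0 Dp; have o1 := omega_le0 Dp.
have z1 : normc (cplx p ^+ n) <= 1.
  by rewrite normcX exprn_ile1 ?normc_ge0// ltW.
rewrite !ger0_norm ?(ltW o0)// ?(ltW (omega_gt0 disk0))// expr2.
apply: ler_pM; rewrite ?mulr_ge0 ?normc_ge0 ?(ltW o0)//.
  by apply: le_trans o1; rewrite ler_piMl// ltW.
by rewrite ler_piMl// ltW.
Qed.

(** * Off-diagonal decay of the kernel and its size on the diagonal *)

Lemma d_ge0 z w : 0 <= d z w. Proof. exact/d_tau_ge0/tau_gt0. Qed.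

Definition decay z w : R := expR (- (sigma / 4 * d z w)).

Lemma decay_ge0 z w : 0 <= decay z w. Proof. exact: expR_ge0. Qed.

Lemma decay_le1 z w : decay z w <= 1.
Proof. by rewrite -expR0 ler_expR oppr_le0 mulr_ge0 ?d_ge0// divr_ge0// ltW. Qed.

Lemma decay_X4 z w : decay z w ^+ 4 = expR (- (sigma * d z w)).
Proof. by rewrite -expRM_natl; congr expR; field. Qed.

Lemma decay_le z w : disk z -> disk w -> z <> w ->
  decay z w <= A * Num.min (tau z) (tau w) / normc (z - w).
Proof.
move=> dz dw zw.
have s4 : 0 < 4 / sigma by rewrite divr_gt0.
have s4' : 0 <= sigma / 4 by rewrite divr_ge0// ltW.
have m0 : 0 <= Num.min (tau z) (tau w) / normc (z - w).
  by rewrite divr_ge0 ?normc_ge0// le_min !ltW// tau_gt0.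
have C0 : 0 <= C (4 / sigma) by rewrite (le_trans ler01)// ltW// hC.
have -> : decay z w = expR (- d z w) `^ (sigma / 4).
  by rewrite /powR gt_eqF ?expR_gt0// expRK mulrN.
have := hdist s4 dz dw zw => /(ge0_ler_powR s4') H.
apply: (le_trans (H _ _)); rewrite ?nnegrE ?expR_ge0 ?mulr_ge0 ?powR_ge0//.
rewrite powRM ?powR_ge0// -powRrM (_ : 4 / sigma * (sigma / 4) = 1).
  by rewrite powRr1// -mulrA.
by field; rewrite lt0r_neq0.
Qed.

Lemma decay_le_left z w : disk z -> disk w -> z <> w ->
  decay z w <= A * Num.min 1 (tau z / normc (z - w)).
Proof.
move=> dz dw zw; have v0 := normc_ge0 (z - w).
rewrite /Num.min; case: ifP => _.
  by rewrite mulr1 (le_trans (decay_le1 _ _))// decay_const_ge1.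
apply: (le_trans (decay_le dz dw zw)); rewrite -mulrA ler_wpM2l ?(ltW A0)//.
by rewrite ler_wpM2r ?invr_ge0// ge_min lexx.
Qed.

(** One decay factor absorbs the uncontrolled 1 / tau w of the upper kernel estimate. *)
Lemma decay_le_right z w : disk z -> disk w -> z <> w ->
  decay z w / tau w <= A / normc (z - w).
Proof.
move=> dz dw zw; have tw := tau_gt0 dw; have v0 := normc_ge0 (z - w).
rewrite ler_pdivrMr// (le_trans (decay_le dz dw zw))//.
rewrite mulrAC -!mulrA ler_wpM2l ?(ltW A0)// ler_wpM2l ?invr_ge0//.
by rewrite ge_min lexx orbT.
Qed.

Lemma kernel_decay b z : disk b -> disk z ->
  normc (K b z) * omega z <= C' / (tau b * omega b) * (decay b z ^+ 4 / tau z).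
Proof.
move=> db dz; have := hup db dz; rewrite -decay_X4 => H.
have ob := omega_gt0 db; have tb := tau_gt0 db; have tz := tau_gt0 dz.
rewrite -(@ler_pM2r _ (omega b))// mulrAC (le_trans H)//.
rewrite le_eqVlt; apply/orP; left; apply/eqP; field.
by rewrite !lt0r_neq0.
Qed.

Lemma N_lower b : disk b -> C'' / tau b ^+ 2 <= N b * omega b ^+ 2.
Proof.
move=> db; have := hlow db db; rewrite d_tau_refl//; last exact: tau_gt0.
by move=> /(_ rad0); rewrite -mulrA -!expr2.
Qed.

Lemma N_upper b : disk b -> N b * omega b ^+ 2 <= C' / tau b ^+ 2.
Proof.
move=> db; have := hup db db; rewrite d_tau_refl//; last exact: tau_gt0.
by rewrite mulr0 oppr0 expR0 mulr1 -mulrA -!expr2.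
Qed.

Lemma N_gt0 b : disk b -> 0 < N b.
Proof.
move=> db; have ob := omega_gt0 db; have tb := tau_gt0 db.
have H : 0 < N b * omega b ^+ 2.
  by apply: lt_le_trans (N_lower db); rewrite divr_gt0// exprn_gt0.
by rewrite -(pmulr_lgt0 _ (exprn_gt0 2 ob)).
Qed.

(** * Lower bound for the Skwarczynski pseudodistance *)

Lemma min1_sqr_le (u : R) : 0 <= u -> Num.min 1 u ^+ 2 <= u * Num.sqrt u.
Proof.
move=> u0; have s0 := sqrtr_ge0 u; rewrite /Num.min; case: ltrP => u1.
  have : 1 <= Num.sqrt u by rewrite -sqrtr1 ler_wsqrtr// ltW.
  by rewrite expr1n; nra.
have : Num.sqrt u <= 1 by rewrite -[leRHS]sqrtr1 ler_wsqrtr.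
rewrite -{2 3}(sqr_sqrtr u0); move: (Num.sqrt u) s0 => s s0 s1.
rewrite !expr2; apply: ler_pM => //; rewrite ?mulr_ge0//.
by rewrite ler_piMl.
Qed.

(* Weighting by [|z - b|^2] compensates the unknown factor [1 / tau z ^ 2] in
   the off-diagonal bound, because [decay b z <= A tau z / |z - b|]. *)
Lemma integral_shifted_kernel_le b : disk b ->
  (\int[dA]_(p in D) ((normc (cplx p - b) * normc (K b (cplx p)) * omega (cplx p)) ^+ 2)%:E
   <= (192 * C' ^+ 2 * A ^+ 5 / omega b ^+ 2)%:E)%E.
Proof.
move=> db; set T := tau b; have T0 : 0 < T by exact: tau_gt0.
have ob := omega_gt0 db; have sT : 0 < Num.sqrt T by rewrite sqrtr_gt0.
pose c := (C' * A / (T * omega b)) ^+ 2 * A ^+ 3 * (T * Num.sqrt T).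
have c0 : 0 <= c.
  by rewrite /c; apply: mulr_ge0; [apply: mulr_ge0; [exact: sqr_ge0|rewrite exprn_ge0// ltW]|
    rewrite mulr_ge0 ?ltW].
have mt := @measurable_tail_ker R T b.
have mt' : measurable_fun D (fun p : plane => (tail_ker T (normc (cplx p - b)))%:E : \bar R).
  by apply/measurable_EFinP; exact: measurable_funTS.
have [[hol _] _] := repK db.
apply: (@le_trans _ _ (c%:E * \int[dA]_(p in D) (tail_ker T (normc (cplx p - b)))%:E)%E).
  rewrite -ge0_integralZl_EFin//; [|exact: measurable_disk2|
    by move=> p _; rewrite lee_fin tail_ker_ge0 ?normc_ge0// ltW].
  apply: ae_ge0_le_integral.
  - exact: measurable_disk2.
  - by move=> p _; rewrite lee_fin sqr_ge0.
  - have hf : holomorphic_disk (fun z => (z - b) * k_ b z).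
      move=> z dz; apply: cderivableM; last exact: hol.
      by apply: cderivableB; [exact: cderivable_id|exact: cderivable_cst].
    apply: eq_measurable_fun (measurable_sqnorm momega hf) => p _.
    by rewrite normcM /kernel_fun normc_conj.
  - move=> p _; rewrite -EFinM lee_fin mulr_ge0 ?tail_ker_ge0 ?normc_ge0//; exact: ltW.
  - exact: measurable_funeM.
  exists (cross b); split; [exact: measurable_cross|exact: dA_cross|].
  move=> p /=; apply: contra_notP => /not_cross_neq pb Dp.
  have zb : b <> cplx p by apply/eqP; rewrite eq_sym.
  set v := normc (cplx p - b).
  have vE : normc (b - cplx p) = v by rewrite -opprB normcN.
  have v0 : 0 < v.
    rewrite lt_neqAle normc_ge0 andbT eq_sym; apply: contra pb => /eqP /eq0_normc /eqP.
    by rewrite subr_eq0.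
  have tz := tau_gt0 Dp.
  rewrite -EFinM lee_fin; set E := decay b (cplx p).
  have E0 : 0 <= E by exact: decay_ge0.
  have E1 : E <= 1 by exact: decay_le1.
  have EA : E <= A * Num.min 1 (T / v) by rewrite -vE; exact: decay_le_left.
  have Et : v * (E / tau (cplx p)) <= A.
    by rewrite mulrC -ler_pdivlMr// -vE; exact: decay_le_right.
  have m0 : 0 <= Num.min 1 (T / v) by rewrite le_min ler01 divr_ge0// ltW.
  (* One of the four decay factors pays for v / tau z. The square of the remaining E^3 is bounded by
     E^3 itself, and three factors already suffice for an integrable majorant. *)
  have H1 : v * normc (K b (cplx p)) * omega (cplx p) <= C' * A / (T * omega b) * E ^+ 3.
    apply: (@le_trans _ _ (v * (C' / (T * omega b) * (E ^+ 4 / tau (cplx p))))).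
      by rewrite -mulrA ler_wpM2l ?(ltW v0)//; exact: kernel_decay.
    have -> : v * (C' / (T * omega b) * (E ^+ 4 / tau (cplx p))) =
       C' / (T * omega b) * (v * (E / tau (cplx p))) * E ^+ 3.
      by field; rewrite !lt0r_neq0.
    have -> : C' * A / (T * omega b) * E ^+ 3 = C' / (T * omega b) * A * E ^+ 3.
      by field; rewrite !lt0r_neq0.
    rewrite ler_wpM2r ?exprn_ge0// ler_wpM2l// divr_ge0 ?(ltW hC')//.
    by rewrite mulr_ge0 ?ltW.
  have p0 : 0 <= v * normc (K b (cplx p)) * omega (cplx p).
    by rewrite mulr_ge0 ?(ltW (omega_gt0 Dp))// mulr_ge0 ?normc_ge0.
  apply: (@le_trans _ _ ((C' * A / (T * omega b) * E ^+ 3) ^+ 2)).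
    by rewrite ler_pXn2r ?nnegrE//; apply: le_trans H1.
  rewrite exprMn (_ : c * _ = (C' * A / (T * omega b)) ^+ 2 *
    (A ^+ 3 * (T * Num.sqrt T * tail_ker T v))); last by rewrite /c !mulrA.
  apply: ler_wpM2l; first exact: sqr_ge0.
  apply: (@le_trans _ _ (E ^+ 3)).
    by rewrite [leLHS]expr2 ler_piMl ?exprn_ge0// exprn_ile1.
  apply: (@le_trans _ _ ((A * Num.min 1 (T / v)) ^+ 3)).
    by rewrite ler_pXn2r ?nnegrE// mulr_ge0// ltW.
  rewrite exprMn ler_wpM2l ?exprn_ge0 ?(ltW A0)// exprSr.
  have u0 : 0 <= T / v by rewrite divr_ge0// ltW.
  (* Two of the three factors min(1, T / v) are traded for (T / v)^(3/2), which leaves exactly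
     T^(3/2) times [tail_ker T v]. *)
  apply: (le_trans (ler_wpM2r m0 (min1_sqr_le u0))).
  rewrite sqrtrM ?(ltW T0)// sqrtrV ?(ltW v0)// /tail_ker.
  rewrite le_eqVlt; apply/orP; left; apply/eqP; field.
  by rewrite !lt0r_neq0 ?sqrtr_gt0.
apply: (le_trans (lee_wpmul2l _ (integral_tail_ker_le b T0))); first by rewrite lee_fin.
rewrite -EFinM lee_fin /c.
have sqT : T = Num.sqrt T ^+ 2 by rewrite sqr_sqrtr// ltW.
move: (Num.sqrt T) sT sqT => q q0 ->.
rewrite le_eqVlt; apply/orP; left; apply/eqP; field.
by rewrite !lt0r_neq0.
Qed.

(** 384 = 2 * 192, the 2 coming from |z - a|^2 <= 2 |z - b|^2 + 2 |a - b|^2. *)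
Definition shift_const : R := 384 * C' ^+ 2 * A ^+ 5.

Lemma shift_const_gt0 : 0 < shift_const.
Proof.
apply: mulr_gt0; last exact: exprn_gt0.
by apply: mulr_gt0; [rewrite ltr0n|exact: exprn_gt0].
Qed.

(** Read off from t^2 C'' <= 8 (shift_const + 2 C' t^2) S^2 with t = |a - b| / tau b. *)
Definition sky_const : R := Num.sqrt (C'' / (8 * (shift_const + 2 * C'))).

Lemma sky_const_gt0 : 0 < sky_const.
Proof.
rewrite sqrtr_gt0; apply: divr_gt0 => //; apply: mulr_gt0 => //.
by apply: addr_gt0; [exact: shift_const_gt0|exact: mulr_gt0].
Qed.

Lemma skwarczynski_sym a b : disk a -> disk b ->
  skwarczynski omega K a b = skwarczynski omega K b a.
Proof.
move=> da db; rewrite /skwarczynski (kernel_sym momega repK da db) normc_conj.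
by rewrite [X in _ / X]mulrC.
Qed.

Lemma skwarczynski_lower a b : disk a -> disk b ->
  sky_const * Num.min 1 (normc (a - b) / tau b) <= skwarczynski omega K a b.
Proof.
move=> da db; set T := tau b; have T0 : 0 < T by exact: tau_gt0.
have S0 : 0 <= skwarczynski omega K a b by exact: sqrtr_ge0.
set t := normc _ / T.
have t0 : 0 <= t by rewrite divr_ge0 ?normc_ge0// ltW.
have ob := omega_gt0 db; have Na := N_gt0 da; have Nb := N_gt0 db.
have [ct _] := repK db.
pose f z := (z - a) * k_ b z.
have hf : holomorphic_disk f.
  move=> z dz; apply: cderivableM; last by have [H _] := ct; exact: H.
  by apply: cderivableB; [exact: cderivable_id|exact: cderivable_cst].
pose B := shift_const; have B0 : 0 < B by exact: shift_const_gt0.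
have BE : B = 2 * (192 * C' ^+ 2 * A ^+ 5) by rewrite /B /shift_const; ring.
have BS : shift_const = B by [].
clearbody B.
have fI : (\int[dA]_(p in D) ((normc (f (cplx p)) * omega (cplx p)) ^+ 2)%:E <=
   ((B + 2 * C' * t ^+ 2) / omega b ^+ 2)%:E)%E.
  have hg : holomorphic_disk (fun z => (z - b) * k_ b z).
    move=> z dz; apply: cderivableM; last by have [H _] := ct; exact: H.
    by apply: cderivableB; [exact: cderivable_id|exact: cderivable_cst].
  have m1 := measurable_sqnorm momega hg.
  have m2 := measurable_sqnorm momega ct.1.
  have mm1 := measurable_funeM 2%:E m1.
  have mm2 := measurable_funeM (2 * normc (a - b) ^+ 2)%:E m2.
  have c0 : 0 <= 2 * normc (a - b) ^+ 2 by rewrite mulr_ge0 ?sqr_ge0.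
  have mD := @measurable_disk2 R.
  apply: (@le_trans _ _ (2%:E * \int[dA]_(p in D) ((normc ((cplx p - b) * k_ b (cplx p)) * omega (cplx p)) ^+ 2)%:E +
     (2 * normc (a - b) ^+ 2)%:E * \int[dA]_(p in D) ((normc (k_ b (cplx p)) * omega (cplx p)) ^+ 2)%:E)%E).
    rewrite -!ge0_integralZl_EFin//; try by move=> p _; rewrite lee_fin sqr_ge0.
    rewrite -ge0_integralD//; try by move=> p _; rewrite -EFinM lee_fin mulr_ge0 ?sqr_ge0.
    apply: ge0_le_integral => //.
    - by move=> p _; rewrite lee_fin sqr_ge0.
    - exact: (measurable_sqnorm momega hf).
    - exact: emeasurable_funD.
    move=> p _; rewrite -!EFinM -EFinD lee_fin /f !normcM !exprMn.
    have := le_normcD (cplx p - b) (b - a).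
    rewrite addrA subrK -(opprB a b) normcN.
    have := normc_ge0 (cplx p - a).
    move: (normc (k_ b _) ^+ 2) (sqr_ge0 (normc (k_ b (cplx p)))) => k k0.
    move: (omega (cplx p) ^+ 2) (sqr_ge0 (omega (cplx p))) => q q0.
    move: (normc (cplx p - a)) (normc (cplx p - b)) (normc (a - b)) => u x y u0 uxy.
    have H : u ^+ 2 <= (x + y) ^+ 2 by rewrite ler_pXn2r ?nnegrE// (le_trans u0).
    rewrite -subr_ge0 (_ : _ - _ = (((x + y) ^+ 2 - u ^+ 2) + (x - y) ^+ 2) * k * q); last by ring.
    by rewrite !mulr_ge0// addr_ge0 ?sqr_ge0 ?subr_ge0.
  have -> : (B + 2 * C' * t ^+ 2) / omega b ^+ 2 =
     2 * (192 * C' ^+ 2 * A ^+ 5 / omega b ^+ 2) +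
     2 * normc (a - b) ^+ 2 * (C' / T ^+ 2 / omega b ^+ 2).
    by rewrite BE /t; field; rewrite !lt0r_neq0.
  rewrite [leRHS]EFinD; apply: leeD.
    rewrite [leRHS]EFinM lee_wpmul2l ?lee_fin//.
    under eq_integral do rewrite normcM /kernel_fun normc_conj.
    exact: integral_shifted_kernel_le.
  rewrite [leRHS]EFinM lee_wpmul2l ?lee_fin// (A2_sqnormE (omega := omega))//.
  rewrite lee_fin (kernel_norm repK)// ler_pdivlMr ?exprn_gt0//.
  exact: N_upper.
have fA : A2 omega f by exact: (A2_of_le hf fI).
have fn := A2norm_le fA fI.
have fa0 : f a = 0 by rewrite /f subrr mul0r.
have := vanishing_eval_le momega repK da db fA fa0 Na.
have -> : normc (f b) ^+ 2 = normc (a - b) ^+ 2 * N b ^+ 2.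
  by rewrite /f normcM /kernel_fun normc_conj -(opprB a b) normcN exprMn.
set k := normc (K a b) / (A2norm omega (k_ a) * A2norm omega (k_ b)).
have k0 : 0 <= k by rewrite divr_ge0 ?normc_ge0// mulr_ge0 ?sqrtr_ge0.
have k2 : normc (K a b) ^+ 2 / N a = N b * k ^+ 2.
  rewrite /k expr_div_n exprMn !(kernel_norm repK)//.
  by field; rewrite !lt0r_neq0.
rewrite k2 (_ : N b - N b * k ^+ 2 = N b * (1 - k ^+ 2)); last by ring.
move=> H1.
have {}H1 : normc (a - b) ^+ 2 * N b <= 4 * A2norm omega f ^+ 2 * (1 - k ^+ 2).
  by rewrite -(@ler_pM2r _ (N b))//; apply: le_trans (le_trans H1 _);
    rewrite le_eqVlt; apply/orP; left; apply/eqP; ring.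
have t2 : t ^+ 2 * C'' <= normc (a - b) ^+ 2 * N b * omega b ^+ 2.
  rewrite -mulrA /t expr_div_n -mulrA ler_wpM2l ?sqr_ge0// mulrC.
  exact: N_lower.
pose Q := B + 2 * C' * t ^+ 2.
have Q0 : 0 < Q.
  by rewrite /Q; apply: (lt_le_trans B0); rewrite lerDl; apply: mulr_ge0; rewrite ?sqr_ge0// mulr_ge0// ltW.
have o2 : 0 < omega b ^+ 2 by rewrite exprn_gt0.
have [->|tn0] := eqVneq t 0.
  by rewrite [Num.min _ _](_ : _ = 0) ?mulr0//; apply/min_idPr; exact: ler01.
have tp : 0 < t by rewrite lt_neqAle eq_sym tn0.
(* [A2inner_sqr_le] carries a factor 4 and does not yield k <= 1 directly; k < 1 is deduced instead
   from the positivity of the left side of [H1]. *)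
have k1 : 0 < 1 - k ^+ 2.
  rewrite ltNge; apply/negP => k1.
  have : t ^+ 2 * C'' <= 0.
    apply: (le_trans t2); rewrite pmulr_lle0//; apply: (le_trans H1).
    by apply: mulr_ge0_le0 => //; apply: mulr_ge0 => //; exact: sqr_ge0.
  by rewrite leNgt mulr_gt0// exprn_gt0.
have H2 : t ^+ 2 * C'' <= 4 * Q * (1 - k ^+ 2).
  apply: (le_trans t2).
  apply: (@le_trans _ _ (4 * (Q / omega b ^+ 2) * (1 - k ^+ 2) * omega b ^+ 2)).
    rewrite ler_wpM2r ?(ltW o2)//; apply: (le_trans H1).
    by rewrite ler_wpM2r ?(ltW k1)// ler_wpM2l.
  by rewrite le_eqVlt; apply/orP; left; apply/eqP; field; exact: lt0r_neq0.
have kl1 : k < 1 by rewrite -(@expr_lt1 _ 2)// -subr_gt0.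
have H3 : t ^+ 2 * C'' <= 8 * Q * (1 - k).
  apply: (le_trans H2); rewrite (_ : 8 * Q * (1 - k) = 4 * Q * (2 * (1 - k))); last by ring.
  rewrite ler_wpM2l ?mulr_ge0 ?(ltW Q0)//.
  rewrite (_ : 1 - k ^+ 2 = (1 + k) * (1 - k)); last by ring.
  by rewrite ler_wpM2r; lra.
rewrite /skwarczynski -/k /sky_const BS.
set m := Num.min 1 t.
have m0 : 0 <= m by rewrite le_min ler01 t0.
rewrite -{1}[m]ger0_norm// -sqrtr_sqr -sqrtrM; last first.
  by rewrite divr_ge0 ?(ltW hC'')// mulr_ge0// ltW// addr_gt0// mulr_gt0.
apply: ler_wsqrtr.
have Bc : 0 < B + 2 * C' by rewrite addr_gt0// mulr_gt0.
rewrite mulrAC ler_pdivrMr ?mulr_gt0//.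
(* [Q] grows like t^2, so the bound saturates for t >= 1; this is why min(1, t) appears instead of
   t. *)
have Hm : m ^+ 2 * Q <= t ^+ 2 * (B + 2 * C').
  have t20 : 0 <= t ^+ 2 by exact: sqr_ge0.
  rewrite /m /Num.min /Q; case: ltrP => t1.
    have : 1 <= t ^+ 2 by rewrite expr_ge1// ltW.
    by rewrite expr1n mul1r; move: (t ^+ 2) t20 => y y0 y1; nra.
  have : t ^+ 2 <= 1 by rewrite expr_le1.
  by move: (t ^+ 2) t20 => y y0 y1; rewrite ler_wpM2l// lerD2l ler_piMr// mulr_ge0// ltW.
rewrite -(@ler_pM2r _ Q)//.
apply: (@le_trans _ _ (C'' * (t ^+ 2 * (B + 2 * C')))).
  by rewrite -mulrA ler_wpM2l// ltW.
rewrite (_ : C'' * _ = t ^+ 2 * C'' * (B + 2 * C')); last by ring.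
rewrite (_ : (1 - k) * _ * Q = 8 * Q * (1 - k) * (B + 2 * C')); last by ring.
by rewrite ler_wpM2r// ltW.
Qed.

(** * Supporting lines of eta in ln r, and their slope where tau is large compared with the
    modulus *)

Definition log_tangent b x := forall r, 0 < r < 1 ->
  eta (normc b)%:C + x * ln (r / normc b) <= eta r%:C.

Lemma log_tangent_exists b : disk b -> 0 < normc b -> exists x, log_tangent b x.
Proof.
move=> db b0; apply: (radial_log_convex (weight_radial we) (weight_second_partials we) (weight_laplacian we)).
by rewrite b0.
Qed.

Lemma omega_normc z : disk z -> omega z = expR (- eta (normc z)%:C).
Proof.
move=> dz; have dn : disk (normc z)%:C.
  by rewrite /disk/mkset normc_real ger0_norm ?normc_ge0.
rewrite -(weight_exp we dn); apply: omega_radial => //.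
by rewrite normc_real ger0_norm ?normc_ge0.
Qed.

Lemma sqrtr_expR x : Num.sqrt (expR x) = expR (x / 2).
Proof.
have -> : expR x = expR (x / 2) ^+ 2 by rewrite -expRM_natl; congr expR; field.
by rewrite sqrtr_sqr ger0_norm// expR_ge0.
Qed.

(** With L = ln (|z| / |b|), the supporting line bounds the left side, relative to its value at b,
    by exp(-(x - n) L). The window for x - n gives exponent 3/2 inside the circle of b, still
    integrable at the origin, and decay with exponent 1/2 outside. *)
Lemma power_omega_le b z x n : disk b -> disk z -> 0 < normc b -> 0 < normc z ->
  log_tangent b x -> 2^-1 <= x - n%:R <= 3 / 2 ->
  normc z ^+ n * omega z <= normc b ^+ n * omega b *
   (if normc z < normc b then normc b / normc z * Num.sqrt (normc b / normc z)
    else Num.sqrt (normc b / normc z)).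
Proof.
move=> db dz b0 z0 tan xn; set L := ln (normc z / normc b).
have zb : normc b / normc z = expR (- L).
  by rewrite expRN lnK ?posrE ?divr_gt0// invf_div.
have -> : normc z ^+ n = normc b ^+ n * expR (n%:R * L).
  rewrite expRM_natl lnK ?posrE ?divr_gt0// -exprMn mulrC divfK//.
  exact: lt0r_neq0.
rewrite zb !omega_normc// -!mulrA ler_wpM2l ?exprn_ge0 ?(ltW b0)//.
have := tan (normc z); rewrite -/L z0 => /(_ dz) H.
have H1 : n%:R * L - eta (normc z)%:C <= - eta (normc b)%:C - (x - n%:R) * L by lra.
rewrite -expRD; case: ltrP => zb'.
- have L0 : L <= 0 by rewrite ln_le0// ler_pdivrMr// mul1r ltW.
  rewrite sqrtr_expR -!expRD ler_expR (le_trans H1)//.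
  have : 0 <= (3 / 2 - (x - n%:R)) * - L by rewrite mulr_ge0 ?oppr_ge0 ?subr_ge0//; case/andP: xn.
  by lra.
- have L0 : 0 <= L by rewrite ln_ge0// ler_pdivlMr// mul1r.
  rewrite sqrtr_expR -!expRD ler_expR (le_trans H1)//.
  have : 0 <= ((x - n%:R) - 2^-1) * L by rewrite mulr_ge0 ?subr_ge0//; case/andP: xn.
  by lra.
Qed.

(** 16 = 2 (2 + 6): the factor of [A2inner_le] times the two coefficients of [slope_tail_le]; 192 is
    the constant of [integral_tail_ker_le]. *)
Definition slope_const : R := 16 * 192 * C' * A ^+ 2.

Lemma slope_const_gt0 : 0 < slope_const.
Proof.
apply: mulr_gt0; last exact: exprn_gt0.
apply: mulr_gt0; last exact: hC'.
by apply: mulr_gt0; rewrite ltr0n.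
Qed.

(** Makes |b| <= center_const T incompatible with T <= slope_const sqrt(|b| T), the inequality that
    reproducing a monomial at b would force. *)
Definition center_const : R := ((slope_const + 1) ^+ 2)^-1.

Lemma center_const_gt0 : 0 < center_const.
Proof. by rewrite invr_gt0 exprn_gt0// ltr_wpDl// ltW// slope_const_gt0. Qed.

Lemma center_const_le1 : center_const <= 1.
Proof.
have s0 := slope_const_gt0; have s1 : 0 < slope_const + 1 by rewrite addr_gt0.
by rewrite invf_le1 ?exprn_gt0// expr_ge1 ?(ltW s1)// lerDr ltW.
Qed.

(* If the slope [x] were at least [1/2], the monomial [z^n] with [n] the integer
   part of [x - 1/2] would be too concentrated on the scale [|b|], much smaller
   than [tau b], to be reproduced at [b] by a kernel spread over the scale [tau b]. *)
Lemma slope_small b x : disk b -> 0 < normc b -> normc b <= center_const * tau b ->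
  log_tangent b x -> x < 2^-1.
Proof.
move=> db b0 bT tan; rewrite ltNge; apply/negP => x2.
set T := tau b in bT *; have T0 : 0 < T by exact: tau_gt0.
set rho := normc b in b0 bT *.
have ob := omega_gt0 db.
pose n := Num.truncn (x - 2^-1).
have xn : 2^-1 <= x - n%:R <= 3 / 2.
  have := @truncn_itv R (x - 2^-1); rewrite subr_ge0 x2 => /(_ isT) /andP[].
  by rewrite -/n -[n.+1%:R]natr1; lra.
have rhoT : rho <= T.
  by apply: (le_trans bT); rewrite ler_piMl ?center_const_le1// ltW.
have fA := A2_X n; have [kA _] := repK db.
have := A2inner_le momega fA kA.
rewrite -(kernel_reproduces repK db fA) normcX -/rho => H.
have mD := @measurable_disk2 R.
pose c := rho ^+ n * (C' * A ^+ 2 / T).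
have rn : 0 < rho ^+ n by rewrite exprn_gt0.
have c0 : 0 < c by rewrite /c mulr_gt0// divr_gt0// mulr_gt0// exprn_gt0.
have srho : 0 < Num.sqrt rho by rewrite sqrtr_gt0.
pose c1 := c * (2 * Num.sqrt rho); pose c2 := c * (6 * Num.sqrt rho).
have c10 : 0 <= c1.
  by apply: mulr_ge0; [exact: ltW|apply: mulr_ge0; [rewrite ler0n|exact: ltW]].
have c20 : 0 <= c2.
  by apply: mulr_ge0; [exact: ltW|apply: mulr_ge0; [rewrite ler0n|exact: ltW]].
have mt0 : measurable_fun D (fun p : plane => (tail_ker rho (normc (cplx p - 0)))%:E : \bar R).
  by apply/measurable_EFinP; apply: measurable_funTS; exact: measurable_tail_ker.
have mtb : measurable_fun D (fun p : plane => (tail_ker T (normc (cplx p - b)))%:E : \bar R).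
  by apply/measurable_EFinP; apply: measurable_funTS; exact: measurable_tail_ker.
have mt0' := measurable_funeM c1%:E mt0; have mtb' := measurable_funeM c2%:E mtb.
have nn0 p : 0 <= tail_ker rho (normc (cplx p - 0)) by rewrite tail_ker_ge0 ?normc_ge0// ltW.
have nnb p : 0 <= tail_ker T (normc (cplx p - b)) by rewrite tail_ker_ge0 ?normc_ge0// ltW.
have I : (\int[dA]_(p in D) (normc (cplx p ^+ n) * normc (k_ b (cplx p)) * omega (cplx p) ^+ 2)%:E <=
    c1%:E * \int[dA]_(p in D) (tail_ker rho (normc (cplx p - 0)))%:E +
    c2%:E * \int[dA]_(p in D) (tail_ker T (normc (cplx p - b)))%:E)%E.
  rewrite -!ge0_integralZl_EFin//; try by move=> p _; rewrite lee_fin.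
  rewrite -ge0_integralD//; try by move=> p _; rewrite -EFinM lee_fin; exact: mulr_ge0.
  apply: ae_ge0_le_integral => //.
  - move=> p Dp; rewrite lee_fin mulr_ge0 ?sqr_ge0//.
    by rewrite mulr_ge0 ?normc_ge0.
  - exact: (measurable_normcM momega (@holomorphicX n) kA.1).
  - by move=> p _; rewrite -!EFinM -EFinD lee_fin; apply: addr_ge0; exact: mulr_ge0.
  - exact: emeasurable_funD.
  exists (cross b `|` cross 0); split.
  - by apply: measurableU; exact: measurable_cross.
  - have : (dA (cross b `|` cross 0%R) <= dA (cross b) + dA (cross 0%R))%E.
      by apply: measureU2; exact: measurable_cross.
    by rewrite !dA_cross adde0 => H0; apply/eqP; rewrite eq_le measure_ge0 andbT; exact: H0.
  move=> p; apply: contra_notP => /not_orP[/not_cross_neq pb /not_cross_neq p0] Dp.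
  set z := cplx p in pb p0 *.
  have dz : disk z by [].
  have zb : b <> z by apply/eqP; rewrite eq_sym.
  rewrite -!EFinM -EFinD lee_fin subr0.
  set v := normc (z - b); set r := normc z.
  have vE : normc (b - z) = v by rewrite -opprB normcN.
  have pos w : w != 0 -> 0 < normc w.
    by move=> w0; rewrite lt_neqAle normc_ge0 andbT eq_sym; apply: contra w0 => /eqP /eq0_normc ->.
  have v0 : 0 < v by apply: pos; rewrite subr_eq0.
  have r0 : 0 < r by exact: pos.
  have tri1 : rho <= v + r by rewrite -vE /rho -{1}(subrK z b); exact: le_normcD.
  have tri2 : v <= rho + r by rewrite addrC -[rho]normcN; exact: le_normcD.
  have oz := omega_gt0 dz; have tz := tau_gt0 dz.
  set E := decay b z.
  have E0 : 0 <= E by exact: decay_ge0.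
  have E1 : E <= 1 by exact: decay_le1.
  have EA : E <= A * Num.min 1 (T / v) by rewrite -vE; exact: decay_le_left.
  have Et : E / tau z <= A / v by rewrite -vE; exact: decay_le_right.
  have m0 : 0 <= Num.min 1 (T / v) by rewrite le_min ler01 divr_ge0// ltW.
  set h := if r < rho then rho / r * Num.sqrt (rho / r) else Num.sqrt (rho / r).
  have h0 : 0 <= h.
    rewrite /h; case: ifP => _; last exact: sqrtr_ge0.
    by rewrite mulr_ge0 ?sqrtr_ge0// divr_ge0// ltW.
  have P1 : r ^+ n * omega z <= rho ^+ n * omega b * h by exact: power_omega_le tan xn.
  (* Of the four decay factors two are dropped as at most 1, one absorbs 1 / tau z, and one supplies
     the cutoff at scale [T]. *)
  have P2 : E ^+ 4 / tau z <= A ^+ 2 * (Num.min 1 (T / v) / v).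
    have -> : E ^+ 4 / tau z = E ^+ 2 * (E * (E / tau z)) by ring.
    apply: (@le_trans _ _ (E * (E / tau z))).
      by rewrite ler_piMl ?exprn_ile1// mulr_ge0// divr_ge0// ltW.
    apply: (@le_trans _ _ ((A * Num.min 1 (T / v)) * (A / v))).
      by apply: ler_pM => //; rewrite divr_ge0// ltW.
    by rewrite le_eqVlt; apply/orP; left; apply/eqP; ring.
  have P3 : normc (K b z) * omega z <= C' / (T * omega b) * (A ^+ 2 * (Num.min 1 (T / v) / v)).
    apply: (le_trans (kernel_decay db dz)); rewrite ler_wpM2l//.
    by rewrite divr_ge0 ?(ltW hC')// mulr_ge0 ?ltW.
  have P4 : h * (Num.min 1 (T / v) / v) <= 2 * Num.sqrt rho * tail_ker rho r + 6 * Num.sqrt rho * tail_ker T v.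
    exact: slope_tail_le.
  rewrite normcX /kernel_fun normc_conj -/r.
  have -> : r ^+ n * normc (K b z) * omega z ^+ 2 = (r ^+ n * omega z) * (normc (K b z) * omega z) by ring.
  apply: (@le_trans _ _ ((rho ^+ n * omega b * h) * (C' / (T * omega b) * (A ^+ 2 * (Num.min 1 (T / v) / v))))).
    apply: ler_pM => //; first by rewrite mulr_ge0 ?exprn_ge0 ?(ltW r0)// ltW.
    by rewrite mulr_ge0 ?normc_ge0// ltW.
  have -> : (rho ^+ n * omega b * h) * (C' / (T * omega b) * (A ^+ 2 * (Num.min 1 (T / v) / v))) =
     c * (h * (Num.min 1 (T / v) / v)).
    by rewrite /c; field; rewrite !lt0r_neq0.
  apply: (le_trans (ler_wpM2l (ltW c0) P4)).
  by rewrite mulrDr /c1 /c2 -!(mulrA c).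
have sT : 0 < Num.sqrt T by rewrite sqrtr_gt0.
have H2 : rho ^+ n <= 2 * (c1 * (192 * Num.sqrt rho) + c2 * (192 * Num.sqrt T)).
  rewrite -lee_fin; apply: (le_trans H); rewrite [leRHS]EFinM lee_wpmul2l//.
  apply: (le_trans I); rewrite EFinD; apply: leeD; rewrite [leRHS]EFinM lee_wpmul2l ?lee_fin//.
    exact: integral_tail_ker_le.
  exact: integral_tail_ker_le.
have srT : Num.sqrt rho <= Num.sqrt T by rewrite ler_wsqrtr.
have H3 : T <= slope_const * (Num.sqrt rho * Num.sqrt T).
  have H4 : rho ^+ n * T <= rho ^+ n * (slope_const * (Num.sqrt rho * Num.sqrt T)).
    rewrite -ler_pdivlMr//; apply: (le_trans H2).
    rewrite ler_pdivlMr//.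
    have -> : 2 * (c1 * (192 * Num.sqrt rho) + c2 * (192 * Num.sqrt T)) * T =
      rho ^+ n * (C' * A ^+ 2 * 192 * (4 * (Num.sqrt rho * Num.sqrt rho) + 12 * (Num.sqrt rho * Num.sqrt T))).
      by rewrite /c1 /c2 /c; field; exact: lt0r_neq0.
    rewrite ler_wpM2l ?(ltW rn)// /slope_const.
    rewrite (_ : 16 * 192 * C' * A ^+ 2 * _ = C' * A ^+ 2 * 192 * (16 * (Num.sqrt rho * Num.sqrt T))); last by ring.
    apply: ler_wpM2l.
      apply: mulr_ge0; last by rewrite ler0n.
      by apply: mulr_ge0; [exact: ltW|exact/exprn_ge0/ltW].
    have := ler_wpM2l (ltW srho) srT; lra.
  by rewrite ler_pM2l in H4.
have sc0 := slope_const_gt0.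
have H5 : (slope_const + 1) * Num.sqrt rho <= Num.sqrt T.
  rewrite -[X in X * _]ger0_norm; last by rewrite addr_ge0// ltW.
  rewrite -sqrtr_sqr -sqrtrM ?sqr_ge0// ler_wsqrtr//.
  move: bT; rewrite /center_const mulrC ler_pdivlMr ?exprn_gt0 ?addr_gt0//.
  by rewrite mulrC.
have TT : Num.sqrt T * Num.sqrt T = T by rewrite -expr2 sqr_sqrtr// ltW.
have H6 : Num.sqrt T <= slope_const * Num.sqrt rho.
  by rewrite -(ler_pM2r sT) TT -mulrA.
by move: H5 H6 srho; rewrite mulrDl mul1r; lra.
Qed.

(** * Lower bound for tau near the centre *)

Definition ratio_const : R := 2 * Num.sqrt (C' / C'').

Lemma ratio_const_gt0 : 0 < ratio_const.
Proof. by rewrite mulr_gt0// sqrtr_gt0 divr_gt0. Qed.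

Lemma disk_normc_le z b : disk b -> normc z <= normc b -> disk z.
Proof. by move=> db zb; apply: le_lt_trans db. Qed.

(** On the circle of radius |b| the diagonal of K is at most a constant Q, by radiality of omega and
    tau, so |K(z, w)|^2 <= 4 K(z, z) Q there. The maximum principle for w -> conj K(z, w), evaluated
    at w = z, gives K(z, z)^2 <= 4 K(z, z) Q. *)
Lemma kernel_max_modulus b z : disk b -> normc z < normc b ->
  N z * omega b ^+ 2 <= 4 * C' / tau b ^+ 2.
Proof.
move=> db zb; have dz : disk z := disk_normc_le db (ltW zb).
have ob := omega_gt0 db; have tb := tau_gt0 db; have Nz := N_gt0 dz.
have ob2 : 0 < omega b ^+ 2 by rewrite exprn_gt0.
pose Q := C' / tau b ^+ 2 / omega b ^+ 2.
have Q0 : 0 <= Q by rewrite divr_ge0 ?divr_ge0 ?sqr_ge0// ltW.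
have Qw w : normc w = normc b -> N w <= Q.
  move=> wb; have dw : disk w by apply: (disk_normc_le db); rewrite wb.
  have := N_upper dw; rewrite (omega_radial dw db wb) (classW_radial cW dw db wb).
  by rewrite -ler_pdivlMr.
have [[hk _] _] := repK dz.
have := @max_modulus R (k_ z) (normc b) z (Num.sqrt (4 * N z * Q)) zb.
rewrite /kernel_fun normc_conj => H.
have {}H : N z <= Num.sqrt (4 * N z * Q).
  apply: H => w wb; first by apply: hk; exact: disk_normc_le wb.
  have dw : disk w by apply: (disk_normc_le db); rewrite wb.
  rewrite normc_conj -[leLHS]ger0_norm ?normc_ge0// -sqrtr_sqr ler_wsqrtr//.
  apply: (le_trans (kernel_sqr_le momega repK dz dw)).
  by rewrite ler_wpM2l ?Qw// mulr_ge0// ltW.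
have {}H : N z * N z <= 4 * N z * Q.
  have s0 := sqrtr_ge0 (4 * N z * Q).
  have := ler_pM (ltW Nz) (ltW Nz) H H.
  by rewrite -[X in _ <= X -> _]expr2 sqr_sqrtr// mulr_ge0// mulr_ge0// ltW.
have {}H : N z <= 4 * Q by rewrite -(ler_pM2l Nz) (_ : N z * (4 * Q) = 4 * N z * Q)//; ring.
rewrite -ler_pdivlMr//; apply: (le_trans H); by rewrite /Q !mulrA.
Qed.

(** A slope below 1/2 gives omega(z)^2 <= omega(b)^2 |b| / |z|. The diagonal bounds compare omega^2
    K(z, z) with 1 / tau^2, so one power of |b| / |z| becomes a square root for tau. *)
Lemma tau_ratio_center b z : disk b -> 0 < normc b -> normc b <= center_const * tau b ->
  normc z <= normc b -> tau b * Num.sqrt (normc z / normc b) <= ratio_const * tau z.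
Proof.
move=> db b0 bT zb; have dz := disk_normc_le db zb.
have tb := tau_gt0 db; have tz := tau_gt0 dz; have rc := ratio_const_gt0.
have [z0|z0] := eqVneq (normc z) 0.
  by rewrite z0 mul0r sqrtr0 mulr0 mulr_ge0// ltW.
have zp : 0 < normc z by rewrite lt_neqAle eq_sym z0 normc_ge0.
have ob := omega_gt0 db; have oz := omega_gt0 dz.
have [x tan] := log_tangent_exists db b0.
have x2 := slope_small db b0 bT tan.
have oo : omega z ^+ 2 <= omega b ^+ 2 * (normc b / normc z).
  rewrite !omega_normc//; set L := ln (normc z / normc b).
  have -> : normc b / normc z = expR (- L) by rewrite expRN lnK ?posrE ?divr_gt0// invf_div.
  rewrite -!expRM_natl -expRD ler_expR.
  have := tan (normc z); rewrite zp => /(_ dz); rewrite -/L => H.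
  have L0 : L <= 0 by rewrite ln_le0// ler_pdivrMr// mul1r.
  have : 0 <= (2^-1 - x) * - L by rewrite mulr_ge0 ?oppr_ge0// subr_ge0 ltW.
  by lra.
have Nz : N z * omega b ^+ 2 <= 4 * C' / tau b ^+ 2.
  move: zb; rewrite le_eqVlt => /predU1P[zb|zb]; last exact: kernel_max_modulus.
  have := N_upper dz; rewrite (omega_radial dz db zb) (classW_radial cW dz db zb).
  move/le_trans; apply; apply: ler_wpM2r; first by rewrite invr_ge0 sqr_ge0.
  by rewrite ler_peMl ?(ltW hC')// ler1n.
(* Taking square roots here produces [ratio_const]. *)
have H : C'' / tau z ^+ 2 <= 4 * C' / tau b ^+ 2 * (normc b / normc z).
  apply: (le_trans (N_lower dz)).
  apply: (@le_trans _ _ (N z * (omega b ^+ 2 * (normc b / normc z)))).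
    by rewrite ler_wpM2l ?normc_ge0.
  by rewrite mulrA ler_wpM2r// divr_ge0// ltW.
rewrite -(@ler_pXn2r _ 2) ?nnegrE ?mulr_ge0 ?sqrtr_ge0 ?(ltW tb) ?(ltW tz) ?(ltW rc)//.
rewrite !exprMn !sqr_sqrtr ?divr_ge0 ?(ltW hC') ?(ltW hC'') ?(ltW zp) ?(ltW b0)//.
have q0 : 0 < tau z ^+ 2 * tau b ^+ 2 * (normc z / normc b) / C''.
  by rewrite !mulr_gt0 ?exprn_gt0 ?divr_gt0 ?invr_gt0.
have := ler_wpM2r (ltW q0) H.
rewrite (_ : C'' / tau z ^+ 2 * _ = tau b ^+ 2 * (normc z / normc b)); last first.
  by field; rewrite !lt0r_neq0.
move/le_trans; apply.
by rewrite le_eqVlt; apply/orP; left; apply/eqP; field; rewrite !lt0r_neq0.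
Qed.

(** * Comparison of d_tau with Euclidean distance, and the conclusion *)

Definition gap_const : R := away_const (C 1) center_const.

Lemma gap_const_gt0 : 0 < gap_const.
Proof.
rewrite /gap_const /away_const !divr_gt0 ?mulr_gt0 ?expR_gt0 ?center_const_gt0//.
by apply: lt_trans (hC ltr01).
Qed.

Lemma gap_const_le1 : gap_const <= 1.
Proof.
have C1 := hC ltr01; have c0 := center_const_gt0; have c1 := center_const_le1.
have e0 := expR_gt0 (-2 : R).
have e1 : expR (-2) <= 1 :> R by have := ler_expR (-2 : R) 0; rewrite expR0 oppr_le0 ler0n.
rewrite /gap_const /away_const ler_pdivrMr; last by lra.
have : center_const * expR (-2) <= 1 by rewrite mulr_ile1// ltW.
lra.
Qed.

Definition dist_const : R := 10 * ratio_const + 9 / gap_const.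

Lemma dist_const_gt0 : 0 < dist_const.
Proof.
apply: addr_gt0; first by apply: mulr_gt0; [rewrite ltr0n|exact: ratio_const_gt0].
by apply: divr_gt0; [rewrite ltr0n|exact: gap_const_gt0].
Qed.

Lemma distance_estimate1 z w : disk z -> disk w -> z <> w ->
  expR (- d z w) <= C 1 * (Num.min (tau z) (tau w) / normc (z - w)).
Proof.
move=> dz dw zw; have := hdist ltr01 dz dw zw; rewrite powRr1//.
by rewrite divr_ge0 ?normc_ge0// le_min !ltW ?tau_gt0.
Qed.

(** [center_const] separates the two regimes, and [dist_const] adds their constants so as to serve
    both. The case b = 0, where polar angles relative to b make no sense, forces a = b. *)
Lemma d_tau_le_dist a b : disk b -> normc a <= normc b ->
  normc (a - b) <= gap_const * tau b ->
  d a b <= dist_const * (normc (a - b) / tau b) /\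
  d b a <= dist_const * (normc (a - b) / tau b).
Proof.
move=> db ab tab; have tb := tau_gt0 db; have da := disk_normc_le db ab.
have m0 := normc_ge0 (a - b); have g0 := gap_const_gt0; have r0 := ratio_const_gt0.
have t0 : 0 <= normc (a - b) / tau b by rewrite divr_ge0// ltW.
have [b0|b0] := eqVneq b 0.
  have a0 : a = 0.
    by apply: eq0_normc; apply/eqP; rewrite eq_le normc_ge0 andbT (le_trans ab)// b0 normc0.
  have L0 := mulr_ge0 (ltW dist_const_gt0) t0.
  by rewrite a0 b0 in L0 *; rewrite d_tau_refl; [|exact: tau_gt0|exact: disk0].
have bp : 0 < normc b.
  by rewrite lt_neqAle normc_ge0 andbT eq_sym; apply: contra b0 => /eqP/eq0_normc->.
rewrite /dist_const mulrDl; set t := normc (a - b) / tau b in t0 *.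
have [c|c] := lerP (normc b) (center_const * tau b).
  have [h1 h2] := d_tau_le_sqrt_profile tau_gt0 db b0 ab (ltW r0)
    (fun z => tau_ratio_center db bp c).
  have e : 0 <= 9 / gap_const * t by apply: mulr_ge0 => //; apply: divr_ge0; exact: ltW.
  by split; [apply: (le_trans h1)|apply: (le_trans h2)]; rewrite lerDl.
have H z : normc a <= normc z <= normc b -> gap_const * tau b <= tau z.
  move=> /andP[za zb].
  apply: (tau_lower_away tau_gt0 (classW_radial cW) (classW_differentiable cW)
    (lt_trans ltr01 (hC ltr01)) distance_estimate1 db) => //.
  - by rewrite center_const_gt0 center_const_le1.
  - exact: ltW.
  - exact: gap_const_le1.
  - apply: le_trans tab; apply: le_trans (normc_dist_le a b); lra.
have [h1 h2] := d_tau_le_lower_bound tau_gt0 db b0 ab (mulr_gt0 g0 tb) H.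
have E : 9 * normc (a - b) / (gap_const * tau b) = 9 / gap_const * t.
  by rewrite /t; field; rewrite !lt0r_neq0.
rewrite E in h1 h2.
have e : 0 <= 10 * ratio_const * t by apply: mulr_ge0 => //; rewrite mulr_ge0// ltW.
by split; [apply: (le_trans h1)|apply: (le_trans h2)]; rewrite lerDr.
Qed.

(** The first term serves t = |a - b| / tau b up to [gap_const], through 1 - exp(-x) <= x. The
    second serves larger t, where 1 - exp(-x) <= 1 and S is bounded below. *)
Definition rho_const : R := dist_const / sky_const + (sky_const * gap_const)^-1.

Lemma rho_const_gt0 : 0 < rho_const.
Proof.
have s0 := sky_const_gt0; have g0 := gap_const_gt0; have d0 := dist_const_gt0.
apply: addr_gt0; first exact: divr_gt0.
by rewrite invr_gt0; exact: mulr_gt0.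
Qed.

(** [x] stands for d_tau from a to b or from b to a, depending on which of the two given points has
    the larger modulus. *)
Lemma rho_le_skwarczynski a b x : disk a -> disk b -> 0 <= x ->
  (normc (a - b) <= gap_const * tau b -> x <= dist_const * (normc (a - b) / tau b)) ->
  1 - expR (- x) <= rho_const * skwarczynski omega K a b.
Proof.
move=> da db x0 H; have tb := tau_gt0 db; have s0 := sky_const_gt0.
have g0 := gap_const_gt0; have d0 := dist_const_gt0.
have t0 : 0 <= normc (a - b) / tau b by rewrite divr_ge0 ?normc_ge0// ltW.
have := skwarczynski_lower da db; set S := skwarczynski _ _ _ _; set t := _ / tau b in t0 H *.
have S0 : 0 <= S by exact: sqrtr_ge0.
have r1 : 0 <= dist_const / sky_const * S by apply: mulr_ge0 => //; apply: divr_ge0; exact: ltW.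
have r2 : 0 <= (sky_const * gap_const)^-1 * S.
  by apply: mulr_ge0 => //; rewrite invr_ge0 ltW// mulr_gt0.
rewrite /rho_const mulrDl => SL.
have [tg|tg] := lerP t gap_const.
  have t1 : Num.min 1 t = t by apply/min_idPr; exact: le_trans gap_const_le1.
  rewrite t1 in SL; have {}H : x <= dist_const * t by apply: H; rewrite -ler_pdivrMr.
  have e : 1 - expR (- x) <= x by have := expR_ge1Dx (- x); lra.
  apply: (le_trans e); apply: (le_trans H); apply: (@le_trans _ _ (dist_const / sky_const * S)).
    by rewrite -mulrA ler_wpM2l ?(ltW d0)// mulrC ler_pdivlMr// mulrC.
  by rewrite lerDl.
have {}SL : sky_const * gap_const <= S.
  apply: le_trans SL; rewrite ler_wpM2l ?(ltW s0)// le_min gap_const_le1; exact: ltW.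
have e : 1 - expR (- x) <= 1 by have := expR_gt0 (- x); lra.
apply: (le_trans e); apply: (@le_trans _ _ ((sky_const * gap_const)^-1 * S)).
  by rewrite mulrC ler_pdivlMr ?mul1r// mulr_gt0.
by rewrite lerDr.
Qed.

Lemma rho_tau_le_skwarczynski z w : disk z -> disk w ->
  rho_tau tau z w <= rho_const * skwarczynski omega K z w.
Proof.
move=> dz dw; rewrite /rho_tau; have [zw|/ltW wz] := lerP (normc z) (normc w).
  by apply: rho_le_skwarczynski => //; [exact: d_ge0|move=> /(d_tau_le_dist dw zw)[]].
rewrite skwarczynski_sym//; apply: rho_le_skwarczynski => //; first exact: d_ge0.
by move=> /(d_tau_le_dist dz wz)[].
Qed.

End Estimates.

Theorem theorem3p2 (R : realType) (C : R -> R) (C' C'' sigma : R)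
    (hC : forall M, 0 < M -> 1 < C M)
    (hC' : 0 < C') (hC'' : 0 < C'') (hsigma : 0 < sigma) :
  exists C3 : R, 0 < C3 /\
    forall (omega eta tau : R[i] -> R) (K : R[i] -> R[i] -> R[i]) (rad : R),
      classW omega eta tau ->
      reproducing_kernel omega K ->
      0 < rad ->
      distance_estimate tau C ->
      kernel_upper_estimate omega tau K C' sigma ->
      kernel_lower_estimate omega tau K C'' rad ->
      forall z w : R[i], disk z -> disk w ->
        rho_tau tau z w <= C3 * skwarczynski omega K z w.
Proof.
exists (rho_const C C' C'' sigma); split; first exact: rho_const_gt0.
move=> omega eta tau K rad cW repK rad0 hdist hup hlow z w dz dw.
exact: (rho_tau_le_skwarczynski hC hC' hC'' hsigma cW repK rad0 hdist hup hlow dz dw).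
Qed.
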